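(* Let $\mathfrak g$ be a $2$-step nilpotent real Lie algebra of dimension $7$ whose commutator $\mathfrak g'=[\mathfrak g,\mathfrak g]$ has dimension $2$ or $3$. Let $\varphi$ be a coclosed $\mathrm G_2$-structure on $\mathfrak g$, let $\lambda\in\mathbb R$, and let $\nabla^\lambda$ be the connection defined by $\varphi$ and $\lambda$. If $\nabla^\lambda$ is a $\mathrm G_2$-instanton, then $\varphi$ calibrates $\mathfrak g'$, $\varphi$ is not purely coclosed, and $\nabla^\lambda\varphi=0$.
   Context: Notation: $e^{ij\cdots}=e^i\wedge e^j\wedge\cdots$; $d$ is the Chevalley–Eilenberg differential, $d\xi(x,y)=-\xi([x,y])$. $2$-step nilpotent means $[\mathfrak g,\mathfrak g]\ne0$, $[\mathfrak g,[\mathfrak g,\mathfrak g]]=0$. A $\mathrm G_2$-structure on $\mathfrak g$ is $\varphi\in\Lambda^3\mathfrak g^*$ that in some basis of $\mathfrak g^*$ equals $e^{127}+e^{347}+e^{567}+e^{135}-e^{146}-e^{236}-e^{245}$. It determines an inner product $g$ and volume form by $(x\lrcorner\varphi)\wedge(y\lrcorner\varphi)\wedge\varphi=6g(x,y)\mathrm{vol}$ (such a basis is orthonormal and positively oriented), hence a Hodge star $\star$; put $\psi=\star\varphi$. $\varphi$ is coclosed if $d\psi=0$, and purely coclosed if moreover $\varphi\wedge d\varphi=0$. $\varphi$ calibrates a subspace $\mathfrak c\subset\mathfrak g$ if $\dim\mathfrak c=3$ and $\mathfrak c$ has an orthonormal basis $\{z_1,z_2,z_3\}$ with $\varphi(z_1,z_2,z_3)=\pm1$.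 The metric connection $\nabla^\lambda$ is defined by $g(\nabla^\lambda_xy,z)=g(\nabla^g_xy,z)+\frac\lambda2T(x,y,z)$, $x,y,z\in\mathfrak g$, where $\nabla^g$ is the Levi-Civita connection of the left-invariant metric $g$ on a Lie group with Lie algebra $\mathfrak g$ and $T=\frac16\star(d\varphi\wedge\varphi)\varphi-\star d\varphi$. Its curvature is $R^\lambda_{x,y}=[\nabla^\lambda_x,\nabla^\lambda_y]-\nabla^\lambda_{[x,y]}$, and it is a $\mathrm G_2$-instanton if $R^\lambda\wedge\psi=0$, i.e. for all $u,v$ the 2-form $(x,y)\mapsto g(R^\lambda_{x,y}u,v)$ wedged with $\psi$ vanishes. *)

(* Defs.v *)
From HB Require Import structures.
From mathcomp Require Import all_boot all_order all_algebra all_fingroup.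
From mathcomp Require Import boolp classical_sets functions reals.
Set Implicit Arguments.
Unset Strict Implicit.
Unset Printing Implicit Defensive.
Import GRing.Theory.
Local Open Scope ring_scope.

(* Functions V^k -> R; [kform] below singles out the elements of the k-th
   exterior power of the dual of V, i.e. the alternating multilinear ones. *)
Notation cochain R V k := (k.-tuple V -> R).

Section Lie.
Variables (R : realType) (V : vectType R) (br : {bilinear V -> V -> V}).

Definition lie_bracket : Prop :=
  (forall x, br x x = 0) /\
  (forall x y z, br x (br y z) + br y (br z x) + br z (br x y) = 0).

(* [U, W], the span of all [x, y] with x in U and y in W (see [lievP]). *)
Definition liev (U W : {vspace V}) : {vspace V} :=
  <<[seq br x y | x <- vbasis U, y <- vbasis W]>>%VS.

Definition derived : {vspace V} := liev fullv fullv.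

Definition two_step_nilpotent : Prop :=
  derived != 0%VS /\ liev fullv derived = 0%VS.

Lemma memv_liev (U W : {vspace V}) x y :
  x \in U -> y \in W -> br x y \in liev U W.
Proof.
move=> /coord_vbasis-> /coord_vbasis->.
rewrite linear_sumr; apply: memv_suml => j _.
rewrite linear_sumlz; apply: memv_suml => i _.
rewrite linearZl_LR linearZr_LR !memvZ//.
by apply/memv_span/allpairs_f; apply: mem_nth; rewrite size_tuple.
Qed.

Lemma lievP (U W X : {vspace V}) :
  reflect (forall x y, x \in U -> y \in W -> br x y \in X)
          (liev U W <= X)%VS.
Proof.
apply: (iffP idP) => [sUWX x y xU yW|brX].
  by apply: subvP sUWX _ _; exact: memv_liev.
apply/span_subvP => _ /allpairsP[[x y] [/= xU yW ->]].
by apply: brX; exact: vbasis_mem.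
Qed.

End Lie.

Section Forms.
Variables (R : realType) (V : vectType R).

Definition tset k (v : k.-tuple V) (i : 'I_k) (x : V) : k.-tuple V :=
  [tuple if j == i then x else tnth v j | j < k].

Definition kform k (a : cochain R V k) : Prop :=
  (forall v i, scalar (fun x => a (tset v i x))) /\
  (forall v i j, i != j -> tnth v i = tnth v j -> a v = 0).

Definition wedge p q (a : cochain R V p) (b : cochain R V q) :
    cochain R V (p + q) := fun v =>
  (p`! * q`!)%:R^-1 * \sum_(s : 'S_(p + q)) (-1) ^+ s *
    (a [tuple tnth v (s (lshift q i)) | i < p] *
     b [tuple tnth v (s (rshift p i)) | i < q]).

Definition interior k (x : V) (a : cochain R V k.+1) : cochain R V k :=
  fun v => a [tuple of x :: v].

(* Chevalley-Eilenberg differential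
     d a (v_0, ..., v_m) =
       sum_(i < i') (-1)^(i + i') a ([v_i, v_i'], v_0, .^., .^., v_m);
   the pairs i < i' are the (i, lift i j) with i <= j, and
   l |-> lift i (lift j l) then enumerates the other indices. *)
Definition ced (br : V -> V -> V) k (a : cochain R V k.+1) :
    cochain R V k.+2 := fun v =>
  \sum_(i < k.+2) \sum_(j < k.+1 | (i <= j)%N)
    (-1) ^+ (i + lift i j)%N *
    a [tuple of br (tnth v i) (tnth v (lift i j)) ::
                [tuple tnth v (lift i (lift j l)) | l < k]].

Section Metric.
Variable g : {dot V for idfun}.

Definition volume_form n (vol : cochain R V n) : Prop :=
  kform vol /\ forall e : n.-tuple V, orthonormal g e -> `|vol e| = 1.

(* Some orthonormal n-tuple; it is a basis when n = dim V. *)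
Definition onb n : n.-tuple V :=
  xget [tuple 0 | i < n] [set e : n.-tuple V | orthonormal g e]%classic.

(* Hodge star for p + q = dim V, normalised by a /\ star b = <a, b> vol:
     (star b)(w) = 1/p! sum_I b(e_I) vol(e_I, w),
   which does not depend on the orthonormal basis e. *)
Definition hodge p q (vol : cochain R V (p + q)) (b : cochain R V p) :
    cochain R V q := fun w =>
  let e := onb (p + q) in
  p`!%:R^-1 * \sum_(I : {ffun 'I_p -> 'I_(p + q)})
    b [tuple tnth e (I i) | i < p] *
    vol [tuple of [tuple tnth e (I i) | i < p] ++ w].

End Metric.
End Forms.

Section G2.
Variables (R : realType) (V : vectType R).

Definition oneform (f : 'Hom(V, R^o)) : cochain R V 1 :=
  fun v => f (thead v).

(* e^{ijk} for the basis e^1, ..., e^7 *)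
Definition ewedge (e : 7.-tuple 'Hom(V, R^o)) (i j k : nat) : cochain R V 3 :=
  wedge (wedge (oneform e`_i.-1) (oneform e`_j.-1)) (oneform e`_k.-1).

Definition G2_structure (phi : cochain R V 3) : Prop :=
  exists2 e : 7.-tuple 'Hom(V, R^o), basis_of fullv e &
    forall v, phi v =
      ewedge e 1 2 7 v + ewedge e 3 4 7 v + ewedge e 5 6 7 v
      + ewedge e 1 3 5 v - ewedge e 1 4 6 v - ewedge e 2 3 6 v
      - ewedge e 2 4 5 v.

(* The identity and the normalisation of vol determine (g, vol) from phi, the
   orientation included: replacing vol by - vol forces g to become - g, which
   is not positive definite. *)
Definition G2_metric (phi : cochain R V 3) (g : {dot V for idfun})
    (vol : cochain R V 7) : Prop :=
  volume_form g vol /\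
  forall x y (v : 7.-tuple V),
    wedge (wedge (interior x phi) (interior y phi)) phi v
      = 6 * g x y * vol v.

Variables (br : {bilinear V -> V -> V}) (phi : cochain R V 3).
Variables (g : {dot V for idfun}) (vol : cochain R V 7).

Definition G2_psi : cochain R V 4 := @hodge R V g 3 4 vol phi.

Definition coclosed : Prop := forall v, ced br G2_psi v = 0.

Definition purely_coclosed : Prop :=
  coclosed /\ forall v, wedge phi (ced br phi) v = 0.

Definition calibrates (c : {vspace V}) : Prop :=
  \dim c = 3%N /\
  exists z1 z2 z3 : V,
    [/\ basis_of c [:: z1; z2; z3],
        orthonormal g [:: z1; z2; z3] &
        phi [tuple z1; z2; z3] = 1 \/ phi [tuple z1; z2; z3] = -1].

(* Levi-Civita connection restricted to left-invariant vector fields: the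
   torsion-free metric connection. *)
Definition levi_civita (nabla : {bilinear V -> V -> V}) : Prop :=
  (forall x y, nabla x y - nabla y x = br x y) /\
  (forall x y z, g (nabla x y) z + g y (nabla x z) = 0).

Definition torsion : cochain R V 3 := fun v =>
  6^-1 * @hodge R V g 7 0 vol (wedge (ced br phi) phi) [tuple] * phi v
  - @hodge R V g 4 3 vol (ced br phi) v.

Definition G2_connection (lambda : R) (nabla : V -> V -> V) : Prop :=
  exists2 nablag : {bilinear V -> V -> V}, levi_civita nablag &
    forall x y z, g (nabla x y) z
      = g (nablag x y) z + lambda / 2 * torsion [tuple x; y; z].

Definition curvature (nabla : V -> V -> V) (x y u : V) : V :=
  nabla x (nabla y u) - nabla y (nabla x u) - nabla (br x y) u.

Definition G2_instanton (nabla : V -> V -> V) : Prop :=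
  forall u v w,
    wedge (fun xy : 2.-tuple V =>
             g (curvature nabla (tnth xy ord0) (tnth xy ord_max) u) v) G2_psi w = 0.

(* (nabla_x a)(v_1, ..., v_k) = - sum_i a (v_1, ..., nabla_x v_i, ..., v_k) *)
Definition covd (nabla : V -> V -> V) k (a : cochain R V k) (x : V) :
    cochain R V k := fun v =>
  - \sum_(i < k) a (tset v i (nabla x (tnth v i))).

Definition parallel (nabla : V -> V -> V) k (a : cochain R V k) : Prop :=
  forall x v, covd nabla a x v = 0.

End G2.

(* Main.v *)
From Stdlib Require Import BinInt.
From HB Require Import structures.
From mathcomp Require Import all_boot all_order all_algebra all_fingroup.
From mathcomp Require Import boolp classical_sets reals.
From mathcomp Require Import ssrZ zify ring lra.
Require Import Defs.
Set Implicit Arguments.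
Unset Strict Implicit.
Unset Printing Implicit Defensive.
Import Order.TTheory GRing.Theory Num.Theory.
Local Open Scope ring_scope.
Delimit Scope Z_scope with bZ.

(** Why the theorem holds.

Let U be the derived algebra. In a suitable orthonormal frame z1, z2, z3, w1,
w2, w3, t the form is
  t /\ (w1 /\ z1 + w2 /\ z2 + w3 /\ z3)
    + Re ((c - i s) (z1 + i w1) /\ (z2 + i w2) /\ (z3 + i w3)),
where c^2 + s^2 = 1. If dim U = 3 one may take z1, z2, z3 to be a basis of U, so
that c = phi (z1, z2, z3) is 1 or -1 exactly when U is calibrated; if dim U = 2
one takes z1, z2 to be a basis of U and z3 to be their cross product, so that
c = 1 and s = 0. Such a frame exists because two orthonormal vectors and a unit
vector m orthogonal to them and to their product generate the imaginary
octonions with the standard multiplication table ([cayley_cross],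
[represents_twisted]); here m is the normalised component of z3 orthogonal to
the product of z1 and z2.

The brackets take values in U, which is central. Coclosedness is linear in the
structure constants. For dim U = 2 it makes z3 central too ([coclosed_dim2]). If
s <> 0, it leaves only the brackets of the w_i with t, given by a symmetric
matrix S; if s = 0, the bracket restricted to self-dual and anti-self-dual
two-vectors of the span of w1, w2, w3, t is given by a symmetric matrix S and by
an arbitrary one, eta ([coclosed_dim3], [split_bracket]).

The instanton condition is quadratic in S and eta. Three traces of it involve
only the squared norm of S, the sum q of its principal 2 x 2 minors, and the
squared norm of eta, and are linear in these quantities.
- If s <> 0 they force S = 0 ([noncalibrated_scalars]), so that the algebra
  is abelian.
- If s = 0 they force a zero bracket, or lambda = 1 and |S|^2 = q
  ([calibrated_scalars]); the latter means that S is a multiple p of the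
  identity. When p = 0 the remaining equations say that all 2 x 2 minors of
  eta vanish, so that U is a line ([skew_line]). Hence p <> 0. This excludes
  dim U = 2, where brackets have no z3 component; phi /\ d phi is 4 tr S times
  the volume form, hence not zero; and for lambda = 1 the covariant derivative
  of phi vanishes identically in S and eta ([calibrated_instanton]).

The polynomials that occur are computed by reflection. A form is represented by
a function from lists of frame indices to polynomials with integer coefficients
([represents]); wedge product, Hodge star, differential, connection, curvature
and covariant derivative have computable counterparts on such functions, and
the identities between the resulting polynomials are checked by evaluation. *)

(** * Polynomials with integer coefficients *)

(** A monomial is the sorted list of its variables. The terms of a polynomial are
kept sorted and nonzero, so that polynomial identities are equalities of lists,
decided by computation. *)
Definition monomial := seq nat.
Definition pol := seq (Z * monomial).

Fixpoint ltmono (m1 m2 : monomial) : bool :=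
  match m1, m2 with
  | _, [::] => false
  | [::], _ => true
  | i :: m1', j :: m2' => (i < j)%N || ((i == j) && ltmono m1' m2')
  end.

Fixpoint pinsert (t : Z * monomial) (p : pol) : pol :=
  if p is u :: p' then
    if t.2 == u.2 then
      let z := Z.add t.1 u.1 in if Z.eqb z 0%bZ then p' else (z, u.2) :: p'
    else if ltmono t.2 u.2 then t :: p else u :: pinsert t p'
  else if Z.eqb t.1 0%bZ then [::] else [:: t].

Definition padd (p q : pol) : pol := foldr pinsert q p.
Definition pconst (z : Z) : pol := pinsert (z, [::]) [::].
Definition pvar (i : nat) : pol := [:: (1%bZ, [:: i])].
Definition pscale (z : Z) (p : pol) : pol :=
  foldr (fun t => pinsert (Z.mul z t.1, t.2)) [::] p.
Definition ptmul (t : Z * monomial) (p q : pol) : pol :=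
  foldr (fun u => pinsert (Z.mul t.1 u.1, merge leq t.2 u.2)) q p.
Definition pmul (p q : pol) : pol := foldr (fun t => ptmul t q) [::] p.
Definition psum (s : seq pol) : pol := foldr padd [::] s.
Definition psgn (n : nat) (p : pol) : pol := if odd n then pscale (-1)%bZ p else p.

(** Normal form modulo c^2 = 1 - s^2, where c and s are the variables 0 and 1. *)
Fixpoint pcircle_monomial (m : monomial) : pol :=
  if m is 0%N :: 0%N :: m' then
    let r := pcircle_monomial m' in padd r (ptmul ((-1)%bZ, [:: 1%N; 1%N]) r [::])
  else [:: (1%bZ, m)].
Definition pcircle (p : pol) : pol :=
  foldr (fun t => padd (pscale t.1 (pcircle_monomial t.2))) [::] p.

Section Eval.
Variables (R : comPzRingType) (env : nat -> R).

Definition zc (z : Z) : R := (int_of_Z z)%:~R.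

Lemma zcD x y : zc (Z.add x y) = zc x + zc y.
Proof. by rewrite /zc (rmorphD int_of_Z) rmorphD. Qed.
Lemma zcM x y : zc (Z.mul x y) = zc x * zc y.
Proof. by rewrite /zc (rmorphM int_of_Z) rmorphM. Qed.

Definition ev_monomial (m : monomial) : R := foldr (fun i x => env i * x) 1 m.
Definition ev (p : pol) : R := foldr (fun t x => zc t.1 * ev_monomial t.2 + x) 0 p.

Lemma ev_monomialE m : ev_monomial m = \prod_(i <- m) env i.
Proof. by elim: m => [|i m IH] /=; rewrite ?big_nil// big_cons IH. Qed.

Lemma ev_monomial_merge m1 m2 : ev_monomial (merge leq m1 m2) = ev_monomial m1 * ev_monomial m2.
Proof. by rewrite !ev_monomialE (perm_big (m1 ++ m2)) ?perm_merge// big_cat. Qed.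

Lemma ev_pinsert t p : ev (pinsert t p) = zc t.1 * ev_monomial t.2 + ev p.
Proof.
elim: p => [|u p IH] /=.
  by case: Z.eqb_spec => [->|_] /=; rewrite ?mul0r ?add0r ?addr0.
case: eqVneq => [e|_].
  case: Z.eqb_spec => /= [z0|_]; last by rewrite zcD mulrDl e addrA.
  by rewrite addrA e -mulrDl -zcD z0 mul0r add0r.
by case: ltmono => //=; rewrite IH addrCA.
Qed.

Lemma ev_add p q : ev (padd p q) = ev p + ev q.
Proof. by elim: p => [|t p IH] /=; rewrite ?add0r// ev_pinsert IH addrA. Qed.

Lemma ev_const z : ev (pconst z) = zc z.
Proof. by rewrite ev_pinsert /= mulr1 addr0. Qed.

Lemma ev_var i : ev (pvar i) = env i.
Proof. by rewrite /= mulr1 addr0 mul1r. Qed.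

Lemma ev_scale z p : ev (pscale z p) = zc z * ev p.
Proof.
elim: p => [|t p IH] /=; first by rewrite mulr0.
by rewrite ev_pinsert IH zcM mulrDr mulrA.
Qed.

Lemma ev_tmul t p q : ev (ptmul t p q) = zc t.1 * ev_monomial t.2 * ev p + ev q.
Proof.
elim: p => [|u p IH] /=; first by rewrite mulr0 add0r.
by rewrite ev_pinsert IH zcM ev_monomial_merge; ring.
Qed.

Lemma ev_mul p q : ev (pmul p q) = ev p * ev q.
Proof.
elim: p => [|t p IH] /=; first by rewrite mul0r.
by rewrite ev_tmul IH mulrDl.
Qed.

Lemma ev_sum s : ev (psum s) = \sum_(p <- s) ev p.
Proof. by elim: s => [|p s IH] /=; rewrite ?big_nil// big_cons ev_add IH. Qed.

Lemma ev_sgn n p : ev (psgn n p) = (-1) ^+ n * ev p.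
Proof.
rewrite /psgn -signr_odd; case: odd; rewrite ?expr0 ?mul1r//.
by rewrite ev_scale expr1.
Qed.

Lemma ev_circle p : env 0%N ^+ 2 + env 1%N ^+ 2 = 1 -> ev (pcircle p) = ev p.
Proof.
move=> c1; suff evp m : ev (pcircle_monomial m) = ev_monomial m.
  by elim: p => //= t p IH; rewrite ev_add ev_scale evp IH.
have [n] := ubnP (size m); elim: n m => // n IH [|[|i] [|[|j] m]] //=;
  rewrite ?addr0 ?mul1r// ltnS => szm.
rewrite ev_add ev_tmul /= addr0 IH; last by apply: leq_trans szm.
have -> : zc (-1)%bZ = -1 by [].
have -> : env 0%N * (env 0%N * ev_monomial m) = (1 - env 1%N ^+ 2) * ev_monomial m.
  by rewrite -c1; ring.
by ring.
Qed.
End Eval.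

(** * Permutations and shuffles *)

(** A permutation of n + 1 points amounts to the point k that it sends to 0 and a
permutation of the others. *)
Lemma sum_perm_lift (R : nmodType) n (F : 'S_n.+1 -> R) :
  \sum_s F s = \sum_(k < n.+1) \sum_(t : 'S_n) F (lift_perm k ord0 t).
Proof.
rewrite pair_bigA /=.
pose f (u : 'I_n.+1 * 'S_n) := lift_perm u.1 ord0 u.2.
have f_inj : injective f.
  move=> [k t] [k' t']; rewrite /f /= => e.
  have kk : k = k'.
    by apply: (@perm_inj _ (lift_perm k' ord0 t')); rewrite -{1}e !lift_perm_id.
  rewrite {}kk in e *; congr (_, _); apply/permP => j; apply: (@lift_inj _ ord0).
  by rewrite -!(lift_perm_lift k') e.
apply: reindex; apply/onW_bij/(inj_card_bij f_inj).
by rewrite card_prod card_ord !card_Sn factS.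
Qed.

Section Shuffle.
Variables (R : numFieldType) (D : pred nat).
Implicit Types (A B : (nat -> nat) -> R) (m : nat -> nat).

Definition scons (x : nat) m : nat -> nat := fun i => if i is j.+1 then m j else x.
Definition swap k i := if i == k then k.+1 else if i == k.+1 then k else i.

(** Forms are treated as functions of an index map m of which only the values
m 0, ..., m (p - 1) matter: inductions on p then avoid dependent types. The
predicate D below delimits the indices of the frame. *)
Definition local p A :=
  forall m m', (forall i, (i < p)%N -> m i = m' i) -> A m = A m'.
Definition alternating p A :=
  forall m k, (forall i, D (m i)) -> (k.+1 < p)%N -> A (m \o swap k) = - A m.

(** k adjacent transpositions bring the k-th argument to the front. *)
Lemma move_to_front p A m k : local p A -> alternating p A ->
  (forall i, D (m i)) -> (k < p)%N ->
  A m = (-1) ^+ k * A (scons (m k) (m \o bump k)).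
Proof.
move=> locA altA; elim: k m => [|k IH] m Dm ltkp.
  by rewrite mul1r; apply: locA => -[|i].
rewrite -[A m]opprK -(altA m k)// (IH (m \o swap k)) => [||]; last exact: ltnW.
  2: by move=> i; exact: Dm.
rewrite exprS mulN1r mulNr; congr (- (_ * _)); apply: locA => -[|i] _ /=.
  by rewrite /swap eqxx.
congr m; rewrite /swap /bump.
by do 2?case: eqP; rewrite /=; lia.
Qed.

Let signsl k (x a b : R) :
  (-1) ^+ k * x * ((-1) ^+ k * a * b) = x * (a * b).
Proof.
transitivity (((-1) ^+ k) ^+ 2 * (x * (a * b))); first by ring.
by rewrite sqrr_sign mul1r.
Qed.

Let signsr k (x y a b : R) :
  x * (-1) ^+ k * y * (a * ((-1) ^+ k * b)) = x * (y * (a * b)).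
Proof.
transitivity (((-1) ^+ k) ^+ 2 * (x * (y * (a * b)))); first by ring.
by rewrite sqrr_sign mul1r.
Qed.

Definition front x A : (nat -> nat) -> R := fun m => A (scons x m).

Lemma local_front p A x : local p.+1 A -> local p (front x A).
Proof. by move=> locA m m' e; apply: locA => -[|i]//=; apply: e. Qed.

Lemma alternating_front p A x : local p.+1 A -> alternating p.+1 A -> D x ->
  alternating p (front x A).
Proof.
move=> locA altA Dx m k Dm ltk.
rewrite /front -(altA (scons x m) k.+1)//; last by case.
by apply: locA => -[|i] _ //=; rewrite /swap !eqSS; case: eqP => //; case: eqP.
Qed.

Lemma sign_lift_perm0 n (k : 'I_n.+1) (t : 'S_n) :
  (-1) ^+ lift_perm k ord0 t = (-1) ^+ k * (-1) ^+ t :> R.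
Proof. by rewrite odd_lift_perm /= addbF signr_addb signr_odd. Qed.

Definition perm_nat n (s : 'S_n) (i : nat) : nat :=
  if insub i is Some o then nat_of_ord (s o) else 0%N.

Lemma perm_nat_lift n (t : 'S_n) (k : 'I_n.+1) i : (i < n)%N ->
  perm_nat (lift_perm k ord0 t) (bump k i) = (perm_nat t i).+1.
Proof.
move=> ltin; rewrite /perm_nat (insubT (fun j => j < n.+1)%N) => [|b].
  by rewrite /bump; case: (k <= i)%N => /=; rewrite ?add1n ?add0n ?ltnS// ltnW.
rewrite (insubT (fun j => j < n)%N)//=.
have -> : Sub (bump k i) b = lift k (Ordinal ltin) :> 'I_n.+1 by apply: val_inj.
by rewrite lift_perm_lift /= /bump leq0n.
Qed.

Lemma perm_nat_id n (t : 'S_n) (k : 'I_n.+1) : perm_nat (lift_perm k ord0 t) k = 0%N.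
Proof.
rewrite /perm_nat insubT//= => lt.
by have -> : Sub (nat_of_ord k) lt = k; [apply: val_inj|rewrite lift_perm_id].
Qed.

Definition wsum n p A B m : R :=
  \sum_(s : 'S_n) (-1) ^+ s *
    (A (fun i => m (perm_nat s i)) * B (fun i => m (perm_nat s (p + i)%N))).

(** If the permutation puts the first index at position k, its sign contributes
(-1)^k. For k < p, moving this index to the front of A cancels that sign; for
k >= p, moving it to the front of B costs (-1)^(k - p), and (-1)^p remains. *)
Lemma wsumS n p q A B m : (n.+1 = p + q)%N ->
  local p A -> alternating p A -> local q B -> alternating q B ->
  (forall i, D (m i)) ->
  wsum n.+1 p A B m
  = p%:R * wsum n p.-1 (front (m 0%N) A) B (m \o S)
    + (-1) ^+ p * (q%:R * wsum n p A (front (m 0%N) B) (m \o S)).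
Proof.
move=> npq locA altA locB altB Dm.
pose X := wsum n p.-1 (front (m 0%N) A) B (m \o S).
pose Y := (-1) ^+ p * wsum n p A (front (m 0%N) B) (m \o S).
rewrite {1}/wsum sum_perm_lift.
transitivity (\sum_(k < n.+1) if (k < p)%N then X else Y); last first.
  rewrite -(big_mkord xpredT (fun k => if (k < p)%N then X else Y)) npq.
  rewrite (@big_cat_nat _ _ _ p)//= ?leq_addr//; congr (_ + _).
    rewrite (eq_big_nat _ _ (F2 := fun=> X)) => [|k /andP[_ ->]//].
    by rewrite big_const_nat subn0 iter_addr_0 mulr_natl.
  rewrite (eq_big_nat _ _ (F2 := fun=> Y)) => [|k /andP[lepk _]]; last first.
    by rewrite ltnNge lepk.
  by rewrite big_const_nat addKn iter_addr_0 /Y -mulrnAr mulr_natl.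
apply: eq_bigr => k _; have ltk := ltn_ord k.
have Dsn (s : 'S_n.+1) j i : D (m (perm_nat s (j + i)%N)) by exact: Dm.
case: ltnP => [ltkp|lepk].
  apply: eq_bigr => t _; have [p' pE] : exists p', p = p'.+1 by case: (p) ltkp => // p' _; exists p'.
  rewrite (move_to_front (k := k) locA)//= perm_nat_id.
  rewrite sign_lift_perm0 signsl.
  congr (_ * (_ * _)).
    apply: locA => -[|i]//= lti; congr m; rewrite perm_nat_lift//; lia.
  apply: locB => i ltiq /=; rewrite pE /= -(perm_nat_lift t k); last by lia.
  by congr (m (perm_nat _ _)); rewrite /bump; lia.
rewrite /Y /wsum mulr_sumr; apply: eq_bigr => t _.
have [k' kE] : exists k', nat_of_ord k = (p + k')%N by exists (k - p)%N; rewrite subnKC.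
have ltk' : (k' < q)%N by lia.
rewrite (move_to_front (k := k') locB)//= -kE perm_nat_id.
rewrite sign_lift_perm0 kE exprD signsr.
congr (_ * (_ * (_ * _))).
  apply: locA => i ltip /=; rewrite -(perm_nat_lift t k); last by lia.
  by congr (m (perm_nat _ _)); rewrite /bump; lia.
apply: locB => -[|i]//= lti; rewrite -(perm_nat_lift t k); last by lia.
by congr (m (perm_nat _ _)); rewrite /bump; lia.
Qed.

(** Laplace expansion along the first argument, iterated: the sum over
(p, q)-shuffles of the argument list. *)
Fixpoint shuffle p q A B n m : R :=
  if n is n'.+1 then
    (if p is p'.+1 then shuffle p' q (front (m 0%N) A) B n' (m \o S) else 0)
    + (if q is q'.+1 then
         (-1) ^+ p * shuffle p q' A (front (m 0%N) B) n' (m \o S) else 0)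
  else A m * B m.

(** The permutations inducing a given shuffle contribute equally, and there are
p! q! of them: this is the factor in the definition of the wedge product. *)
Lemma wsum_shuffle p q A B n m : n = (p + q)%N ->
  local p A -> alternating p A -> local q B -> alternating q B ->
  (forall i, D (m i)) -> wsum n p A B m = (p`! * q`!)%:R * shuffle p q A B n m.
Proof.
elim: n p q A B m => [|n IH] p q A B m npq locA altA locB altB Dm.
  have [p0 q0] : p = 0%N /\ q = 0%N by lia.
  rewrite {npq}p0 {}q0 in locA locB *.
  rewrite mul1r /wsum (bigD1 1%g)//= big1 ?addr0; last first.
    by move=> s; rewrite (_ : s = 1%g) ?eqxx//; apply/permP => -[].
  by rewrite odd_perm1 mul1r; congr (_ * _); [apply: locA|apply: locB].
rewrite (@wsumS _ p q)//= mulrDr; congr (_ + _).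
  case: p npq locA altA => [|p] npq locA altA; first by rewrite mul0r mulr0.
  have npq' : n = (p + q)%N by lia.
  rewrite /= (IH _ _ _ _ _ npq' (local_front _ locA)
    (alternating_front locA altA (Dm 0%N)) locB altB) => [|i]; last exact: Dm.
  by rewrite factS !natrM; ring.
case: q npq locB altB => [|q] npq locB altB; first by rewrite mul0r !mulr0.
have npq' : n = (p + q)%N by lia.
rewrite /= (IH _ _ _ _ _ npq' locA altA (local_front _ locB)
  (alternating_front locB altB (Dm 0%N))) => [|i]; last exact: Dm.
by rewrite factS !natrM; ring.
Qed.
End Shuffle.

(** * Orthonormal frames *)
Section Metric.
Variables (R : realType) (V : vectType R) (g : {dot V for idfun}).

Lemma metricC x y : g x y = g y x.
Proof. by rewrite hermC expr0 mul1r. Qed.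

Lemma metricDl x y z : g (x + y) z = g x z + g y z.
Proof. exact: linearDl. Qed.
Lemma metricZl a x z : g (a *: x) z = a * g x z.
Proof. exact: linearZl_LR. Qed.
Lemma metricBl x y z : g (x - y) z = g x z - g y z.
Proof. exact: linearBl. Qed.
Lemma metricNl x z : g (- x) z = - g x z.
Proof. exact: linearNl. Qed.
Lemma metric0l z : g 0 z = 0.
Proof. exact: linear0l. Qed.
Lemma metricDr x y z : g z (x + y) = g z x + g z y.
Proof. by rewrite !(metricC z) metricDl. Qed.
Lemma metricZr a x z : g z (a *: x) = a * g z x.
Proof. by rewrite !(metricC z) metricZl. Qed.
Lemma metricBr x y z : g z (x - y) = g z x - g z y.
Proof. by rewrite !(metricC z) metricBl. Qed.
Lemma metricNr x z : g z (- x) = - g z x.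
Proof. by rewrite !(metricC z) metricNl. Qed.
Lemma metric_suml I (r : seq I) (P : pred I) (F : I -> V) z :
  g (\sum_(i <- r | P i) F i) z = \sum_(i <- r | P i) g (F i) z.
Proof. exact: linear_sumlz. Qed.
Lemma metric_gt0 x : x != 0 -> 0 < g x x.
Proof. exact: neq0_dnorm_gt0. Qed.

Lemma metric_inj x y : (forall z, g x z = g y z) -> x = y.
Proof.
move=> e; apply/eqP; rewrite -subr_eq0; apply: contraT => /metric_gt0.
by rewrite metricBl e subrr ltxx.
Qed.

Lemma metric_ge0 x : 0 <= g x x.
Proof.
have [->|/metric_gt0/ltW//] := eqVneq x 0.
by rewrite metric0l.
Qed.

Definition orthonormal_frame n (h : nat -> V) :=
  forall i j, (i < n)%N -> (j < n)%N -> g (h i) (h j) = (i == j)%:R.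

Lemma orthonormal_tupleP n (e : n.-tuple V) :
  orthonormal g e <-> orthonormal_frame n (nth 0 e).
Proof.
case: e => s /= /eqP <-{n}; elim: s => [|x s IH].
  by split.
rewrite /orthonormal /= andbT; split.
  move=> /andP[/andP[/eqP gx gs] /andP[xs os]].
  have /IH os' : orthonormal g s by rewrite /orthonormal gs.
  have xs' j : (j < size s)%N -> g x (nth 0 s j) = 0.
    by move=> lt; move/allP: xs => /(_ _ (mem_nth 0 lt))/eqP.
  move=> [|i] [|j] //= lti ltj; rewrite ?xs'//; last exact: os'.
  by rewrite metricC xs'.
move=> o; have /IH : orthonormal_frame (size s) (nth 0 s).
  by move=> i j lti ltj; rewrite (o i.+1 j.+1).
rewrite /orthonormal => /andP[-> ->].
rewrite (o 0%N 0%N)//= eqxx !andbT; apply/allP => y /(nthP 0)[j ltj <-].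
by rewrite /= (o 0%N j.+1).
Qed.

Section Frame.
Variables (n : nat) (h : nat -> V).
Hypotheses (dimV : \dim {: V} = n) (oh : orthonormal_frame n h).

Lemma frame_coord (k : 'I_n -> R) (j : 'I_n) : g (\sum_(i < n) k i *: h i) (h j) = k j.
Proof.
rewrite metric_suml (bigD1 j)//= big1 ?addr0 => [|i ij].
  by rewrite metricZl oh//= eqxx mulr1.
by rewrite metricZl oh// val_eqE (negbTE ij) mulr0.
Qed.

Lemma frame_expand x : x = \sum_(i < n) g x (h i) *: h i.
Proof.
pose X := [tuple h i | i < n].
have XE (i : 'I_n) : X`_i = h i by rewrite -tnth_nth tnth_mktuple.
have frX : free X.
  apply/freeP => k k0 i; rewrite -(frame_coord k i); under eq_bigr do rewrite -XE.
  by rewrite k0 metric0l.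
have Xfull : <<X>>%VS = fullv.
  by apply/eqP; rewrite eqEdim subvf dimV (eqP frX) size_tuple leqnn.
have xE : x = \sum_i coord X i x *: h i.
  rewrite {1}(@coord_span _ _ _ X x) ?Xfull ?memvf//.
  by apply: eq_bigr => i _; rewrite XE.
by rewrite {1}xE; apply: eq_bigr => i _; rewrite {2}xE frame_coord.
Qed.

Lemma frame_inj x y : (forall i, (i < n)%N -> g x (h i) = g y (h i)) -> x = y.
Proof.
move=> e; rewrite (frame_expand x) (frame_expand y).
by apply: eq_bigr => i _; rewrite e.
Qed.

End Frame.

Lemma scalar_sum (f : V -> R) I (r : seq I) (P : pred I) (a : I -> R) (x : I -> V) :
  scalar f -> f (\sum_(i <- r | P i) a i *: x i) = \sum_(i <- r | P i) a i * f (x i).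
Proof.
move=> lf; have f0 : f 0 = 0.
  by have := lf 1 0 0; rewrite scaler0 addr0 mul1r => e;
    apply: (addrI (f 0)); rewrite addr0.
elim/big_rec2: _ => // i y1 y2 _ <-; exact: lf.
Qed.

(** Both sides are the inner product of the linear forms f and k, which does
not depend on an orthonormal basis. *)
Lemma frame_trace n (h e : nat -> V) (f k : V -> R) :
  \dim {: V} = n -> orthonormal_frame n h -> orthonormal_frame n e ->
  scalar f -> scalar k ->
  \sum_(i < n) f (h i) * k (h i) = \sum_(i < n) f (e i) * k (e i).
Proof.
move=> dimV oh oe lf lk.
have fE i : f (h i) = \sum_(j < n) g (h i) (e j) * f (e j).
  by rewrite {1}(frame_expand dimV oe (h i)) (scalar_sum _ _ _ _ lf).
under eq_bigr => i _ do rewrite fE mulr_suml.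
rewrite exchange_big /=; apply: eq_bigr => j _.
have -> : k (e j) = \sum_(i < n) g (e j) (h i) * k (h i).
  by rewrite {1}(frame_expand dimV oh (e j)) (scalar_sum _ _ _ _ lk).
rewrite mulr_sumr; apply: eq_bigr => i _; rewrite (metricC (h i)); ring.
Qed.
End Metric.

(** * Multilinear and alternating forms *)
Section Multilinear.
Variables (R : realType) (V : vectType R).

Definition multilinear k (a : cochain R V k) :=
  forall v i, scalar (fun x => a (tset v i x)).

Lemma scalar_scale (c : R) (f : V -> R) : scalar f -> scalar (fun x => c * f x).
Proof. by move=> lf a x y; rewrite lf; ring. Qed.

Lemma scalar_bigsum I (r : seq I) (P : pred I) (F : I -> V -> R) :
  (forall i, P i -> scalar (F i)) -> scalar (fun x => \sum_(i <- r | P i) F i x).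
Proof.
move=> lF a x y; rewrite mulr_sumr -big_split /=.
by apply: eq_bigr => i /lF ->.
Qed.

Lemma tnth_tset k (v : k.-tuple V) i x j :
  tnth (tset v i x) j = if j == i then x else tnth v j.
Proof. by rewrite tnth_mktuple. Qed.

(** Entries picked by an injective f; x occurs once among them or not at all. *)
Lemma tset_pick k n (v : n.-tuple V) t (f : 'I_k -> 'I_n) : injective f ->
  (exists2 i, f i = t & forall x, [tuple tnth (tset v t x) (f j) | j < k]
                     = tset [tuple tnth v (f j) | j < k] i x) \/
  ((forall i, f i != t) /\ forall x, [tuple tnth (tset v t x) (f j) | j < k]
             = [tuple tnth v (f j) | j < k]).
Proof.
move=> fI; case: (pickP (fun i => f i == t)) => [i /eqP fi|nf].
  left; exists i => // x; apply: eq_from_tnth => j.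
  by rewrite !tnth_mktuple -fi (inj_eq fI).
right; split=> [i|x]; first by rewrite nf.
by apply: eq_from_tnth => j; rewrite !tnth_mktuple nf.
Qed.

Lemma multilinear_wedge p q (a : cochain R V p) (b : cochain R V q) :
  multilinear a -> multilinear b -> multilinear (wedge a b).
Proof.
move=> la lb v t; apply: scalar_scale; apply: scalar_bigsum => s _.
apply: scalar_scale.
have lI : injective (fun i : 'I_p => s (lshift q i)).
  by move=> i j /perm_inj/lshift_inj.
have rI : injective (fun i : 'I_q => s (rshift p i)).
  by move=> i j /perm_inj/rshift_inj.
have [u su] : exists u, s u = t by exists (s^-1 t)%g; rewrite permKV.
case: (tset_pick v t lI) => [[i ei xi]|[ni xi]];
  case: (tset_pick v t rI) => [[j ej xj]|[nj xj]] => c x y /=; rewrite !xi !xj.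
- by move: ej; rewrite -ei => /perm_inj/eqP; rewrite eq_rlshift.
- by rewrite la; ring.
- by rewrite lb; ring.
- move: su; case: (split_ordP u) => k ->; first by move/eqP; rewrite (negbTE (ni k)).
  by move/eqP; rewrite (negbTE (nj k)).
Qed.

Lemma tset_head k (w : k.-tuple V) x :
  [tuple of x :: w] = tset [tuple of 0 :: w] ord0 x.
Proof.
apply: eq_from_tnth => i; rewrite tnth_mktuple.
by case: (unliftP ord0 i) => [j|] -> //=; rewrite !tnthS.
Qed.

Lemma scalar_head k (a : cochain R V k.+1) (w : k.-tuple V) :
  multilinear a -> scalar (fun x => a [tuple of x :: w]).
Proof.
move=> la c x y /=.
by rewrite (tset_head w (c *: x + y)) (tset_head w x) (tset_head w y) la.
Qed.

Lemma tset_behead k (w : k.-tuple V) x y i :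
  [tuple of x :: tset w i y] = tset [tuple of x :: w] (lift ord0 i) y.
Proof.
apply: eq_from_tnth => j; rewrite tnth_mktuple.
case: (unliftP ord0 j) => [l|] ->; last by [].
by rewrite !tnthS tnth_mktuple (inj_eq lift_inj).
Qed.

(** Every summand reads slot t exactly once, either as a plain argument of a or as
one of the two arguments of the bracket. *)
Lemma multilinear_ced (br : {bilinear V -> V -> V}) k (a : cochain R V k.+1) :
  multilinear a -> multilinear (ced br a).
Proof.
move=> la v t; apply: scalar_bigsum => i _; apply: scalar_bigsum => j _.
apply: scalar_scale.
have fI : injective (fun l : 'I_k => lift i (lift j l)).
  by move=> l1 l2 /lift_inj/lift_inj.
case: (tset_pick v t fI) => [[l el xl]|[nl xl]].
  have [ni nj] : i != t /\ lift i j != t.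
    by rewrite -el neq_lift (inj_eq lift_inj) neq_lift.
  move=> c x y; rewrite !xl !tnth_tset (negbTE ni) (negbTE nj).
  by rewrite !tset_behead la.
move=> c x y; rewrite !xl !tnth_tset.
have [eit|ni] := eqVneq i t.
  have -> : (lift i j == t) = false by rewrite -eit eq_sym (negbTE (neq_lift _ _)).
  by rewrite linearPl (scalar_head _ la).
have [ejt|nj] := eqVneq (lift i j) t.
  by rewrite linearPr (scalar_head _ la).
case: (unliftP i t) ni => [t'|] et; last by rewrite et eqxx.
case: (unliftP j t') => [t''|] et' _; last by rewrite et et' eqxx in nj.
by have := nl t''; rewrite et et' eqxx.
Qed.

(** Precomposing with a transposition reindexes the sum over permutations and
flips every sign. *)
Lemma alternating_wedge D h p q (a : cochain R V p) (b : cochain R V q) :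
  alternating D (p + q) (fun m => wedge a b [tuple h (m i) | i < p + q]).
Proof.
move=> m j _ ltj; pose i1 := Ordinal ltj; pose i0 := Ordinal (ltnW ltj).
have n01 : i0 != i1 by rewrite -val_eqE /= neq_ltn ltnSn.
rewrite /wedge -mulrN; congr (_ * _); rewrite -sumrN.
rewrite (reindex_inj (mulIg (tperm i0 i1))) /=; apply: eq_bigr => s _.
rewrite odd_permM odd_tperm n01 addbT signrN mulNr; congr (- (_ * _)).
have E x : tnth [tuple h ((m \o swap j) i) | i < p + q] ((s * tperm i0 i1)%g x)
           = tnth [tuple h (m i) | i < p + q] (s x).
  rewrite permM !tnth_mktuple /= /swap; congr (h (m _)).
  case: tpermP => [->|->|/eqP n0 /eqP n1] /=.
  - by rewrite eqxx gtn_eqF.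
  - by rewrite eqxx.
  - by rewrite -!val_eqE /= in n0 n1; rewrite (negbTE n0) (negbTE n1).
by congr (_ * _); [congr a|congr b]; apply: eq_from_tnth => x;
  rewrite [LHS]tnth_mktuple [RHS]tnth_mktuple E.
Qed.

Section Alternating.
Variables (k : nat) (a : cochain R V k).
Hypothesis ka : kform a.

(** Polarisation: expand a (..., x + y, ..., x + y, ...) = 0. *)
Lemma kform_swap (v : k.-tuple V) i j : i != j ->
  a (tset (tset v i (tnth v j)) j (tnth v i)) = - a v.
Proof.
case: ka => la za ij; pose F x y := a (tset (tset v i x) j y).
have Flr y : scalar (F y) by move=> c x z; rewrite /F la.
have Fll y : scalar (F^~ y).
  have sw x : tset (tset v i x) j y = tset (tset v j y) i x.
    apply: eq_from_tnth => l; rewrite !tnth_tset.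
    by case: eqP => // ->; rewrite eq_sym (negbTE ij).
  by move=> c x z; rewrite /F !sw la.
have F0 x : F x x = 0.
  by apply: (za _ i j) => //; rewrite !tnth_tset !eqxx; case: eqP.
set x := tnth v i; set y := tnth v j.
have -> : a v = F x y.
  congr a; apply: eq_from_tnth => l; rewrite !tnth_tset.
  by case: eqP => [->|_]//; case: eqP => [->|].
apply/eqP; rewrite -addr_eq0; apply/eqP.
have := F0 (1 *: x + y); rewrite Fll !Flr !F0 => /eqP.
by rewrite !mul1r add0r addr0 addrC => /eqP.
Qed.

Definition frame_eval (h : nat -> V) k (b : cochain R V k) (m : nat -> nat) : R :=
  b [tuple h (m i) | i < k].

Lemma local_frame_eval h n (b : cochain R V n) : local n (frame_eval h b).
Proof.
move=> m m' e; congr b; apply: eq_from_tnth => i.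
by rewrite !tnth_mktuple e.
Qed.

Lemma alternating_kform D h : alternating D k (frame_eval h a).
Proof.
move=> m j _ ltj; pose i1 := Ordinal ltj; pose i0 := Ordinal (ltnW ltj).
have n01 : i0 != i1 by rewrite -val_eqE /= neq_ltn ltnSn.
rewrite /frame_eval -(kform_swap _ n01); congr a.
apply: eq_from_tnth => l; rewrite !tnth_tset !tnth_mktuple /= /swap.
rewrite -!val_eqE /=; case: (eqVneq (l : nat) j) => [->|_].
  by rewrite ltn_eqF.
by case: eqP.
Qed.
End Alternating.
End Multilinear.

(** * Sums over multi-indices *)
Section MultiSum.
Variables (R : realType) (n : nat).

(** Sum over the lists of p indices below n, iterated so that one index can be
split off at a time. *)
Fixpoint nsum p (F : seq nat -> R) : R :=
  if p is p'.+1 then \sum_(i < n) nsum p' (fun l => F (nat_of_ord i :: l))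
  else F [::].

Lemma eq_nsum p F1 F2 : (forall l, size l = p -> F1 l = F2 l) ->
  nsum p F1 = nsum p F2.
Proof.
elim: p F1 F2 => [|p IH] F1 F2 e /=; first exact: e.
by apply: eq_bigr => i _; apply: IH => l sl; apply: e; rewrite /= sl.
Qed.

Lemma nsum_sum p I (r : seq I) (F : I -> seq nat -> R) :
  nsum p (fun l => \sum_(i <- r) F i l) = \sum_(i <- r) nsum p (F i).
Proof.
elim: p F => [|p IH] F //=.
by under eq_bigr do rewrite IH; rewrite exchange_big.
Qed.

Lemma sum_ffun_nsum p (F : seq nat -> R) :
  \sum_(I : {ffun 'I_p -> 'I_n}) F [seq nat_of_ord (I i) | i <- enum 'I_p]
  = nsum p F.
Proof.
elim: p F => [|p IH] F /=.
  rewrite (bigD1 (ffun0 (card_ord 0)))//= big1 ?addr0 => [|I /eqP[]].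
    by rewrite (size0nil (s := enum 'I_0)) ?size_enum_ord.
  by apply/ffunP => -[].
pose c (u : 'I_n * {ffun 'I_p -> 'I_n}) : {ffun 'I_p.+1 -> 'I_n} :=
  [ffun i => oapp u.2 u.1 (unlift ord0 i)].
rewrite (reindex c); last first.
  exists (fun J : {ffun 'I_p.+1 -> 'I_n} =>
      (J ord0, [ffun i => J (lift ord0 i)])) => [[x J] _|J _] /=.
    rewrite /c ffunE unlift_none /=; congr pair.
    by apply/ffunP => i; rewrite !ffunE liftK.
  by apply/ffunP => i; rewrite ffunE; case: unliftP => [j|] -> //=; rewrite ffunE.
rewrite -(pair_big xpredT xpredT (fun i J => F [seq nat_of_ord (c (i, J) l) | l <- enum 'I_p.+1])) /=.
apply: eq_bigr => i _; rewrite -IH; apply: eq_bigr => J _.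
rewrite enum_ordSl /= -map_comp /c ffunE unlift_none /=; congr (F (_ :: _)).
by apply: eq_map => l /=; rewrite ffunE liftK.
Qed.

Lemma nsum_eq0 p F : (forall l, size l = p -> all (gtn n) l -> F l = 0) ->
  nsum p F = 0.
Proof.
elim: p F => [|p IH] F F0 /=; first exact: F0.
by apply: big1 => i _; apply: IH => l sl nl; apply: F0; rewrite /= ?sl ?ltn_ord.
Qed.

(** A symmetric function supported on the arrangements of the list K: all p`!
of them contribute the same. *)
Lemma nsum_symmetric p F K : uniq K -> size K = p -> all (gtn n) K ->
  (forall x s1 s2, (size (s1 ++ s2)).+1 = p -> all (gtn n) (x :: s1 ++ s2) ->
     F (s1 ++ x :: s2) = F (x :: s1 ++ s2)) ->
  (forall l, size l = p -> all (gtn n) l -> ~~ (uniq l && all (mem K) l) -> F l = 0) ->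
  nsum p F = p`!%:R * F K.
Proof.
elim: p F K => [|p IH] F K uK sK nK mvF F0.
  by rewrite (size0nil sK) mul1r.
rewrite [nsum _ _]/=; transitivity (\sum_(i < n) if nat_of_ord i \in K then p`!%:R * F K else 0).
  apply: eq_bigr => i _; case: ifP => [iK|niK]; last first.
    by apply: nsum_eq0 => l sl nl; apply: F0; rewrite /= ?sl ?ltn_ord// niK andbF.
  have [[s1 s2] /= Ks] : exists s, K = s.1 ++ nat_of_ord i :: s.2.
    by case/splitPr: iK => s1 s2; exists (s1, s2).
  have [uKi nKi] : uniq (s1 ++ s2) /\ all (gtn n) (s1 ++ s2).
    move: uK nK; rewrite Ks -cat1s uniq_catCA cat1s /= => /andP[_ ->].
    by rewrite !all_cat /= => /andP[-> /andP[_ ->]].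
  have sKi : size (s1 ++ s2) = p by move: sK; rewrite Ks !size_cat /= addnS => -[].
  rewrite (IH _ (s1 ++ s2))//= => [|x t1 t2 st nt|l sl nl' nl].
  - by rewrite Ks -(mvF _ s1 s2) ?sKi//= ltn_ord.
  - have nit : all (gtn n) [:: x, nat_of_ord i & t1 ++ t2].
      by case/andP: nt => /= -> ->; rewrite ltn_ord.
    rewrite (mvF x (nat_of_ord i :: t1)) /= ?st//.
    by rewrite (mvF x [:: nat_of_ord i] (t1 ++ t2))//= st.
  - apply: F0 => /=; rewrite ?sl ?ltn_ord//; apply: contra nl => /and3P[/andP[il ul] _ lK].
    rewrite ul /=; apply/allP => x xl; have := allP lK x xl.
    rewrite /= Ks !mem_cat inE; case: (eqVneq x i) => // xi.
    by rewrite -xi xl in il.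
suff sumK (c : R) : \sum_(i < n) (if nat_of_ord i \in K then c else 0) = p.+1%:R * c.
  by rewrite sumK factS natrM mulrA.
rewrite -big_mkcond -(big_mkord (mem K) (fun=> c)) -big_filter (perm_big K).
  by rewrite big_const_seq count_predT sK iter_addr_0 mulr_natl.
apply: uniq_perm => // [|i]; first by rewrite filter_uniq ?iota_uniq.
rewrite mem_filter mem_index_iota /=.
by case iK: (i \in K) => //=; exact: (allP nK).
Qed.
End MultiSum.

Section Hodge.
Variables (R : realType) (V : vectType R) (g : {dot V for idfun}).

Definition on_seq k (a : cochain R V k) (s : seq V) : R :=
  a [tuple nth 0 s i | i < k].

Fixpoint seq_multilinear p (B : seq V -> R) : Prop :=
  if p is p'.+1 then
    (forall s, size s = p' -> scalar (fun x => B (x :: s))) /\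
    (forall x, seq_multilinear p' (fun s => B (x :: s)))
  else True.

Lemma seq_multilinear_cat k (a : cochain R V k) p pre suf :
  multilinear a -> (size pre + p + size suf = k)%N ->
  seq_multilinear p (fun s => on_seq a (pre ++ s ++ suf)).
Proof.
move=> la; elim: p pre => //= p IH pre szk; split=> [s sp|x]; last first.
  have := IH (rcons pre x); rewrite size_rcons addSnnS => /(_ szk).
  by under eq_fun do rewrite cat_rcons.
have ltk : (size pre < k)%N by lia.
have E x : [tuple nth 0 (pre ++ x :: s ++ suf) i | i < k]
   = tset [tuple nth 0 (pre ++ 0 :: s ++ suf) i | i < k] (Ordinal ltk) x.
  apply: eq_from_tnth => i; rewrite !tnth_mktuple -val_eqE /= !nth_cat.
  case: (ltngtP i (size pre)) => // [lt|->]; last by rewrite subnn.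
  by rewrite -(subnSK lt).
by move=> c x y; rewrite /on_seq (E (c *: x + y)) (E x) (E y) la.
Qed.

Variable n : nat.
Hypothesis dimV : \dim {: V} = n.

(** [frame_trace], one slot at a time: a full contraction of two p-linear functions
is independent of the orthonormal basis. *)
Lemma nsum_frame p (e h : nat -> V) (B C : seq V -> R) :
  orthonormal_frame g n e -> orthonormal_frame g n h ->
  seq_multilinear p B -> seq_multilinear p C ->
  nsum n p (fun l => B (map e l) * C (map e l))
  = nsum n p (fun l => B (map h l) * C (map h l)).
Proof.
move=> oe oh; elim: p B C => [|p IH] B C //= [lB mB] [lC mC].
under eq_bigr => i _ do rewrite (IH (fun s => B (e i :: s)) (fun s => C (e i :: s)))//.
rewrite -!nsum_sum; apply: eq_nsum => l sl.
by apply: (frame_trace dimV oe oh (f := fun x => B (x :: _)) (k := fun x => C (x :: _)));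
  [apply: lB|apply: lC]; rewrite size_map.
Qed.
End Hodge.

(** * Forms as functions of frame indices *)
Definition swap_list j (l : seq nat) := [seq nth 0%N l (swap j i) | i <- iota 0 (size l)].

Fixpoint lists k : seq (seq nat) :=
  if k is k'.+1 then [seq x :: l | x <- iota 0 7, l <- lists k'] else [:: [::]].

Lemma mem_lists k l : (l \in lists k) = (size l == k) && all (gtn 7) l.
Proof.
elim: k l => [|k IH] [|x l]; rewrite ?inE//.
  by apply/negbTE/negP => /allpairsPdep [y [l' []]].
rewrite eqSS; apply/allpairsPdep/idP => [[y [l' [+ + [-> ->]]]]|/and3P[sl xl ll]].
  by rewrite mem_iota IH => /= -> /andP[-> ->].
by exists x, l; split=> //; [rewrite mem_iota | rewrite IH sl].
Qed.

Definition alternatingb k (A : seq nat -> pol) : bool :=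
  all (fun l => all (fun j => nilp (padd (A l) (A (swap_list j l)))) (iota 0 k.-1))
      (lists k).

Fixpoint pshuffle p q (A B : seq nat -> pol) (l : seq nat) : pol :=
  if l is x :: l' then
    padd (if p is p'.+1 then pshuffle p' q (fun s => A (x :: s)) B l' else [::])
         (if q is q'.+1 then psgn p (pshuffle p q' A (fun s => B (x :: s)) l')
          else [::])
  else pmul (A [::]) (B [::]).

(** Insertion sort, together with the parity of the permutation performed. *)
Fixpoint isort (l : seq nat) : bool * seq nat :=
  if l is x :: l' then
    let: (b, s) := isort l' in
    let j := find (ltn x) s in (b (+) odd j, take j s ++ x :: drop j s)
  else (false, [::]).

Definition complement n (l : seq nat) := [seq x <- iota 0 n | x \notin l].

(** In an orthonormal frame the value of the Hodge star at J is the value of A at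
the complementary indices K, up to the sign of the permutation K J. *)
Definition pstar n (A : seq nat -> pol) (J : seq nat) : pol :=
  if uniq J then
    let K := complement n J in psgn (isort (K ++ J)).1 (A K)
  else [::].

Definition complement_sortedb p q : bool :=
  all (fun J => uniq J ==> (size (complement (p + q) J) == p)
         && ((isort (complement (p + q) J ++ J)).2 == iota 0 (p + q)))
      (lists q).

(** C i j x stands for the x-th coordinate of the bracket of the i-th and j-th
frame vectors. *)
Definition pced (C : nat -> nat -> nat -> pol) k (A : seq nat -> pol) (l : seq nat) : pol :=
  psum [seq psgn (i + bump i j)
          (psum [seq pmul (C (nth 0%N l i) (nth 0%N l (bump i j)) x)
                          (A (x :: [seq nth 0%N l (bump i (bump j r)) | r <- iota 0 k]))
                | x <- iota 0 7])
       | i <- iota 0 k.+2, j <- [seq j <- iota 0 k.+1 | (i <= j)%N]].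

Section Represent.
Variables (R : realType) (V : vectType R) (h : nat -> V) (env : nat -> R).

(** This relation links computation and geometry: with the variables evaluated by
env, A gives the values of the form a on the frame h. *)
Definition represents k (A : seq nat -> pol) (a : cochain R V k) : Prop :=
  forall l, size l = k -> all (gtn 7) l -> ev env (A l) = frame_eval h a (nth 0%N l).

Lemma represents_alternating k A (a : cochain R V k) :
  alternatingb k A -> represents A a -> alternating (gtn 7) k (frame_eval h a).
Proof.
move=> /allP altA rA m j Dm ltj.
have sz : size (mkseq m k) = k by rewrite size_mkseq.
have all7 : all (gtn 7) (mkseq m k).
  by apply/(all_nthP 0%N) => i; rewrite sz => lti; rewrite nth_mkseq//; exact: Dm.
have sz' : size (swap_list j (mkseq m k)) = k by rewrite size_map size_iota sz.
have swj i : (i < k)%N -> (swap j i < k)%N.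
  by rewrite /swap; case: eqP => // _; case: eqP => // _; lia.
have swE i : (i < k)%N -> nth 0%N (swap_list j (mkseq m k)) i = m (swap j i).
  move=> lti; rewrite (nth_map 0%N) ?size_iota ?sz// nth_iota//.
  by rewrite add0n nth_mkseq// swj.
have all7' : all (gtn 7) (swap_list j (mkseq m k)).
  by apply/(all_nthP 0%N) => i; rewrite sz' => lti; rewrite swE//; exact: Dm.
have /altA/allP/(_ j) : mkseq m k \in lists k by rewrite mem_lists sz eqxx.
rewrite mem_iota add0n leq0n /= => /(_ _)/nilP.
have -> : (j < k.-1)%N by lia.
move=> /(_ isT)/(congr1 (ev env)); rewrite ev_add (rA _ sz all7) (rA _ sz' all7') => /eqP.
rewrite addrC addr_eq0 => /eqP.
have -> : frame_eval h a (nth 0%N (swap_list j (mkseq m k))) = frame_eval h a (m \o swap j).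
  by apply: local_frame_eval => i lti; exact: swE.
by move->; congr (- _); apply: local_frame_eval => i lti; rewrite nth_mkseq.
Qed.

Lemma ev_pshuffle p q A B (a : (nat -> nat) -> R) (b : (nat -> nat) -> R) l :
  local p a -> local q b ->
  (forall s, size s = p -> all (gtn 7) s -> ev env (A s) = a (nth 0%N s)) ->
  (forall s, size s = q -> all (gtn 7) s -> ev env (B s) = b (nth 0%N s)) ->
  size l = (p + q)%N -> all (gtn 7) l ->
  ev env (pshuffle p q A B l) = shuffle p q a b (size l) (nth 0%N l).
Proof.
elim: l p q A B a b => [|x l IH] p q A B a b la lb rA rB /=.
  case: p la rA => // la rA; case: q lb rB => // lb rB _ _.
  by rewrite ev_mul rA// rB//.
move=> szl /andP[x7 l7].
have fr (c : (nat -> nat) -> R) k s : local k.+1 c ->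
    c (nth 0%N (x :: s)) = front x c (nth 0%N s).
  by move=> lc; apply: lc => -[].
rewrite ev_add; congr (_ + _).
  case: p la rA szl => // p la rA szl.
  rewrite (IH _ _ _ _ (front x a) b) //; [exact: local_front| |by case: szl].
  by move=> s ss s7; rewrite rA/= ?ss ?x7// (fr _ _ _ la).
case: q lb rB szl => // q lb rB szl; rewrite ev_sgn.
rewrite (IH _ _ _ _ a (front x b)) //; [exact: local_front| |lia].
by move=> s ss s7; rewrite rB/= ?ss ?x7// (fr _ _ _ lb).
Qed.

Lemma represents_wedge p q A B (a : cochain R V p) (b : cochain R V q) :
  alternating (gtn 7) p (frame_eval h a) ->
  alternating (gtn 7) q (frame_eval h b) -> represents A a -> represents B b ->
  represents (pshuffle p q A B) (wedge a b).
Proof.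
move=> altA altB rA rB l szl l7.
rewrite (ev_pshuffle (@local_frame_eval _ _ h _ a) (@local_frame_eval _ _ h _ b) rA rB)//.
rewrite /frame_eval /wedge szl; set S := \sum_(s : _) _.
have -> : S = wsum (p + q) p (frame_eval h a) (frame_eval h b) (nth 0%N l).
  apply: eq_bigr => s _; congr (_ * (_ * _)).
    congr a; apply: eq_from_tnth => i; rewrite !tnth_mktuple; congr (h (nth _ _ _)).
    rewrite /perm_nat insubT; first exact: ltn_addr (ltn_ord i).
    by move=> lt; congr (nat_of_ord (s _)); apply: val_inj.
  congr b; apply: eq_from_tnth => i; rewrite !tnth_mktuple; congr (h (nth _ _ _)).
  rewrite /perm_nat insubT; first by rewrite ltn_add2l.
  by move=> lt; congr (nat_of_ord (s _)); apply: val_inj.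
rewrite (@wsum_shuffle _ (gtn 7) p q)//; first last.
- move=> i; case: (ltnP i (size l)) => lti; first exact: (all_nthP 0%N l7).
  by rewrite nth_default.
- exact: local_frame_eval.
- exact: local_frame_eval.
rewrite mulKf// pnatr_eq0 -lt0n muln_gt0 !fact_gt0//.
Qed.

Lemma represents_interior k A (a : cochain R V k.+1) i : (i < 7)%N ->
  represents A a -> represents (fun l => A (i :: l)) (interior (h i) a).
Proof.
move=> i7 rA l szl l7; rewrite rA/= ?szl ?i7// /frame_eval /interior.
congr a; apply: eq_from_tnth => j; rewrite !tnth_mktuple.
case: (unliftP ord0 j) => [r|] -> //.
by rewrite tnthS tnth_mktuple.
Qed.
End Represent.

Section FrameForms.
Variables (R : realType) (V : vectType R) (g : {dot V for idfun}).
Variables (h : nat -> V) (env : nat -> R).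

Lemma isort_sign (A : (nat -> nat) -> R) l : local (size l) A ->
  alternating (gtn 7) (size l) A -> all (gtn 7) l ->
  size (isort l).2 = size l /\ all (gtn 7) (isort l).2 /\
  A (nth 0%N l) = (-1) ^+ (isort l).1 * A (nth 0%N (isort l).2).
Proof.
elim: l A => [|x l IH] A locA altA /=; first by rewrite mul1r.
move=> /andP[x7 l7].
have [] := IH _ (local_front x locA) (alternating_front locA altA x7) l7.
case: (isort l) => b s /= ss [s7 e]; set j := find _ _.
have lej : (j <= size s)%N by apply: find_size.
have szs : size (take j s ++ x :: drop j s) = (size l).+1.
  by rewrite size_cat /= addnS -size_cat cat_take_drop ss.
have all7 : all (gtn 7) (take j s ++ x :: drop j s).
  rewrite all_cat /= andbCA; apply/andP; split=> //.
  by rewrite -all_cat cat_take_drop.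
split=> //; split=> //.
have -> : A (nth 0%N (x :: l)) = front x A (nth 0%N l) by apply: locA => -[].
rewrite e (@move_to_front _ (gtn 7) (size l).+1 A (nth 0%N (take j s ++ x :: drop j s)) j)//; first last.
- by rewrite -ss ltnS.
- move=> i; case: (ltnP i (size (take j s ++ x :: drop j s))) => lti.
    exact: (all_nthP 0%N all7).
  by rewrite nth_default.
rewrite signr_addb signr_odd mulrA -[_ * _ * (-1) ^+ j]mulrA -exprD addnn.
rewrite -(signr_odd _ j.*2) odd_double mulr1; congr (_ * _); apply: locA => -[|i] lti /=.
  by rewrite nth_cat size_takel// ltnn subnn.
rewrite nth_cat size_takel// /bump; case: (leqP j i) => leji.
  rewrite add1n ltnNge leqW// subSn// /= nth_drop subnKC//.
by rewrite add0n leji nth_take.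
Qed.

Variable n : nat.
Hypotheses (dimV : \dim {: V} = n) (oh : orthonormal_frame g n h).

Lemma on_seq_frame k (a : cochain R V k) l : size l = k ->
  on_seq a (map h l) = frame_eval h a (nth 0%N l).
Proof.
move=> sl; congr a; apply: eq_from_tnth => i.
by rewrite !tnth_mktuple (nth_map 0%N)// sl.
Qed.

Lemma hodge_onb p (e : p.-tuple V) : orthonormal g e -> orthonormal g (onb g p).
Proof.
move=> oe; rewrite /onb; case: xgetP => [x -> //|/(_ e)]; by case.
Qed.

Lemma kform_nonuniq k (a : cochain R V k) l : kform a -> size l = k -> ~~ uniq l ->
  frame_eval h a (nth 0%N l) = 0.
Proof.
move=> [_ za] sl /(uniqPn 0%N)[i [j [ltij ltj e]]]; rewrite sl in ltj.
apply: (za _ (Ordinal (ltn_trans ltij ltj)) (Ordinal ltj)).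
  by rewrite -val_eqE /= ltn_eqF.
by rewrite !tnth_mktuple /= e.
Qed.
End FrameForms.

Section HodgeFrame.
Variables (R : realType) (V : vectType R) (g : {dot V for idfun}).
Variables (h : nat -> V) (env : nat -> R).

(** The sum defining the star may be taken over the frame h ([nsum_frame]). A
repeated index, or an index of J, makes the volume form vanish; the p! orderings
of the complement of J contribute equally, which cancels 1 / p!. *)
Lemma represents_hodge p q (vol : cochain R V (p + q)) A (a : cochain R V p) :
  (p + q = 7)%N -> \dim {: V} = (p + q)%N -> orthonormal_frame g (p + q) h ->
  kform vol -> vol [tuple h i | i < p + q] = 1 ->
  multilinear a -> alternating (gtn 7) p (frame_eval h a) -> complement_sortedb p q ->
  represents h env A a -> represents h env (pstar (p + q) A) (hodge g vol a).
Proof.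
move=> pq dimV oh kvol vol1 la alta starpq rA J sJ J7.
have altv : alternating (gtn 7) (p + q) (frame_eval h vol).
  exact: alternating_kform.
pose F l := frame_eval h a (nth 0%N l) * frame_eval h vol (nth 0%N (l ++ J)).
have starE : frame_eval h (hodge g vol a) (nth 0%N J) = p`!%:R^-1 * nsum (p + q) p F.
  rewrite /frame_eval /hodge; congr (_ * _).
  set w := [tuple h (nth 0%N J i) | i < q]; set e := onb g (p + q).
  have oe : orthonormal_frame g (p + q) (nth 0 e).
    apply/orthonormal_tupleP/(@hodge_onb _ _ _ _ [tuple h i | i < p + q]).
    apply/orthonormal_tupleP => i j lti ltj.
    have nE k (ltk : (k < p + q)%N) : nth 0 [tuple h i | i < p + q] k = h k.
      by rewrite -[k]/(val (Ordinal ltk)) -tnth_nth tnth_mktuple.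
    by rewrite !nE// oh.
  pose B s := on_seq a s; pose C s := on_seq vol (s ++ w).
  transitivity (nsum (p + q) p (fun l => B (map (nth 0 e) l) * C (map (nth 0 e) l))).
    rewrite -sum_ffun_nsum; apply: eq_bigr => I _.
    have eE (i : 'I_p) : nth 0 [seq nth 0 e j | j <- [seq nat_of_ord (I i) | i <- enum 'I_p]] i = tnth e (I i).
      rewrite -map_comp (nth_map i) ?size_enum_ord//= nth_ord_enum.
      by rewrite -tnth_nth.
    have sI : size [seq nth 0 e j | j <- [seq nat_of_ord (I i) | i <- enum 'I_p]] = p.
      by rewrite 2!size_map size_enum_ord.
    congr (_ * _); first by congr a; apply: eq_from_tnth => i; rewrite !tnth_mktuple eE.
    congr vol; apply: eq_from_tnth => i; rewrite tnth_mktuple.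
    case: (split_ordP i) => j ->.
      by rewrite [RHS]nth_cat sI [X in (X < p)%N]/= ltn_ord eE tnth_lshift tnth_mktuple.
    by rewrite tnth_rshift (tnth_nth 0) [RHS]nth_cat sI ltnNge leq_addr [in RHS]/= addKn.
  rewrite (nsum_frame dimV (h := h) oe oh).
  - apply: eq_nsum => l sl; congr (_ * _); first exact: on_seq_frame.
    rewrite /C -on_seq_frame ?size_cat ?sl ?sJ// map_cat; congr (on_seq _ (_ ++ _)).
    apply: (@eq_from_nth _ 0); first by rewrite size_tuple size_map sJ.
    move=> i; rewrite size_tuple => lti; rewrite -[i]/(val (Ordinal lti)) -tnth_nth.
    by rewrite tnth_mktuple (nth_map 0%N) ?sJ.
  - have := @seq_multilinear_cat _ _ _ a p [::] [::] la; rewrite addn0 => /(_ erefl).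
    by under eq_fun do rewrite cat0s cats0.
  - have := @seq_multilinear_cat _ _ _ vol p [::] w (proj1 kvol).
    by rewrite size_tuple => /(_ erefl).
rewrite starE /pstar; case: ifP => uJ; last first.
  rewrite nsum_eq0 ?mulr0// => l sl l7; rewrite /F.
  have szlJ : size (l ++ J) = (p + q)%N by rewrite size_cat sl sJ.
  by rewrite (kform_nonuniq h kvol szlJ) ?mulr0// cat_uniq uJ !andbF.
have /allP/(_ J) := starpq; rewrite mem_lists sJ eqxx J7 uJ /= => /(_ isT)/andP[/eqP sK /eqP iK].
set K := complement (p + q) J in sK iK *.
have K7 : all (gtn 7) K.
  by apply/allP => x; rewrite mem_filter mem_iota pq => /andP[].
rewrite (@nsum_symmetric _ _ _ _ K)//.
- rewrite mulKf ?pnatr_eq0 -?lt0n ?fact_gt0// ev_sgn /F rA//.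
  have sKJ : size (K ++ J) = (p + q)%N by rewrite size_cat sK sJ.
  have [|||_ [_ ->]] := @isort_sign R (frame_eval h vol) (K ++ J).
  + by rewrite sKJ; exact: local_frame_eval.
  + by rewrite sKJ.
  + by rewrite all_cat K7.
  rewrite iK (_ : frame_eval h vol _ = 1) ?mulr1 1?mulrC//.
  rewrite -vol1; congr vol; apply: eq_from_tnth => i.
  by rewrite !tnth_mktuple nth_iota.
- by rewrite filter_uniq ?iota_uniq.
- by rewrite pq.
- move=> x s1 s2 ss; rewrite pq /= => /andP[x7]; rewrite all_cat => /andP[s17 s27].
  have mv k (A' : (nat -> nat) -> R) t : local k A' -> alternating (gtn 7) k A' ->
      (size s1 < k)%N -> all (gtn 7) t ->
      A' (nth 0%N (s1 ++ x :: t)) = (-1) ^+ size s1 * A' (nth 0%N (x :: s1 ++ t)).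
    move=> locA' altA' ltk t7; rewrite (move_to_front locA' altA' _ ltk); last first.
      move=> i; case: (ltnP i (size (s1 ++ x :: t))) => lti.
        have A7 : all (gtn 7) (s1 ++ x :: t) by rewrite all_cat s17 /=; apply/andP.
        exact: (all_nthP 0%N A7).
      by rewrite nth_default.
    congr (_ * _); apply: locA' => -[|i] _ /=; first by rewrite nth_cat ltnn subnn.
    rewrite !nth_cat /bump; case: (leqP (size s1) i) => le1.
      by rewrite add1n ltnNge leqW// subSn.
    by rewrite add0n le1.
  have lt1 : (size s1 < p)%N by rewrite -ss size_cat ltnS leq_addr.
  rewrite /F (mv p)//; last exact: local_frame_eval.
  rewrite -catA /= (mv (p + q)%N) ?all_cat ?s27 ?J7//; last first.
  + exact: leq_trans lt1 (leq_addr _ _).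
  + exact: local_frame_eval.
  by rewrite mulrACA -exprD addnn -signr_odd odd_double mul1r catA.
- move=> l sl; rewrite pq => l7 nl; rewrite /F.
  have szlJ : size (l ++ J) = (p + q)%N by rewrite size_cat sl sJ.
  rewrite (kform_nonuniq h kvol szlJ) ?mulr0//.
  apply: contra nl; rewrite cat_uniq => /and3P[-> /hasPn lJ _] /=.
  apply/allP => x xl; rewrite /= mem_filter mem_iota pq.
  apply/andP; split; last exact: (allP l7).
  by apply/negP => /lJ; rewrite /= xl.
Qed.
End HodgeFrame.

Section RepresentBracket.
Variables (R : realType) (V : vectType R) (g : {dot V for idfun}).
Variables (br : {bilinear V -> V -> V}) (h : nat -> V) (env : nat -> R).
Variable C : nat -> nat -> nat -> pol.
Hypotheses (dimV : \dim {: V} = 7%N) (oh : orthonormal_frame g 7 h).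

Definition represents_bracket := forall i j x, (i < 7)%N -> (j < 7)%N ->
  (x < 7)%N -> ev env (C i j x) = g (br (h i) (h j)) (h x).

Lemma represents_ced k A (a : cochain R V k.+1) :
  represents_bracket -> multilinear a -> represents h env A a ->
  represents h env (pced C k A) (ced br a).
Proof.
move=> rC la rA l sl l7; rewrite ev_sum big_allpairs_dep.
rewrite -[iota 0 k.+2]/(index_iota 0 k.+2) big_mkord; apply: eq_bigr => i _.
rewrite big_filter -[iota 0 k.+1]/(index_iota 0 k.+1) big_mkord.
apply: eq_bigr => j _.
rewrite ev_sgn ev_sum big_map; congr (_ * _).
have lt7 r : (nth 0%N l r < 7)%N.
  case: (ltnP r (size l)) => ltr; first exact: (all_nthP 0%N l7).
  by rewrite nth_default.
rewrite !tnth_mktuple (frame_expand dimV oh (br _ _)).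
set w := [tuple _ | l0 < k].
rewrite (scalar_sum _ _ _ _ (scalar_head w la)).
rewrite -[iota 0 7]/(index_iota 0 7) big_mkord; apply: eq_bigr => x _.
rewrite ev_mul rC//; congr (_ * _).
set L := _ :: _; have sL : size L = k.+1 by rewrite /= size_map size_iota.
have L7 : all (gtn 7) L.
  rewrite /= ltn_ord; apply/allP => _ /mapP[r _ ->]; exact: lt7.
rewrite rA//; congr a; apply: eq_from_tnth => r; rewrite tnth_mktuple.
case: (unliftP ord0 r) => [r'|] ->; last by [].
rewrite tnthS !tnth_mktuple [nth _ _ _]/= add0n (nth_map 0%N) ?size_iota//.
by rewrite nth_iota.
Qed.
End RepresentBracket.

(** * Curvature of the connection in a frame *)

(** Tables prevent entries that are used many times from being recomputed. *)
Definition tab3 (f : nat -> nat -> nat -> pol) : seq (seq (seq pol)) :=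
  [seq [seq [seq f i j k | k <- iota 0 7] | j <- iota 0 7] | i <- iota 0 7].
Definition get3 (t : seq (seq (seq pol))) i j k : pol :=
  nth [::] (nth [::] (nth [::] t i) j) k.

Lemma get3E f i j k : (i < 7)%N -> (j < 7)%N -> (k < 7)%N ->
  get3 (tab3 f) i j k = f i j k.
Proof.
by move=> i7 j7 k7; rewrite /get3 /tab3 !(nth_map 0%N) ?size_iota// !nth_iota.
Qed.

Section Computation.
Variables (P : seq nat -> pol) (C : nat -> nat -> nat -> pol) (L : pol).

Definition ppsi := pstar 7 P.
Definition pdphi := pced C 2 P.
Definition ptau := pshuffle 4 3 pdphi P (iota 0 7).

(** 6 times the torsion; tau stands for the component of d phi /\ phi. *)
Definition ptorsion (tau : pol) (l : seq nat) : pol :=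
  padd (pmul tau (P l)) (pscale (-6)%bZ (pstar 7 pdphi l)).

(** 12 times the coefficients of the connection, by the Koszul formula; L stands
for lambda. *)
Definition pconn (tau : pol) i j k : pol :=
  padd (pscale 6%bZ (padd (C i j k) (padd (pscale (-1)%bZ (C j k i)) (C k i j))))
       (pmul L (ptorsion tau [:: i; j; k])).

(** 144 times the curvature, where D is 12 times the connection. *)
Definition pcurv (D : nat -> nat -> nat -> pol) u v (l : seq nat) : pol :=
  let i := nth 0%N l 0 in let j := nth 0%N l 1 in
  psum [seq padd (padd (pmul (D j u k) (D i k v)) (pscale (-1)%bZ (pmul (D i u k) (D j k v))))
                 (pscale (-12)%bZ (pmul (C i j k) (D k u v))) | k <- iota 0 7].

(** The component of R /\ psi that omits the a-th frame vector, times 144. *)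
Definition pinst D a u v : pol :=
  pshuffle 2 4 (pcurv D u v) ppsi (rem a (iota 0 7)).

(** The covariant derivative of phi, times -12. *)
Definition pcovd (D : nat -> nat -> nat -> pol) x i j k : pol :=
  psum [seq padd (padd (pmul (D x i l) (P [:: l; j; k])) (pmul (D x j l) (P [:: i; l; k])))
                 (pmul (D x k l) (P [:: i; j; l])) | l <- iota 0 7].
End Computation.

Section Geometry.
Variables (R : realType) (V : vectType R) (br : {bilinear V -> V -> V}).
Variables (phi : cochain R V 3) (g : {dot V for idfun}) (vol : cochain R V 7).
Variables (lambda : R) (nabla : V -> V -> V).
Variables (h : nat -> V) (env : nat -> R).
Variables (P : seq nat -> pol) (C : nat -> nat -> nat -> pol) (L : pol).

Lemma multilinear_hodge p q (w : cochain R V (p + q)) (b : cochain R V p) :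
  multilinear w -> multilinear (hodge g w b).
Proof.
move=> lw v t; apply: scalar_scale; apply: scalar_bigsum => I _.
apply: scalar_scale.
set u := [tuple _ | i < p].
have E x : [tuple of u ++ tset v t x] = tset [tuple of u ++ v] (rshift p t) x.
  apply: eq_from_tnth => i; rewrite tnth_mktuple.
  case: (split_ordP i) => j ->; first by rewrite eq_lrshift !tnth_lshift.
  by rewrite eq_rshift !tnth_rshift tnth_mktuple.
by move=> c x y; rewrite (E (c *: x + y)) (E x) (E y) lw.
Qed.

Hypotheses (dimV : \dim {: V} = 7%N) (oh : orthonormal_frame g 7 h).
Hypotheses (kvol : kform vol) (vol1 : vol [tuple h i | i < 7] = 1).
Hypotheses (lphi : multilinear phi) (rP : represents h env P phi).
Hypotheses (altP : alternatingb 3 P) (rC : represents_bracket g br h env C).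
Hypotheses (altdP : alternatingb 4 (pdphi P C)) (altpsi : alternatingb 4 (ppsi P)).
Hypotheses (evL : ev env L = lambda).

Lemma starb43 : complement_sortedb 4 3. Proof. by vm_compute. Qed.
Lemma starb70 : complement_sortedb 7 0. Proof. by vm_compute. Qed.

Let altphi : alternating (gtn 7) 3 (frame_eval h phi).
Proof. exact: represents_alternating rP. Qed.

Lemma represents_psi : represents h env (ppsi P) (G2_psi phi g vol).
Proof. exact: (@represents_hodge _ _ g h env 3 4 vol P phi). Qed.

Lemma multilinear_psi : multilinear (G2_psi phi g vol).
Proof. exact: (@multilinear_hodge 3 4 vol phi (proj1 kvol)). Qed.

Lemma represents_dpsi : represents h env (pced C 3 (ppsi P)) (ced br (G2_psi phi g vol)).
Proof. exact: represents_ced rC multilinear_psi represents_psi. Qed.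

Lemma represents_dphi : represents h env (pdphi P C) (ced br phi).
Proof. exact: represents_ced rC lphi rP. Qed.

Let altdphi : alternating (gtn 7) 4 (frame_eval h (ced br phi)).
Proof. exact: represents_alternating represents_dphi. Qed.

Lemma ev_dphi_phi : ev env (ptau P C) = wedge (ced br phi) phi [tuple h i | i < 7].
Proof.
rewrite (@represents_wedge _ _ h env 4 3 _ _ (ced br phi) phi)//.
  congr (wedge _ _ _); apply: eq_from_tnth => i.
  by rewrite !tnth_mktuple nth_iota.
exact: represents_dphi.
Qed.

Lemma ev_phi_dphi : ev env (pshuffle 3 4 P (pdphi P C) (iota 0 7))
  = wedge phi (ced br phi) [tuple h i | i < 7].
Proof.
rewrite (@represents_wedge _ _ h env 3 4 _ _ phi (ced br phi))//.
  congr (wedge _ _ _); apply: eq_from_tnth => i.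
  by rewrite !tnth_mktuple nth_iota.
exact: represents_dphi.
Qed.

Lemma hodge_top : @hodge R V g 7 0 vol (wedge (ced br phi) phi) [tuple]
  = wedge (ced br phi) phi [tuple h i | i < 7].
Proof.
have ral : represents h env (pshuffle 4 3 (pdphi P C) P) (wedge (ced br phi) phi).
  by apply: (@represents_wedge _ _ h env 4 3) => //; exact: represents_dphi.
have lal : multilinear (wedge (ced br phi) phi).
  by apply: (@multilinear_wedge _ _ 4 3) => //; exact: multilinear_ced.
have aal : alternating (gtn 7) 7 (frame_eval h (wedge (ced br phi) phi)).
  exact: (@alternating_wedge _ _ _ h 4 3).
have := @represents_hodge _ _ g h env 7 0 vol _ _ erefl dimV oh kvol vol1 lal aal starb70 ral [::] erefl isT.
rewrite -ev_dphi_phi => e.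
have -> : [tuple] = [tuple h (nth 0%N [::] i) | i < 0] by apply: eq_from_tnth => -[].
by rewrite -[LHS]e /ptau.
Qed.

Lemma ev_torsion i j k : (i < 7)%N -> (j < 7)%N -> (k < 7)%N ->
  ev env (ptorsion P C (ptau P C) [:: i; j; k])
  = 6 * torsion br phi g vol [tuple h i; h j; h k].
Proof.
move=> i7 j7 k7.
have E : [tuple h (nth 0%N [:: i; j; k] r) | r < 3] = [tuple h i; h j; h k].
  by apply: eq_from_tnth => r; rewrite tnth_mktuple; case: r => -[|[|[|//]]].
have all7 : all (gtn 7) [:: i; j; k] by rewrite /= i7 j7 k7.
rewrite /torsion hodge_top -ev_dphi_phi ev_add ev_mul ev_scale rP// /frame_eval E.
rewrite (@represents_hodge _ _ g h env 4 3 vol _ _ erefl dimV oh kvol vol1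
  (multilinear_ced br lphi) altdphi starb43 represents_dphi)//.
rewrite /frame_eval E (_ : zc R _ = - 6); last by rewrite /zc.
by field.
Qed.

Lemma multilinear_torsion : multilinear (torsion br phi g vol).
Proof.
move=> v t; have lh := @multilinear_hodge 4 3 vol (ced br phi) (proj1 kvol).
rewrite /torsion => c x y; rewrite lphi lh; ring.
Qed.

Section Slots.
Variables (a : cochain R V 3).
Hypothesis la : multilinear a.

Lemma scalar_slot1 y z : scalar (fun x => a [tuple x; y; z]).
Proof.
have E w : [tuple w; y; z] = tset [tuple 0; y; z] ord0 w.
  by apply: eq_from_tnth => -[[|[|[|//]]]] ?; rewrite tnth_mktuple.
by move=> c x x'; rewrite (E (c *: x + x')) (E x) (E x') la.
Qed.

Lemma scalar_slot2 x z : scalar (fun y => a [tuple x; y; z]).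
Proof.
have E w : [tuple x; w; z] = tset [tuple x; 0; z] (lift ord0 ord0) w.
  by apply: eq_from_tnth => -[[|[|[|//]]]] ?; rewrite tnth_mktuple.
by move=> c y y'; rewrite (E (c *: y + y')) (E y) (E y') la.
Qed.

Lemma scalar_slot3 x y : scalar (fun z => a [tuple x; y; z]).
Proof.
have E w : [tuple x; y; w] = tset [tuple x; y; 0] ord_max w.
  by apply: eq_from_tnth => -[[|[|[|//]]]] ?; rewrite tnth_mktuple.
by move=> c z z'; rewrite (E (c *: z + z')) (E z) (E z') la.
Qed.
End Slots.

Hypothesis conn : G2_connection br phi g vol lambda nabla.

Lemma koszul (nablag : {bilinear V -> V -> V}) x y z : levi_civita br g nablag ->
  2 * g (nablag x y) z = g (br x y) z - g (br y z) x + g (br z x) y.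
Proof.
move=> [tors met]; rewrite -!tors !metricBl.
have mt a b c : g (nablag a b) c = - g (nablag a c) b.
  by apply/eqP; rewrite -addr_eq0 (metricC g (nablag a c)) met.
have := mt x z y; have := mt y x z; have := mt z x y.
lra.
Qed.

Lemma nabla_linear x c y y' :
  nabla x (c *: y + y') = c *: nabla x y + nabla x y'.
Proof.
have [nablag _ cE] := conn; apply: (@metric_inj _ _ g) => z.
rewrite metricDl metricZl !cE linearDr linearZr_LR metricDl metricZl.
rewrite (scalar_slot2 multilinear_torsion); ring.
Qed.

Lemma nabla_linearl c x x' y :
  nabla (c *: x + x') y = c *: nabla x y + nabla x' y.
Proof.
have [nablag _ cE] := conn; apply: (@metric_inj _ _ g) => z.
rewrite metricDl metricZl !cE linearDl linearZl_LR metricDl metricZl.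
rewrite (scalar_slot1 multilinear_torsion); ring.
Qed.

Lemma ev_conn i j k : (i < 7)%N -> (j < 7)%N -> (k < 7)%N ->
  ev env (pconn P C L (ptau P C) i j k) = 12 * g (nabla (h i) (h j)) (h k).
Proof.
move=> i7 j7 k7; have [nablag lc ->] := conn.
rewrite ev_add ev_scale !ev_add ev_scale !rC// ev_mul evL ev_torsion//.
have := koszul (h i) (h j) (h k) lc.
rewrite (_ : zc R 6%bZ = 6)// (_ : zc R (-1)%bZ = -1)//.
lra.
Qed.

Variable D : nat -> nat -> nat -> pol.
Hypothesis evD : forall i j k, (i < 7)%N -> (j < 7)%N -> (k < 7)%N ->
  ev env (D i j k) = 12 * g (nabla (h i) (h j)) (h k).

Lemma frame_sum (f : V -> R) x : scalar f ->
  f x = \sum_(l < 7) g x (h l) * f (h l).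
Proof. by move=> lf; rewrite {1}(frame_expand dimV oh x) (scalar_sum _ _ _ _ lf). Qed.

Lemma ev_curv i j u v : (i < 7)%N -> (j < 7)%N -> (u < 7)%N -> (v < 7)%N ->
  ev env (pcurv C D u v [:: i; j])
  = 144 * g (curvature br nabla (h i) (h j) (h u)) (h v).
Proof.
move=> i7 j7 u7 v7; rewrite /curvature !metricBl.
have ln x : scalar (fun y => g (nabla x y) (h v)).
  by move=> c y y'; rewrite nabla_linear metricDl metricZl.
have lnl y : scalar (fun x => g (nabla x y) (h v)).
  by move=> c x x'; rewrite nabla_linearl metricDl metricZl.
rewrite (frame_sum (nabla (h j) (h u)) (ln (h i))).
rewrite (frame_sum (nabla (h i) (h u)) (ln (h j))).
rewrite (frame_sum (br (h i) (h j)) (lnl (h u))).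
rewrite -!sumrB mulr_sumr ev_sum big_map -[iota 0 7]/(index_iota 0 7) big_mkord.
apply: eq_bigr => l _; rewrite !ev_add !ev_scale !ev_mul !evD// rC//.
rewrite (_ : zc R (-1)%bZ = -1)// (_ : zc R (-12)%bZ = -12)//.
ring.
Qed.

Hypothesis br_alt : forall x, br x x = 0.

Lemma br_anti x y : br y x = - br x y.
Proof.
have := br_alt (x + y); rewrite linearDl !linearDr !br_alt add0r addr0 => /eqP.
by rewrite addrC addr_eq0 => /eqP.
Qed.

Lemma nablaN x y : nabla (- x) y = - nabla x y.
Proof.
have n0 : nabla 0 y = 0.
  have := nabla_linearl 1 0 0 y; rewrite scaler0 addr0 scale1r => e.
  by apply: (addrI (nabla 0 y)); rewrite addr0.
by have := nabla_linearl (-1) x 0 y; rewrite !addr0 !scaleN1r n0 addr0.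
Qed.

(** The form (x, y) -> 144 g (R_(x, y) u, v) is represented by [pcurv]; it alternates
because nabla is linear in its first argument. *)
Lemma ev_inst a u v : (a < 7)%N -> (u < 7)%N -> (v < 7)%N ->
  G2_instanton br phi g vol nabla -> ev env (pinst P C D a u v) = 0.
Proof.
move=> a7 u7 v7 inst.
pose om (xy : 2.-tuple V) :=
  144 * g (curvature br nabla (tnth xy ord0) (tnth xy ord_max) (h u)) (h v).
have alt_om : alternating (gtn 7) 2 (frame_eval h om).
  move=> m [|//] _ _; rewrite /frame_eval /om !tnth_mktuple /= -mulrN -metricNl.
  rewrite /swap /=; congr (_ * g _ _); rewrite /curvature (br_anti (h (m 0%N))) nablaN.
  by rewrite opprK opprD opprB opprK.
have rom : represents h env (pcurv C D u v) om.
  move=> [|i [|j [|//]]]// _ /and3P[i7 j7 _].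
  by rewrite ev_curv// /frame_eval /om !tnth_mktuple.
have rpsi := represents_psi.
have szl : size (rem a (iota 0 7)) = 6 by rewrite size_rem ?size_iota ?mem_iota.
have l7 : all (gtn 7) (rem a (iota 0 7)).
  by apply/allP => x /mem_rem; rewrite mem_iota.
rewrite /pinst (@represents_wedge _ _ h env 2 4 _ _ om _ alt_om _ rom rpsi)//.
  rewrite /frame_eval; have := inst (h u) (h v) [tuple h (nth 0%N (rem a (iota 0 7)) i) | i < 6].
  rewrite /wedge => /(congr1 (fun t => 144 * t)); rewrite mulr0 => e.
  rewrite -[RHS]e mulrCA; congr (_ * _); rewrite mulr_sumr; apply: eq_bigr => s _.
  by rewrite /om [RHS]mulrCA -[144 * _ * _]mulrA.
exact: represents_alternating rpsi.
Qed.

Lemma frame_eq0 (f : V -> R) x : scalar f ->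
  (forall i, (i < 7)%N -> f (h i) = 0) -> f x = 0.
Proof.
by move=> lf f0; rewrite (frame_sum x lf) big1// => i _; rewrite f0 ?mulr0.
Qed.

Lemma ev_covd x i j k : (x < 7)%N -> (i < 7)%N -> (j < 7)%N -> (k < 7)%N ->
  ev env (pcovd P D x i j k)
  = 12 * (phi [tuple nabla (h x) (h i); h j; h k]
          + phi [tuple h i; nabla (h x) (h j); h k]
          + phi [tuple h i; h j; nabla (h x) (h k)]).
Proof.
move=> x7 i7 j7 k7.
rewrite (frame_sum (nabla (h x) (h i)) (scalar_slot1 lphi _ _)).
rewrite (frame_sum (nabla (h x) (h j)) (scalar_slot2 lphi _ _)).
rewrite (frame_sum (nabla (h x) (h k)) (scalar_slot3 lphi _ _)).
rewrite -!big_split mulr_sumr ev_sum big_map -[iota 0 7]/(index_iota 0 7) big_mkord.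
apply: eq_bigr => l _.
have rPE a b c : (a < 7)%N -> (b < 7)%N -> (c < 7)%N ->
    ev env (P [:: a; b; c]) = phi [tuple h a; h b; h c].
  move=> a7 b7 c7; rewrite rP//=; last by rewrite a7 b7 c7.
  by congr phi; apply: eq_from_tnth => -[[|[|[|//]]]] ?; rewrite tnth_mktuple.
rewrite !ev_add !ev_mul !evD// !rPE//=; ring.
Qed.

(** nabla phi is linear in each of its four arguments, hence zero as soon as it
vanishes on the frame. *)
Lemma parallel_frame :
  (forall x i j k, (x < 7)%N -> (i < 7)%N -> (j < 7)%N -> (k < 7)%N ->
     ev env (pcovd P D x i j k) = 0) -> parallel nabla phi.
Proof.
move=> K0 x v.
pose K x a b c := phi [tuple nabla x a; b; c] + phi [tuple a; nabla x b; c]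
  + phi [tuple a; b; nabla x c].
have -> : covd nabla phi x v = - K x (tnth v ord0) (tnth v (lift ord0 ord0)) (tnth v ord_max).
  rewrite /covd !big_ord_recl big_ord0 addr0 addrA; congr (- (_ + _ + _));
    congr phi; apply: eq_from_tnth => -[[|[|[|//]]]] ?;
    by rewrite tnth_mktuple !(tnth_nth 0).
rewrite -[RHS]oppr0; congr (- _).
move: (tnth v ord0) (tnth v (lift ord0 ord0)) (tnth v ord_max) => a b c.
have l1 := scalar_slot1 lphi; have l2 := scalar_slot2 lphi; have l3 := scalar_slot3 lphi.
apply: (frame_eq0 (f := fun x => K x a b c)) => [t y y'|x' x7].
  by rewrite /K !nabla_linearl l1 l2 l3; ring.
apply: (frame_eq0 (f := fun a => K (h x') a b c)) => [t y y'|i i7].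
  by rewrite /K !nabla_linear !l1; ring.
apply: (frame_eq0 (f := fun b => K (h x') (h i) b c)) => [t y y'|j j7].
  by rewrite /K !nabla_linear !l2; ring.
apply: (frame_eq0 (f := fun c => K (h x') (h i) (h j) c)) => [t y y'|k k7].
  by rewrite /K !nabla_linear !l3; ring.
have := ev_covd x7 i7 j7 k7; rewrite K0// => /esym/eqP.
by rewrite mulf_eq0 pnatr_eq0 => /eqP.
Qed.
End Geometry.

(** * Models of the form and of the bracket *)

(** The alternating form with prescribed values on increasing lists of indices. *)
Definition pform (terms : seq (seq nat * pol)) (l : seq nat) : pol :=
  if uniq l then
    let: (b, s) := isort l in
    psgn b (nth [::] (unzip2 terms) (index s (unzip1 terms)))
  else [::].

Definition pneg := pscale (-1)%bZ.

(** In the coframe dual to z1, z2, z3, w1, w2, w3, t (numbered from 0), this is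
t /\ (w1 /\ z1 + w2 /\ z2 + w3 /\ z3) + Re ((c - i s) (z1 + i w1) /\ (z2 + i w2)
/\ (z3 + i w3)). *)
Definition ptwisted (c s : pol) : seq nat -> pol := pform
  [:: ([:: 0; 1; 2], c); ([:: 0; 4; 5], pneg c); ([:: 1; 3; 5], c); ([:: 2; 3; 4], pneg c);
      ([:: 1; 2; 3], s); ([:: 0; 2; 4], pneg s); ([:: 0; 1; 5], s); ([:: 3; 4; 5], pneg s);
      ([:: 0; 3; 6], pconst (-1)%bZ); ([:: 1; 4; 6], pconst (-1)%bZ);
      ([:: 2; 5; 6], pconst (-1)%bZ)]%N.

Lemma twisted_ext (R : realType) (env1 env2 : nat -> R) p1 q1 p2 q2 l :
  ev env1 p1 = ev env2 p2 -> ev env1 q1 = ev env2 q2 ->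
  ev env1 (ptwisted p1 q1 l) = ev env2 (ptwisted p2 q2 l).
Proof.
move=> ep eq; rewrite /ptwisted /pform; case: uniq => //.
case: (isort l) => b s; rewrite !ev_sgn; congr (_ * _).
move: (index _ _); rewrite /= => k.
do 11 (case: k => [|k] /=; first by rewrite ?ev_scale ?ep ?eq).
by case: k.
Qed.

(** The bracket with values in the span of z1, z2, z3 whose x-th component on the
i-th and j-th frame vectors, i < j, is B x i j. *)
Definition pbracket (B : nat -> nat -> nat -> pol) i j x : pol :=
  if (x < 3)%N then
    if (i < j)%N then B x i j else if (j < i)%N then pneg (B x j i) else [::]
  else [::].

(** Throughout, variables 0 and 1 are c and s, variable 2 is lambda, variables 3 to
8 are the entries 00, 01, 02, 11, 12, 22 of the symmetric matrix S, and variables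
9 to 17 are the entries of eta, row by row. *)
Definition psym i j : pol :=
  pvar (3 + minn i j * 2 + maxn i j - (minn i j == 2))%N.

Definition pgen i j : pol := pvar (9 + 3 * i + j).

(** Let (i, j, k) run over the cyclic permutations of (1, 2, 3). The bracket of w_i
and t is the i-th column of S + eta, and the bracket of w_j and w_k that of
S - eta: S and eta are the restrictions of the bracket to self-dual and
anti-self-dual two-vectors, up to the factor 2. *)
Definition pbr_cal (S : nat -> nat -> pol) x i j : pol :=
  match i, j with
  | 3, 6 => padd (S x 0) (pgen x 0)
  | 4, 6 => padd (S x 1) (pgen x 1)
  | 5, 6 => padd (S x 2) (pgen x 2)
  | 4, 5 => padd (S x 0) (pneg (pgen x 0))
  | 3, 5 => padd (pneg (S x 1)) (pgen x 1)
  | 3, 4 => padd (S x 2) (pneg (pgen x 2))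
  | _, _ => [::]
  end%N.

Definition pbr_noncal x i j : pol :=
  match i, j with
  | 3, 6 => psym x 0
  | 4, 6 => psym x 1
  | 5, 6 => psym x 2
  | _, _ => [::]
  end%N.

(** The calibrated case c = 1, s = 0. *)
Definition pphi_cal := ptwisted (pconst 1%bZ) [::].
Definition pphi_cs := ptwisted (pvar 0) (pvar 1).

(** * Frames adapted to the form *)
Lemma alternating_phi_cs : alternatingb 3 pphi_cs.
Proof. by vm_compute. Qed.

Lemma alternating_interior_phi_cs :
  all (fun k => alternatingb 2 (fun l => pphi_cs (k :: l))) (iota 0 7).
Proof. by vm_compute. Qed.

Lemma adapted_metric :
  all (fun i => all (fun j =>
    pcircle (pshuffle 4 3
      (pshuffle 2 2 (fun l => pphi_cs (i :: l)) (fun l => pphi_cs (j :: l))) pphi_cs (iota 0 7))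
    == pconst (if i == j then 6 else 0)%bZ) (iota 0 7)) (iota 0 7).
Proof. by vm_compute. Qed.

Section AdaptedFrames.
Variables (R : realType) (V : vectType R) (g : {dot V for idfun}).
Variables (phi : cochain R V 3) (vol : cochain R V 7).
Hypothesis metric : G2_metric phi g vol.

Lemma seq_multilinear_scale p (B : seq V -> R) r s : seq_multilinear p B ->
  size s = p -> B [seq r *: x | x <- s] = r ^+ p * B s.
Proof.
elim: p B s => [|p IH] B [|x s]//= ; first by rewrite mul1r.
move=> [lB mB] [sp].
have := @scalar_sum _ _ (fun x => B (x :: [seq r *: x | x <- s])) _ [:: tt] xpredT (fun=> r) (fun=> x).
rewrite !big_seq1 => ->; last by apply: lB; rewrite size_map.
by rewrite (IH (fun s => B (x :: s)) s)// exprS mulrA.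
Qed.

(** Evaluated on the frame, the identity that determines the metric reads
g (h i) (h j) * v = (i == j), where v is the volume of h. Hence v > 0 and the
frame r h is orthonormal for r = sqrt v. Its volume r^7 v = r^9 has absolute value
1, so that v = 1. *)
Lemma adapted_orthonormal h env : env 0%N ^+ 2 + env 1%N ^+ 2 = 1 ->
  represents h env pphi_cs phi ->
  orthonormal_frame g 7 h /\ vol [tuple h i | i < 7] = 1.
Proof.
move=> cs1 rP.
have altP := represents_alternating alternating_phi_cs rP.
set v := vol [tuple h i | i < 7].
have gv i j : (i < 7)%N -> (j < 7)%N -> g (h i) (h j) * v = (i == j)%:R.
  move=> i7 j7; have /allP/(_ i) := adapted_metric; rewrite mem_iota => /(_ i7)/allP/(_ j).
  rewrite mem_iota => /(_ j7)/eqP/(congr1 (ev env)).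
  have ri k : (k < 7)%N -> represents h env (fun l => pphi_cs (k :: l)) (interior (h k) phi).
    by move=> k7; exact: represents_interior.
  have ai k : (k < 7)%N -> alternating (gtn 7) 2 (frame_eval h (interior (h k) phi)).
    move=> k7; apply: represents_alternating (ri k k7).
    by apply: (allP alternating_interior_phi_cs); rewrite mem_iota.
  have r22 := @represents_wedge _ _ h env 2 2 _ _ _ _ (ai i i7) (ai j j7) (ri i i7) (ri j j7).
  have a22 := @alternating_wedge _ _ (gtn 7) h 2 2 (interior (h i) phi) (interior (h j) phi).
  have r43 := @represents_wedge _ _ h env 4 3 _ _ _ _ a22 altP r22 rP (iota 0 7) erefl isT.
  rewrite (ev_circle _ cs1) r43.
  rewrite /frame_eval metric.2 (_ : [tuple _ | _ < _] = [tuple h k | k < 7]).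
    rewrite -/v ev_const -mulrA => e.
    apply: (@mulfI _ 6); first by rewrite pnatr_eq0.
    by rewrite e; case: (i == j); rewrite ?mulr1 ?mulr0 /zc.
  by apply: eq_from_tnth => k; rewrite !tnth_mktuple nth_iota.
have gv0 : g (h 0%N) (h 0%N) * v = 1 by rewrite gv.
have v0 : 0 < v.
  have := metric_ge0 g (h 0%N); rewrite le_eqVlt => /orP[/eqP e|gp].
    by move: gv0; rewrite -e mul0r => /esym/eqP; rewrite oner_eq0.
  by rewrite -(pmulr_rgt0 _ gp) gv0.
pose r := Num.sqrt v; have r0 : 0 < r by rewrite sqrtr_gt0.
have rr : r ^+ 2 = v by rewrite sqr_sqrtr// ltW.
have [[lvol _] vol1] := metric.1.
have oe : orthonormal g [tuple r *: h i | i < 7].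
  apply/orthonormal_tupleP => i j i7 j7.
  have nE k : (k < 7)%N -> nth 0 [tuple r *: h i | i < 7] k = r *: h k.
    by move=> k7; rewrite -[k]/(val (Ordinal k7)) -tnth_nth tnth_mktuple.
  rewrite (nE i i7) (nE j j7) metricZl metricZr mulrA -expr2 rr mulrC; exact: gv.
have := vol1 _ oe.
have := seq_multilinear_scale (B := on_seq vol) (p := 7) r (s := map h (iota 0 7)).
rewrite size_map size_iota => /(_ _ erefl).
have onE (k : nat -> V) : on_seq vol [seq k i | i <- iota 0 7] = vol [tuple k i | i < 7].
  rewrite (on_seq_frame k vol (size_iota 0 7)); apply: (congr1 vol).
  apply: eq_from_tnth => j. by rewrite !tnth_mktuple nth_iota.
rewrite -map_comp (onE h) (onE (fun i => r *: h i)) -/v.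
move=> ->; last first.
  have := @seq_multilinear_cat _ _ _ vol 7 [::] [::] lvol erefl.
  by under eq_fun do rewrite cat0s cats0.
rewrite -[X in _ * X]rr -exprD gtr0_norm ?exprn_gt0// => /eqP.
rewrite pexpr_eq1 ?ltW// => /eqP r1.
have v1 : v = 1 by rewrite -rr r1 expr1n.
by split=> // i j i7 j7; rewrite -[RHS]gv// v1 mulr1.
Qed.
End AdaptedFrames.

(** * Cross product and Cayley bases *)

(** The z-component of the polarisation of a x (a x y) = g a y a - g a a y, for
frame vectors a, b, y, z. *)
Definition pcross_id a b y z : pol :=
  let d i j : Z := if i == j then 1%bZ else 0%bZ in
  padd (psum [seq padd (pmul (pphi_cal [:: b; y; l]) (pphi_cal [:: a; l; z]))
                       (pmul (pphi_cal [:: a; y; l]) (pphi_cal [:: b; l; z])) | l <- iota 0 7])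
       (pconst (Z.sub (Z.mul 2%bZ (Z.mul (d a b) (d y z)))
                      (Z.add (Z.mul (d a y) (d b z)) (Z.mul (d b y) (d a z))))).

Lemma cross_idE : all (fun a => all (fun b => all (fun y => all (fun z =>
  nilp (pcross_id a b y z)) (iota 0 7)) (iota 0 7)) (iota 0 7)) (iota 0 7).
Proof. by vm_compute. Qed.

Section CrossProduct.
Variables (R : realType) (V : vectType R) (g : {dot V for idfun}).
Variables (phi : cochain R V 3) (f : nat -> V) (env : nat -> R).
Hypotheses (dimV : \dim {: V} = 7%N) (onf : orthonormal_frame g 7 f).
Hypotheses (lphi : multilinear phi) (rP : represents f env pphi_cal phi).
Hypothesis aphi : forall h : nat -> V, alternating predT 3 (frame_eval h phi).

Local Notation F x y z := (phi [tuple x; y; z]).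

Definition cross x y : V := \sum_(l < 7) F x y (f l) *: f l.

Lemma crossE x y z : g (cross x y) z = F x y z.
Proof.
rewrite (frame_sum dimV onf z (scalar_slot3 lphi x y)) metric_suml.
by apply: eq_bigr => l _; rewrite metricZl (metricC _ z) mulrC.
Qed.

Lemma phi_swap x y z : F y x z = - F x y z /\ F x z y = - F x y z.
Proof.
have e0 := @aphi (nth 0 [:: x; y; z]) id 0%N (fun=> isT) isT.
have e1 := @aphi (nth 0 [:: x; y; z]) id 1%N (fun=> isT) isT.
have E : [tuple nth 0 [:: x; y; z] (id i) | i < 3] = [tuple x; y; z].
  by apply: eq_from_tnth => -[[|[|[|//]]]] ?; rewrite tnth_mktuple.
rewrite /frame_eval E in e0 e1.
by split; [rewrite -e0|rewrite -e1]; congr phi;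
  apply: eq_from_tnth => -[[|[|[|//]]]] ?; rewrite tnth_mktuple.
Qed.

Lemma phi_swap12 x y z : F y x z = - F x y z.
Proof. exact: (phi_swap x y z).1. Qed.
Lemma phi_swap23 x y z : F x z y = - F x y z.
Proof. exact: (phi_swap x y z).2. Qed.

Lemma phi_xx x z : F x x z = 0.
Proof. by apply/eqP; rewrite -eqNr; apply/eqP; rewrite -phi_swap12. Qed.

Lemma phi_xyx x y : F x y x = 0.
Proof. by rewrite phi_swap23 phi_xx oppr0. Qed.

Lemma phi_yxx x y : F y x x = 0.
Proof. by rewrite phi_swap12 phi_xyx oppr0. Qed.

Lemma crossC x y : cross y x = - cross x y.
Proof. by apply: (@metric_inj _ _ g) => z; rewrite metricNl !crossE phi_swap12. Qed.

Lemma cross_linear x c y y' :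
  cross x (c *: y + y') = c *: cross x y + cross x y'.
Proof.
apply: (@metric_inj _ _ g) => z.
by rewrite metricDl metricZl !crossE (scalar_slot2 lphi).
Qed.

Lemma cross_linearl c x x' y :
  cross (c *: x + x') y = c *: cross x y + cross x' y.
Proof.
apply: (@metric_inj _ _ g) => z.
by rewrite metricDl metricZl !crossE (scalar_slot1 lphi).
Qed.

Lemma cross0r x : cross x 0 = 0.
Proof.
apply: (@metric_inj _ _ g) => z; rewrite metric0l crossE -[RHS](subrr (F x 0 z)).
by have := scalar_slot2 lphi x z (-1) 0 0; rewrite scaler0 addr0 mulN1r addNr subrr.
Qed.

Lemma crossNr x y : cross x (- y) = - cross x y.
Proof.
by have := cross_linear x (-1) y 0; rewrite !addr0 !scaleN1r cross0r addr0.
Qed.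

(** Polarisation of a x (a x y) = g a y a - g a a y: both sides are linear in
a, b, y, and the components in the frame are numbers. *)
Lemma cross_cross a b y : cross a (cross b y) + cross b (cross a y)
  = g a y *: b + g b y *: a - (2 * g a b) *: y.
Proof.
apply: (@metric_inj _ _ g) => z; rewrite metricBl !metricDl !metricZl !crossE.
have l1 := scalar_slot1 lphi; have l2 := scalar_slot2 lphi; have l3 := scalar_slot3 lphi.
apply/eqP; rewrite -subr_eq0; apply/eqP.
pose K a b y z := F a (cross b y) z + F b (cross a y) z
  - (g a y * g b z + g b y * g a z - 2 * g a b * g y z).
rewrite -[LHS]/(K a b y z).
apply: (frame_eq0 dimV onf (f := fun a => K a b y z)) => [c t t'|i i7].
  by rewrite /K cross_linearl l1 l2 !metricDl !metricZl; ring.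
apply: (frame_eq0 dimV onf (f := fun b => K (f i) b y z)) => [c t t'|j j7].
  by rewrite /K cross_linearl l1 l2 !metricDl !metricDr !metricZl !metricZr; ring.
apply: (frame_eq0 dimV onf (f := fun y => K (f i) (f j) y z)) => [c t t'|k k7].
  by rewrite /K !cross_linear !l2 !metricDl !metricDr !metricZl !metricZr; ring.
apply: (frame_eq0 dimV onf (f := fun z => K (f i) (f j) (f k) z)) => [c t t'|r r7].
  by rewrite /K !l3 !metricDr !metricZr; ring.
have /allP/(_ i) := cross_idE; rewrite mem_iota => /(_ i7).
move=> /allP/(_ j); rewrite mem_iota => /(_ j7).
move=> /allP/(_ k); rewrite mem_iota => /(_ k7).
move=> /allP/(_ r); rewrite mem_iota => /(_ r7)/nilP/(congr1 (ev env)).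
have rPE u v w : (u < 7)%N -> (v < 7)%N -> (w < 7)%N ->
    ev env (pphi_cal [:: u; v; w]) = F (f u) (f v) (f w).
  move=> u7 v7 w7; rewrite rP//=; last by rewrite u7 v7 w7.
  by congr phi; apply: eq_from_tnth => -[[|[|[|//]]]] ?; rewrite tnth_mktuple.
have dE u v : zc R (if u == v then 1 else 0)%bZ = (u == v)%:R by case: eqP.
rewrite ev_add ev_const ev_sum big_map -[iota 0 7]/(index_iota 0 7) big_mkord.
rewrite /K (frame_sum dimV onf (cross (f j) (f k)) (l2 (f i) (f r))).
rewrite (frame_sum dimV onf (cross (f i) (f k)) (l2 (f j) (f r))) -big_split.
rewrite !onf// => e; rewrite -[RHS]e; congr (_ + _).
  by apply: eq_bigr => l _; rewrite ev_add !ev_mul !rPE// !crossE.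
have zcB u v : zc R (Z.sub u v) = zc R u - zc R v.
  by rewrite /zc (rmorphB int_of_Z) rmorphB.
by rewrite zcB !zcM zcD !zcM !dE (_ : zc R 2%bZ = 2)//; ring.
Qed.

Lemma cross_sq a y : g a a = 1 -> g a y = 0 -> cross a (cross a y) = - y.
Proof.
move=> aa ay; have := cross_cross a a y; rewrite aa ay !scale0r add0r sub0r mulr1.
rewrite -mulr2n -scaler_nat -scalerN => e.
by apply: (scalerI (a := 2)); rewrite ?pnatr_eq0.
Qed.

Lemma cross_anti a b y : g a b = 0 -> g a y = 0 -> g b y = 0 ->
  cross a (cross b y) = - cross b (cross a y).
Proof.
move=> ab ay yb; apply/eqP; rewrite -addr_eq0 cross_cross ab ay yb mulr0.
by rewrite !scale0r addr0 subr0.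
Qed.

Lemma cross_isometry a b d : g a a = 1 -> g a b = 0 ->
  g (cross a b) (cross a d) = g b d.
Proof.
move=> aa ab; rewrite metricC crossE phi_swap23 -crossE cross_sq//.
by rewrite metricNl opprK.
Qed.
End CrossProduct.

(** Coefficient and index of the cross product of two elements of the Cayley basis
x, y, x y, y m, x m, m, (x y) m. *)
Definition cayley_table i j : Z * nat :=
  match i, j with
  | 0, 1 => (1%bZ, 2) | 0, 2 => ((-1)%bZ, 1) | 0, 3 => ((-1)%bZ, 6)
  | 0, 4 => ((-1)%bZ, 5) | 0, 5 => (1%bZ, 4) | 0, 6 => (1%bZ, 3)
  | 1, 2 => (1%bZ, 0) | 1, 3 => ((-1)%bZ, 5) | 1, 4 => (1%bZ, 6)
  | 1, 5 => (1%bZ, 3) | 1, 6 => ((-1)%bZ, 4)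
  | 2, 3 => (1%bZ, 4) | 2, 4 => ((-1)%bZ, 3) | 2, 5 => (1%bZ, 6)
  | 2, 6 => ((-1)%bZ, 5)
  | 3, 4 => (1%bZ, 2) | 3, 5 => ((-1)%bZ, 1) | 3, 6 => ((-1)%bZ, 0)
  | 4, 5 => ((-1)%bZ, 0) | 4, 6 => (1%bZ, 1)
  | 5, 6 => (1%bZ, 2)
  | _, _ => (0%bZ, 0)
  end%N.

(** Coordinates of the frame of ptwisted c s in the Cayley basis: its third vector
is c (x y) + s m, its sixth s (x y) - c m. *)
Definition cayley_frame (c s : pol) i j : pol :=
  match i, j with
  | 0, 0 | 1, 1 | 3, 3 | 6, 6 => pconst 1%bZ
  | 4, 4 => pconst (-1)%bZ
  | 2, 2 => c | 2, 5 => s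
  | 5, 2 => s | 5, 5 => pneg c
  | _, _ => [::]
  end%N.

Definition pcayley i j k : pol :=
  let e i j := let: (z, l) := cayley_table i j in if l == k then pconst z else [::] in
  if (i < j)%N then e i j else if (j < i)%N then pneg (e j i) else [::].

Lemma cayley_twisted : all (fun l => nilp (padd (pscale (-1)%bZ (pphi_cs l))
  (pcircle (psum [seq pmul (cayley_frame (pvar 0) (pvar 1) (nth 0 l 0) a)
    (psum [seq pmul (cayley_frame (pvar 0) (pvar 1) (nth 0 l 1) b)
       (psum [seq pmul (cayley_frame (pvar 0) (pvar 1) (nth 0 l 2) d) (pcayley a b d)
              | d <- iota 0 7]) | b <- iota 0 7]) | a <- iota 0 7]%N)))) (lists 3).
Proof. by vm_compute. Qed.

Section CayleyBasis.
Variables (R : realType) (V : vectType R) (g : {dot V for idfun}).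
Variables (phi : cochain R V 3) (f : nat -> V) (env : nat -> R).
Hypotheses (dimV : \dim {: V} = 7%N) (onf : orthonormal_frame g 7 f).
Hypotheses (lphi : multilinear phi) (rP : represents f env pphi_cal phi).
Hypothesis aphi : forall h : nat -> V, alternating predT 3 (frame_eval h phi).

Local Notation F x y z := (phi [tuple x; y; z]).
Local Notation X := (cross phi f).

Variables x y m : V.
Hypotheses (xx : g x x = 1) (yy : g y y = 1) (mm : g m m = 1).
Hypotheses (xy : g x y = 0) (xm : g x m = 0) (ym : g y m = 0).
Hypothesis Fxym : F x y m = 0.

Let p := X x y.
Let n4 := X p m.
Let n5 := X x m.
Let n6 := X y m.
Let e := nth 0 [:: x; y; p; n6; n5; m; n4].

Let gX a b c : g (X a b) c = F a b c.
Proof. exact: crossE. Qed.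
Let Xsq a b : g a a = 1 -> g a b = 0 -> X a (X a b) = - b.
Proof. exact: (cross_sq dimV onf lphi rP). Qed.
Let Xanti a b c : g a b = 0 -> g a c = 0 -> g b c = 0 -> X a (X b c) = - X b (X a c).
Proof. exact: (cross_anti dimV onf lphi rP). Qed.
Let Xiso a b c : g a a = 1 -> g a b = 0 -> g (X a b) (X a c) = g b c.
Proof. exact: (cross_isometry dimV onf lphi rP). Qed.
Let XC a b : X b a = - X a b.
Proof. exact: (crossC dimV onf lphi aphi). Qed.
Let XN a b : X a (- b) = - X a b.
Proof. exact: (crossNr dimV onf lphi). Qed.
Let gC := metricC g.
Let gNl := metricNl g.
Let gNr := metricNr g.
Let F1 a c : F a a c = 0. Proof. exact: phi_xx. Qed.
Let F2 a c : F a c a = 0. Proof. exact: phi_xyx. Qed.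
Let F3 a c : F c a a = 0. Proof. exact: phi_yxx. Qed.

Let px : g p x = 0. Proof. by rewrite gX F2. Qed.
Let py : g p y = 0. Proof. by rewrite gX F3. Qed.
Let pm : g p m = 0. Proof. by rewrite gX. Qed.
Let pp : g p p = 1. Proof. by rewrite Xiso. Qed.
Let xp : g x p = 0. Proof. by rewrite gC. Qed.
Let yp : g y p = 0. Proof. by rewrite gC. Qed.
Let yx : g y x = 0. Proof. by rewrite gC. Qed.
Let mx : g m x = 0. Proof. by rewrite gC. Qed.
Let my : g m y = 0. Proof. by rewrite gC. Qed.
Let mp : g m p = 0. Proof. by rewrite gC. Qed.
Let n5x : g n5 x = 0. Proof. by rewrite gX F2. Qed.
Let n5m : g n5 m = 0. Proof. by rewrite gX F3. Qed.
Let n5y : g n5 y = 0. Proof. by rewrite gX phi_swap23// Fxym oppr0. Qed.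
Let n5p : g n5 p = 0. Proof. by rewrite Xiso. Qed.
Let n5n5 : g n5 n5 = 1. Proof. by rewrite Xiso. Qed.
Let n6y : g n6 y = 0. Proof. by rewrite gX F2. Qed.
Let n6m : g n6 m = 0. Proof. by rewrite gX F3. Qed.
Let n6x : g n6 x = 0.
Proof. by rewrite gX phi_swap23// phi_swap12// Fxym !oppr0. Qed.
Let n6p : g n6 p = 0. Proof. by rewrite /p (XC y) gNr Xiso// mx oppr0. Qed.
Let n6n6 : g n6 n6 = 1. Proof. by rewrite Xiso. Qed.
Let n5n6 : g n5 n6 = 0.
Proof. by rewrite /n5 /n6 !(XC m) gNl gNr Xiso// xy !oppr0. Qed.
Let n4m : g n4 m = 0. Proof. by rewrite gX F3. Qed.
Let n4p : g n4 p = 0. Proof. by rewrite gX F2. Qed.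
Let n4n4 : g n4 n4 = 1. Proof. by rewrite Xiso. Qed.
Let xXp : X x p = - y. Proof. by rewrite Xsq. Qed.
Let yXp : X y p = x. Proof. by rewrite /p (XC y) XN Xsq// opprK. Qed.
Let n4x : g n4 x = 0.
Proof. by rewrite gX phi_swap23// phi_swap12// -gX xXp gNl ym; rewrite !oppr0. Qed.
Let n4y : g n4 y = 0.
Proof. by rewrite gX phi_swap23// phi_swap12// -gX yXp xm !oppr0. Qed.
Let n4n5 : g n4 n5 = 0.
Proof. by rewrite /n4 /n5 !(XC m) gNl gNr Xiso// px !oppr0. Qed.
Let n4n6 : g n4 n6 = 0.
Proof. by rewrite /n4 /n6 !(XC m) gNl gNr Xiso// py !oppr0. Qed.

(** x, y and m generate the imaginary octonions: up to sign, a product of two of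
their products is determined by [cross_sq], [cross_anti] and [cross_isometry]. *)
Lemma cayley_orthonormal : orthonormal_frame g 7 e.
Proof.
have sym i j : g (e i) (e j) = (i == j)%:R -> g (e j) (e i) = (j == i)%:R.
  by rewrite gC eq_sym.
suff tri i j : (i <= j)%N -> (j < 7)%N -> g (e i) (e j) = (i == j)%:R.
  move=> i j i7 j7; case: (leqP i j) => [ij|/ltnW ji]; first exact: tri.
  by apply: sym; exact: tri.
case: j => [|[|[|[|[|[|[|//]]]]]]]; case: i => [|[|[|[|[|[|[|//]]]]]]] // _ _;
  by [|rewrite gC].
Qed.

Let xn6 : g x n6 = 0. Proof. by rewrite gC. Qed.
Let yn5 : g y n5 = 0. Proof. by rewrite gC. Qed.
Let pn5 : g p n5 = 0. Proof. by rewrite gC. Qed.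
Let xXn5 : X x n5 = - m. Proof. by rewrite Xsq. Qed.
Let yXn6 : X y n6 = - m. Proof. by rewrite Xsq. Qed.
Let pXn4 : X p n4 = - m. Proof. by rewrite Xsq. Qed.
Let mXn5 : X m n5 = x. Proof. by rewrite /n5 (XC m) XN Xsq// opprK. Qed.
Let mXn6 : X m n6 = y. Proof. by rewrite /n6 (XC m) XN Xsq// opprK. Qed.
Let mXn4 : X m n4 = p. Proof. by rewrite /n4 (XC m) XN Xsq// opprK. Qed.
Let xXn6 : X x n6 = - n4.
Proof. by rewrite /n6 (XC m) XN (Xanti xm xy my) opprK -/p (XC p). Qed.
Let yXn5 : X y n5 = n4.
Proof. by rewrite /n5 (Xanti yx ym xm) -/n6 xXn6 opprK. Qed.
Let xXn4 : X x n4 = n6.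
Proof. by rewrite -[n4]opprK -xXn6 XN Xsq// opprK. Qed.
Let yXn4 : X y n4 = - n5. Proof. by rewrite -yXn5 Xsq. Qed.
Let pXn5 : X p n5 = - n6.
Proof. by rewrite /n5 (Xanti px pm xm) -/n4 xXn4. Qed.
Let pXn6 : X p n6 = n5.
Proof. by rewrite -[n6]opprK -pXn5 XN Xsq// opprK. Qed.
Let n4Xn5 : X n4 n5 = - y.
Proof. by rewrite /n5 (Xanti n4x n4m xm) (XC m) mXn4 XN opprK xXp. Qed.
Let n4Xn6 : X n4 n6 = x.
Proof. by rewrite /n6 (Xanti n4y n4m ym) (XC m) mXn4 XN opprK yXp. Qed.
Let n5Xn6 : X n5 n6 = - p.
Proof. by rewrite /n6 (Xanti n5y n5m ym) (XC m) mXn5 XN opprK XC. Qed.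

Lemma cayley_cross i j : (i < j < 7)%N ->
  X (e i) (e j) = zc R (cayley_table i j).1 *: e (cayley_table i j).2.
Proof.
have z1 (v : V) : zc R 1%bZ *: v = v by rewrite scale1r.
have zN1 (v : V) : zc R (-1)%bZ *: v = - v by rewrite scaleN1r.
case/andP=> + j7; case: j j7 => [|[|[|[|[|[|[|//]]]]]]] _;
  case: i => [|[|[|[|[|[|[|//]]]]]]] //= _; rewrite ?z1 ?zN1 //; rewrite XC ?n4Xn5 ?n4Xn6 ?n5Xn6 ?mXn4 ?mXn5 ?mXn6 ?opprK //.
Qed.

Lemma cayley_phi i j k : (i < 7)%N -> (j < 7)%N -> (k < 7)%N ->
  F (e i) (e j) (e k) = ev env (pcayley i j k).
Proof.
have lt a b : (a < b < 7)%N -> (k < 7)%N -> F (e a) (e b) (e k)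
    = ev env (let: (z, l) := cayley_table a b in if l == k then pconst z else [::]).
  move=> ab k7; rewrite -gX cayley_cross// metricZl.
  have l7 : ((cayley_table a b).2 < 7)%N.
    case/andP: ab => + b7; case: b b7 => [|[|[|[|[|[|[|//]]]]]]] _;
      by case: a => [|[|[|[|[|[|[|//]]]]]]].
  rewrite cayley_orthonormal//; case: cayley_table => z l /=.
  by case: eqP => _; rewrite ?ev_const ?mulr1 ?mulr0.
move=> i7 j7 k7; rewrite /pcayley.
case: (ltngtP i j) => [ij|ji|->]; last by rewrite phi_xx.
  by apply: lt; rewrite ?ij.
by rewrite phi_swap12// lt ?ji// ev_scale mulN1r.
Qed.

Variables (c s : R) (env' : nat -> R).
Hypotheses (ec : env' 0%N = c) (es : env' 1%N = s) (cs1 : c ^+ 2 + s ^+ 2 = 1).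

Definition twisted_frame i : V :=
  \sum_(a < 7) ev env' (cayley_frame (pvar 0) (pvar 1) i a) *: e a.

Lemma twisted_frameE : [/\ twisted_frame 0 = x, twisted_frame 1 = y &
  twisted_frame 2 = c *: X x y + s *: m].
Proof.
by split; rewrite /twisted_frame !big_ord_recl big_ord0 /= ?ec ?es /zc /=
  ?scale0r ?scale1r ?mul1r ?mulr1 ?addr0 ?add0r ?scale1r ?scale0r ?add0r ?addr0.
Qed.

(** Both sides are trilinear in the frame, and [cayley_twisted] compares their
expansions in the Cayley basis. *)
Lemma represents_twisted : represents twisted_frame env' pphi_cs phi.
Proof.
move=> l sl l7; have ll : l \in lists 3 by rewrite mem_lists sl eqxx.
have /allP/(_ _ ll)/nilP/(congr1 (ev env')) := cayley_twisted.
rewrite ev_add ev_scale mulN1r ev_circle; last by rewrite ec es.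
move=> /eqP; rewrite addrC subr_eq0 => /eqP <-.
case: l sl l7 {ll} => [|i [|j [|k [|//]]]]// _ /and4P[i7 j7 k7 _].
have -> : frame_eval twisted_frame phi (nth 0%N [:: i; j; k])
    = F (twisted_frame i) (twisted_frame j) (twisted_frame k).
  by congr phi; apply: eq_from_tnth => -[[|[|[|//]]]] ?; rewrite !tnth_mktuple.
rewrite ev_sum big_map -[iota 0 7]/(index_iota 0 7) big_mkord {1}/twisted_frame.
rewrite (scalar_sum _ _ _ _ (scalar_slot1 lphi _ _)); apply: eq_bigr => a _.
rewrite ev_mul; apply: (congr1 (fun t => _ * t)).
rewrite ev_sum big_map big_mkord {1}/twisted_frame.
rewrite (scalar_sum _ _ _ _ (scalar_slot2 lphi _ _)); apply: eq_bigr => b _.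
rewrite ev_mul; apply: (congr1 (fun t => _ * t)).
rewrite ev_sum big_map big_mkord {1}/twisted_frame.
rewrite (scalar_sum _ _ _ _ (scalar_slot3 lphi _ _)); apply: eq_bigr => d _.
rewrite ev_mul; apply: (congr1 (fun t => _ * t)).
rewrite cayley_phi// /pcayley.
have tab a' b' : ev env' (let: (z, l) := cayley_table a' b' in if l == d then pconst z else [::])
    = ev env (let: (z, l) := cayley_table a' b' in if l == d then pconst z else [::]).
  by case: cayley_table => z l'; case: eqP => // _; rewrite !ev_const.
by case: ltnP => _; [|case: ltnP => _ //; rewrite /pneg !ev_scale; congr (_ * _)]; exact: tab.
Qed.
End CayleyBasis.

(** The values of the coframe e^1, ..., e^7 on the frame dual to e^1, e^2, e^7,
- e^6, - e^5, - e^3, e^4, in which the standard form is ptwisted 1 0. *)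
Definition standard_values (i j : nat) : Z :=
  match i, j with
  | 0, 0 | 1, 1 | 6, 2 | 3, 6 => 1%bZ
  | 5, 3 | 4, 4 | 2, 5 => (-1)%bZ
  | _, _ => 0%bZ
  end%N.

Definition pewedge i j k : seq nat -> pol :=
  let o i l := pconst (standard_values i.-1 (nth 0%N l 0)) in
  pshuffle 2 1 (pshuffle 1 1 (o i) (o j)) (o k).

Definition pstandard l : pol :=
  let e i j k := pewedge i j k l in
  padd (padd (padd (padd (padd (padd (e 1 2 7) (e 3 4 7)) (e 5 6 7)) (e 1 3 5))
    (pneg (e 1 4 6))) (pneg (e 2 3 6))) (pneg (e 2 4 5)).

Lemma standard_twisted :
  all (fun l => nilp (padd (pneg (pstandard l)) (pphi_cal l))) (lists 3).
Proof. by vm_compute. Qed.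

Section Standard.
Variables (R : realType) (V : vectType R) (g : {dot V for idfun}).
Hypothesis dimV : \dim {: V} = 7%N.

(** The coframe gives a linear map from V to R^7 that is injective since it spans
the dual, hence onto. *)
Lemma coframe_values (e : 7.-tuple 'Hom(V, R^o)) (t : nat -> R) :
  basis_of fullv e -> exists x, forall i, (i < 7)%N -> e`_i x = t i.
Proof.
move=> be; pose F x := \row_(i < 7) (e`_i x : R).
have lF : linear F.
  by move=> a x y; apply/rowP => i; rewrite !mxE linearP.
pose FL := GRing.isLinear.Build _ _ _ _ F lF.
pose FH : {linear V -> 'rV[R]_7} := HB.pack F FL.
pose f := linfun FH.
have ker0 : lker f == 0%VS.
  apply/lker0P => x y; rewrite !lfunE /= => /rowP Fxy.
  apply: (@metric_inj _ _ g) => z.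
  pose gz : V -> R^o := fun u => g u z.
  have lgz : linear gz by move=> a u v; rewrite /gz metricDl metricZl.
  pose gzL := GRing.isLinear.Build _ _ _ _ gz lgz.
  pose gzH : {linear V -> R^o} := HB.pack gz gzL.
  have -> : g x z = linfun gzH x by rewrite lfunE.
  have -> : g y z = linfun gzH y by rewrite lfunE.
  rewrite (coord_basis be (memvf (linfun gzH))) !sum_lfunE.
  apply: eq_bigr => i _; rewrite !scale_lfunE; congr (_ * _).
  by have := Fxy i; rewrite !mxE.
have fullf : limg f = fullv.
  apply/eqP; rewrite eqEdim subvf limg_dim_eq ?(eqP ker0) ?capv0//.
  by rewrite dimV dimvf /dim /= mul1n.
have : (\row_(i < 7) t i) \in limg f by rewrite fullf memvf.
move=> /memv_imgP[x _ e']; exists x => i i7.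
move/rowP: e' => /(_ (Ordinal i7)); rewrite lfunE !mxE => ->//.
Qed.

Variable phi : cochain R V 3.
Hypothesis G2 : G2_structure phi.

Lemma multilinear_oneform (f : 'Hom(V, R^o)) : multilinear (oneform f).
Proof.
move=> v i a x y; rewrite (ord1 i) /oneform /thead !tnth_tset eqxx.
by rewrite linearP.
Qed.

Lemma multilinear_ewedge e i j k : multilinear (@ewedge R V e i j k).
Proof.
apply: (@multilinear_wedge _ _ 2 1); last exact: multilinear_oneform.
by apply: (@multilinear_wedge _ _ 1 1); exact: multilinear_oneform.
Qed.

Lemma G2_multilinear : multilinear phi.
Proof.
have [e _ phiE] := G2; move=> v i a x y; rewrite !phiE.
by rewrite !multilinear_ewedge; ring.
Qed.

Lemma G2_alternating (h : nat -> V) : alternating predT 3 (frame_eval h phi).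
Proof.
have [e _ phiE] := G2; move=> m k Dm ltk; rewrite /frame_eval !phiE.
have E i j l := @alternating_wedge _ _ predT h 2 1
  (wedge (oneform e`_i.-1) (oneform e`_j.-1)) (oneform e`_l.-1) m k Dm ltk.
by rewrite /ewedge !E; ring.
Qed.

Lemma G2_frame env : exists h : nat -> V, represents h env pphi_cal phi.
Proof.
have [e be phiE] := G2.
have [h he] : exists h : nat -> V, forall i j, (i < 7)%N -> e`_i (h j) = zc R (standard_values i j).
  have H j := coframe_values (fun i => zc R (standard_values i j)) be.
  by exists (fun j => sval (cid (H j))) => i j i7; exact: (svalP (cid (H j))).
exists h => l sl l7; have ll : l \in lists 3 by rewrite mem_lists sl eqxx.
have /allP/(_ _ ll)/nilP/(congr1 (ev env)) := standard_twisted.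
rewrite ev_add ev_scale mulN1r addrC => /eqP; rewrite subr_eq0 => /eqP ->.
have a1 (f : 'Hom(V, R^o)) : alternating (gtn 7) 1 (frame_eval h (oneform f)).
  by move=> m [].
pose o i (l : seq nat) := pconst (standard_values i.-1 (nth 0%N l 0)).
have ro i : (i.-1 < 7)%N -> represents h env (o i) (oneform e`_i.-1).
  move=> i7 s ss s7; rewrite ev_const /frame_eval /oneform /thead tnth_mktuple.
  by rewrite he.
have rE i j k : (i.-1 < 7)%N -> (j.-1 < 7)%N -> (k.-1 < 7)%N ->
    ev env (pewedge i j k l) = ewedge e i j k [tuple h (nth 0%N l r) | r < 3].
  move=> i7 j7 k7.
  have r11 := @represents_wedge _ _ h env 1 1 _ _ _ _ (a1 e`_i.-1) (a1 e`_j.-1) (ro i i7) (ro j j7).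
  have a11 := @alternating_wedge _ _ (gtn 7) h 1 1 (oneform e`_i.-1) (oneform e`_j.-1).
  exact: (@represents_wedge _ _ h env 2 1 _ _ _ _ a11 (a1 e`_k.-1) r11 (ro k k7) l sl l7).
rewrite /frame_eval phiE /pstandard !ev_add !ev_scale !rE//.
by rewrite !mulN1r.
Qed.
End Standard.

(** * Orthonormal systems in subspaces *)
Section UnitVectors.
Variables (R : realType) (V : vectType R) (g : {dot V for idfun}).

Lemma normalize v : v != 0 -> g ((Num.sqrt (g v v))^-1 *: v) ((Num.sqrt (g v v))^-1 *: v) = 1.
Proof.
move=> v0; have gv := metric_gt0 g v0.
rewrite metricZl metricZr mulrA -expr2 exprVn sqr_sqrtr ?ltW// mulVf//.
by rewrite gt_eqF.
Qed.

(** Gram-Schmidt: n vectors do not span U. *)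
Lemma unit_orthogonal (U : {vspace V}) n (h : nat -> V) : orthonormal_frame g n h ->
  (forall i, (i < n)%N -> h i \in U) -> (n < \dim U)%N ->
  exists u, [/\ u \in U, g u u = 1 & forall i, (i < n)%N -> g u (h i) = 0].
Proof.
move=> oh hU ltn; pose s := [seq h i | i <- iota 0 n].
have /subvPn[v vU vs] : ~~ (U <= <<s>>)%VS.
  apply/negP => /dimvS; rewrite leqNgt (leq_ltn_trans (dim_span _))//.
  by rewrite size_map size_iota.
pose w := v - \sum_(i < n) g v (h i) *: h i.
have sU : \sum_(i < n) g v (h i) *: h i \in <<s>>%VS.
  apply: memv_suml => i _; apply/memvZ/memv_span/map_f.
  by rewrite mem_iota ltn_ord.
have w0 : w != 0 by apply: contraNneq vs => /eqP; rewrite subr_eq0 => /eqP ->.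
have wh i : (i < n)%N -> g w (h i) = 0.
  move=> ltin; rewrite metricBl metric_suml (bigD1 (Ordinal ltin))//=.
  rewrite metricZl oh// eqxx mulr1 big1 ?addr0 ?subrr// => j ji.
  by rewrite metricZl oh// (negbTE (ji : (j != i :> nat))) mulr0.
exists ((Num.sqrt (g w w))^-1 *: w); split; last first.
- by move=> i ltin; rewrite metricZl wh ?mulr0.
- exact: normalize.
- rewrite memvZ// memvB// memv_suml// => i _; exact/memvZ/hU.
Qed.

Lemma orthonormal_seq (s : seq V) (U : {vspace V}) :
  orthonormal g s -> {subset s <= U} -> size s = \dim U -> basis_of U s.
Proof.
move=> os sU sz.
have /orthonormal_tupleP oh : orthonormal g (in_tuple s) by [].
have frs : free s.
  apply/(freeP (X := in_tuple s)) => k k0 i.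
  have := congr1 (fun x => g x (nth 0 (in_tuple s) i)) k0; rewrite metric0l metric_suml.
  rewrite (bigD1 i)//= big1 => [|j ji]; last first.
    rewrite metricZl. by rewrite oh// val_eqE (negbTE ji) mulr0.
  by rewrite metricZl oh// eqxx mulr1 addr0.
rewrite basisEfree frs -sz leqnn andbT; exact/span_subvP.
Qed.
End UnitVectors.

Section OrthonormalSystems.
Variables (R : realType) (V : vectType R) (g : {dot V for idfun}).

Lemma orthonormal_in (U : {vspace V}) n : (n <= \dim U)%N ->
  exists2 h, orthonormal_frame g n h & forall i, (i < n)%N -> h i \in U.
Proof.
elim: n => [|n IH] ltn; first by exists (fun=> 0).
have [h oh hU] := IH (ltnW ltn).
have [u [uU uu uh]] := unit_orthogonal oh hU ltn.
exists (fun i => if i == n then u else h i) => [i j|i]; rewrite !ltnS; last first.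
  by case: eqP => // /eqP ni le_in; rewrite hU// ltn_neqAle ni.
rewrite (leq_eqVlt i) (leq_eqVlt j); case: (eqVneq i n) => [->|ni] /=; case: (eqVneq j n) => [->|nj] //= i_n j_n.
- by rewrite uh.
- by rewrite metricC uh// (negbTE ni).
- exact: oh.
Qed.

Lemma orthogonal_span (U : {vspace V}) (s : seq V) z : basis_of U s ->
  (forall v, v \in s -> g v z = 0) -> forall u, u \in U -> g u z = 0.
Proof.
move=> bs sz u uU; rewrite (coord_basis (X := in_tuple s) bs uU) metric_suml big1// => i _.
by rewrite metricZl sz ?mulr0// mem_nth.
Qed.
End OrthonormalSystems.

(** * The scalar equations *)
Section ScalarEquations.
Variable R : realFieldType.

(** For L <> 1 the last two equations eliminate H; together with the first one they
give two linear equations in s and q, which imply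
(L - 1) (L + 1) (3 L^2 - 4 L + 5) q = 0. The quadratic factor is positive; for
L = -1 the signs of s and H conclude. *)
Lemma calibrated_scalars (L s q H : R) : 0 <= s -> 0 <= H ->
  4 * L ^+ 2 * s + (5 * L ^+ 2 - 6 * L - 3) * q = 0 ->
  (9 - 14 * L - 3 * L ^+ 2) * s + (20 * L - 6 - 6 * L ^+ 2) * q
    + 9 * (L - 1) ^+ 2 * H = 0 ->
  (1 - L) * ((3 + 11 * L) * s + (10 * L - 6) * q + 3 * (1 + L) * H) = 0 ->
  (L = 1 /\ s = q) \/ (s = 0 /\ H = 0).
Proof.
move=> s0 H0 e1 e2 /eqP; rewrite mulf_eq0 subr_eq0 => /orP[/eqP L1|/eqP e3].
  by left; split=> //; move: e2; rewrite -L1; lra.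
right.
have e4 : L * (10 * L - 5 - 9 * L ^+ 2) * s
    + (3 - 13 * L + 23 * L ^+ 2 - 9 * L ^+ 3) * q = 0.
  suff : 4 * (L * (10 * L - 5 - 9 * L ^+ 2) * s
    + (3 - 13 * L + 23 * L ^+ 2 - 9 * L ^+ 3) * q) = 0 by lra.
  transitivity ((1 + L) * ((9 - 14 * L - 3 * L ^+ 2) * s + (20 * L - 6 - 6 * L ^+ 2) * q
    + 9 * (L - 1) ^+ 2 * H) - 3 * (1 - L) ^+ 2 * ((3 + 11 * L) * s + (10 * L - 6) * q + 3 * (1 + L) * H)).
    by ring.
  by rewrite e2 e3; ring.
have e5 : (L - 1) * (L + 1) * (3 * L ^+ 2 - 4 * L + 5) * q = 0.
  suff : 3 * ((L - 1) * (L + 1) * (3 * L ^+ 2 - 4 * L + 5) * q) = 0 by lra.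
  transitivity (4 * L * (L * (10 * L - 5 - 9 * L ^+ 2) * s
    + (3 - 13 * L + 23 * L ^+ 2 - 9 * L ^+ 3) * q)
    - (10 * L - 5 - 9 * L ^+ 2) * (4 * L ^+ 2 * s + (5 * L ^+ 2 - 6 * L - 3) * q)).
    by ring.
  by rewrite e1 e4; ring.
have quad : 0 < 3 * L ^+ 2 - 4 * L + 5 by have := sqr_ge0 (3 * L - 2); nra.
move: e5 => /eqP; rewrite !mulf_eq0 (gt_eqF quad) orbF.
case/orP => [/orP[|]|/eqP q0].
- by rewrite subr_eq0 => /eqP L1; move: e1 e3; rewrite L1; lra.
- by rewrite addr_eq0 => /eqP L1; move: e1 e2; rewrite L1; lra.
move: e1 e2 e3; rewrite q0 !mulr0 !addr0 => /eqP.
rewrite mulf_eq0 mulf_eq0 pnatr_eq0 expf_eq0 /= => /orP[/eqP->|/eqP->];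
  first by lra.
move=> e2 e3; split=> //.
have : (L - 1) ^+ 2 * H = 0 by lra.
move=> /eqP; rewrite mulf_eq0 expf_eq0 subr_eq0 /= => /orP[/eqP L1|/eqP//].
by move: e3; rewrite L1; lra.
Qed.

(** If s <> 0 then L is 1 or -1, and the difference of the last two equations
gives q = 0 or q = - 2 s, respectively; then s = 0 by the second equation or by
the sign of s + 2 q. *)
Lemma noncalibrated_scalars (L s q x : R) : 0 <= s -> 0 <= s + 2 * q ->
  (1 - L ^+ 2) * s = 0 ->
  12 * x * L * q + 5 * L ^+ 2 * (s + 2 * q) - 6 * L * (s + q) - 3 * s = 0 ->
  12 * x * L * q - L ^+ 2 * (s + 2 * q) + 6 * L * (s - q) - 9 * s = 0 -> s = 0.
Proof.
move=> s0 t0 /eqP; rewrite mulf_eq0 => /orP[|/eqP//].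
rewrite subr_eq0 eq_sym sqrf_eq1 => /orP[]/eqP-> e2 e3; last by lra.
have q0 : q = 0 by lra.
by move: e3; rewrite q0; lra.
Qed.
End ScalarEquations.

(** * Coclosed forms *)
Definition pairs_from lo : seq (nat * nat) :=
  [seq p <- [seq (i, j) | i <- iota 0 7, j <- iota 0 7] | (lo <= p.1 < p.2)%N].

(** Independent variables for the components of a bracket whose derived algebra
lies in the span of the first lo frame vectors, which are central. *)
Definition pbr_free lo x i j : pol :=
  let ps := pairs_from lo in
  if ((i, j) \in ps) && (x < lo)%N then
    pvar (2 + size ps * x + index (i, j) ps)
  else [::].

Ltac normalize_pol :=
  match goal with |- ev ?e ?p = _ -> _ =>
    let v := eval vm_compute in p in
    have -> : p = v by vm_compute
  end.

Ltac normalize_lhs :=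
  match goal with |- ev ?e ?p = _ =>
    let v := eval vm_compute in p in
    have -> : p = v by vm_compute
  end.

Lemma zc1 (R : comPzRingType) : zc R 1%bZ = 1.
Proof. by []. Qed.
Lemma zcN1 (R : comPzRingType) : zc R (-1)%bZ = -1.
Proof. by []. Qed.

Ltac monomial_eq0 :=
  normalize_pol; rewrite /= ?zc1 ?zcN1 ?mulr1 ?mul1r ?mulN1r ?addr0 => /eqP;
  rewrite ?oppr_eq0 => /eqP ?.

Lemma alternating_psi_cs : alternatingb 4 (ppsi pphi_cs).
Proof. by vm_compute. Qed.
Lemma alternating_psi_cal : alternatingb 4 (ppsi pphi_cal).
Proof. by vm_compute. Qed.
Lemma alternating_phi_cal : alternatingb 3 pphi_cal.
Proof. by vm_compute. Qed.

Section Bracket.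
Variables (R : realType) (V : vectType R) (br : {bilinear V -> V -> V}).
Variables (phi : cochain R V 3) (g : {dot V for idfun}) (vol : cochain R V 7).
Variables (h : nat -> V).
Hypothesis br_alt : forall x, br x x = 0.
Hypotheses (dimV : \dim {: V} = 7%N) (oh : orthonormal_frame g 7 h).

Lemma bracket_subspace (U : {vspace V}) :
  (forall i j, (i < 7)%N -> (j < 7)%N -> br (h i) (h j) \in U) ->
  forall x y, br x y \in U.
Proof.
move=> brU x y; rewrite (frame_expand dimV oh x) (frame_expand dimV oh y).
rewrite linear_sumr; apply: memv_suml => j _.
rewrite linear_sumlz; apply: memv_suml => i _.
by rewrite linearZl_LR linearZr_LR !memvZ// brU.
Qed.

Definition structure_constant i j x : R := g (br (h i) (h j)) (h x).
Local Notation C3 := structure_constant.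

Lemma structure_anti i j x : C3 j i x = - C3 i j x.
Proof. by rewrite /C3 (br_anti br_alt) metricNl. Qed.

Lemma represents_pbracket env B :
  (forall x i j, (x < 3)%N -> (i < j < 7)%N -> ev env (B x i j) = C3 i j x) ->
  (forall x i j, (3 <= x < 7)%N -> C3 i j x = 0) ->
  represents_bracket g br h env (pbracket B).
Proof.
move=> Blt Bge i j x i7 j7 x7; rewrite -/(C3 i j x) /pbracket.
case: ltnP => x3; last by rewrite Bge ?x3.
case: (ltngtP i j) => [ij|ji|->]; first by rewrite Blt// ij.
  by rewrite ev_scale Blt ?ji// mulN1r structure_anti opprK.
by rewrite /C3 br_alt metric0l.
Qed.

Definition free_env lo (c s : R) : nat -> R :=
  nth 0 (c :: s :: [seq C3 p.1 p.2 x | x <- iota 0 lo, p <- pairs_from lo]).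

Lemma represents_free lo c s : lo = 2%N \/ lo = 3%N ->
  (forall i y, (i < lo)%N -> br (h i) y = 0) ->
  (forall x y k, (lo <= k < 7)%N -> g (br x y) (h k) = 0) ->
  represents_bracket g br h (free_env lo c s) (pbracket (pbr_free lo)).
Proof.
move=> lo23 cen der.
apply: represents_pbracket => [x i j x3 /andP[ij j7]|x i j /andP[x3 x7]]; last first.
  by apply: der; rewrite x7 andbT; apply: leq_trans x3; case: lo23 => ->.
have [xlo|lox] := ltnP x lo; last first.
  by rewrite /pbr_free ltnNge lox andbF /C3 der// lox (leq_trans x3).
have [ilo|loi] := ltnP i lo.
  rewrite /pbr_free /C3 cen// metric0l ifF// mem_filter /= leqNgt ilo //.
case: lo23 cen der xlo loi => -> cen der xlo loi;
  case: x xlo {x3} => [|[|[|//]]] // _;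
  case: i loi ij => [|[|[|[|[|[|[|i]]]]]]] //= _;
  case: j j7 => [|[|[|[|[|[|[|//]]]]]]] //= _ _;
  by rewrite mulr1 mul1r addr0.
Qed.

Hypotheses (kvol : kform vol) (vol1 : vol [tuple h i | i < 7] = 1).
Hypotheses (lphi : multilinear phi).
Hypothesis cocl : coclosed br phi g vol.

Lemma coclosed_eq env P B l : represents h env P phi -> alternatingb 3 P ->
  represents_bracket g br h env (pbracket B) -> size l = 5 -> all (gtn 7) l ->
  ev env (pced (pbracket B) 3 (ppsi P) l) = 0.
Proof.
move=> rP aP rB sl l7.
by rewrite (represents_dpsi dimV oh kvol vol1 lphi rP aP rB sl l7) /frame_eval cocl.
Qed.

(** Each of the eight components of d psi used here is, up to sign, a single
component of a bracket with z3. *)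
Lemma coclosed_dim2 (env : nat -> R) : represents h env pphi_cal phi ->
  (forall i y, (i < 2)%N -> br (h i) y = 0) ->
  (forall x y k, (2 <= k < 7)%N -> g (br x y) (h k) = 0) ->
  forall y, br (h 2) y = 0.
Proof.
move=> rP cen der y.
pose env' := free_env 2 1 0.
have rP' : represents h env' pphi_cal phi.
  by move=> l sl l7; rewrite -rP//; apply: twisted_ext; rewrite ?ev_const.
have rB : represents_bracket g br h env' (pbracket (pbr_free 2)).
  by apply: represents_free => //; left.
have E l : size l = 5 -> all (gtn 7) l ->
    ev env' (pced (pbracket (pbr_free 2)) 3 (ppsi pphi_cal) l) = 0.
  by apply: coclosed_eq => //; exact: alternating_phi_cal.
have C2 j x : (2 < j < 7)%N -> (x < 2)%N -> C3 2 j x = 0.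
  have := E [:: 1; 2; 3; 5; 6]%N erefl isT; monomial_eq0.
  have := E [:: 1; 2; 4; 5; 6]%N erefl isT; monomial_eq0.
  have := E [:: 1; 2; 3; 4; 5]%N erefl isT; monomial_eq0.
  have := E [:: 1; 2; 3; 4; 6]%N erefl isT; monomial_eq0.
  have := E [:: 0; 2; 3; 5; 6]%N erefl isT; monomial_eq0.
  have := E [:: 0; 2; 4; 5; 6]%N erefl isT; monomial_eq0.
  have := E [:: 0; 2; 3; 4; 5]%N erefl isT; monomial_eq0.
  have := E [:: 0; 2; 3; 4; 6]%N erefl isT; monomial_eq0.
  move=> j7; case: x => [|[|//]] _; case: j j7 => [|[|[|[|[|[|[|//]]]]]]] //= _; assumption.
apply: (frame_inj dimV oh) => x x7; rewrite metric0l.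
apply: (frame_eq0 dimV oh (f := fun y => g (br (h 2) y) (h x))) => [c t t'|j j7].
  by rewrite linearDr linearZr_LR metricDl metricZl.
have [x2|x2] := ltnP x 2; last by rewrite der ?x2.
have [j2|j2] := ltnP j 2; first by rewrite (br_anti br_alt) cen// oppr0 metric0l.
have [->|jn2] := eqVneq j 2; first by rewrite br_alt metric0l.
by apply: C2; rewrite // ltn_neqAle eq_sym jn2 j2.
Qed.

(** The components of d psi with one index among z1, z2, z3 give the three linear
relations, those with two such indices are single structure constants times s. *)
Lemma coclosed_dim3 c s : c ^+ 2 + s ^+ 2 = 1 ->
  represents h (free_env 3 c s) pphi_cs phi ->
  (forall i y, (i < 3)%N -> br (h i) y = 0) ->
  (forall x y k, (3 <= k < 7)%N -> g (br x y) (h k) = 0) ->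
  [/\ [/\ c * C3 3 4 0 - C3 3 6 2 - c * C3 4 5 2 + C3 5 6 0 = 0,
          c * C3 3 5 0 + C3 3 6 1 + c * C3 4 5 1 - C3 4 6 0 = 0 &
          C3 4 6 2 - c * C3 3 4 1 - c * C3 3 5 2 - C3 5 6 1 = 0] &
      forall x i j, (x < 3)%N -> (3 <= i < j)%N -> (j < 6)%N -> s * C3 i j x = 0].
Proof.
move=> cs1 rP cen der.
have rB : represents_bracket g br h (free_env 3 c s) (pbracket (pbr_free 3)).
  by apply: represents_free => //; right.
have E l : size l = 5 -> all (gtn 7) l ->
    ev (free_env 3 c s) (pced (pbracket (pbr_free 3)) 3 (ppsi pphi_cs) l) = 0.
  by apply: coclosed_eq => //; exact: alternating_phi_cs.
split; [split|].
- have := E [:: 1; 3; 4; 5; 6]%N erefl isT; normalize_pol.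
  by rewrite /free_env /= ?zc1 ?zcN1 => <-; ring.
- have := E [:: 2; 3; 4; 5; 6]%N erefl isT; normalize_pol.
  by rewrite /free_env /= ?zc1 ?zcN1 => <-; ring.
- have := E [:: 0; 3; 4; 5; 6]%N erefl isT; normalize_pol.
  by rewrite /free_env /= ?zc1 ?zcN1 => <-; ring.
have := E [:: 1; 2; 3; 4; 6]%N erefl isT; monomial_eq0.
have := E [:: 1; 2; 3; 5; 6]%N erefl isT; monomial_eq0.
have := E [:: 1; 2; 4; 5; 6]%N erefl isT; monomial_eq0.
have := E [:: 0; 2; 3; 4; 6]%N erefl isT; monomial_eq0.
have := E [:: 0; 2; 3; 5; 6]%N erefl isT; monomial_eq0.
have := E [:: 0; 2; 4; 5; 6]%N erefl isT; monomial_eq0.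
have := E [:: 0; 1; 3; 4; 6]%N erefl isT; monomial_eq0.
have := E [:: 0; 1; 3; 5; 6]%N erefl isT; monomial_eq0.
have := E [:: 0; 1; 4; 5; 6]%N erefl isT; monomial_eq0.
move=> x i j; case: x => [|[|[|//]]] _; case: i => [|[|[|[|[|[|i]]]]]] //=;
  case: j => [|[|[|[|[|[|j]]]]]] //= _ _; assumption.
Qed.
End Bracket.

(** * Derived algebra of dimension three, not calibrated *)
Definition conn_noncal : seq (seq (seq pol)) := Eval vm_compute in
  tab3 (pconn pphi_cs (pbracket pbr_noncal) (pvar 2) (ptau pphi_cs (pbracket pbr_noncal))).
Lemma conn_noncalE : conn_noncal = tab3 (pconn pphi_cs (pbracket pbr_noncal) (pvar 2) (ptau pphi_cs (pbracket pbr_noncal))).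
Proof. by vm_compute. Qed.
Definition inst_noncal := pinst pphi_cs (pbracket pbr_noncal) (get3 conn_noncal).

Lemma alternating_dphi_noncal : alternatingb 4 (pdphi pphi_cs (pbracket pbr_noncal)).
Proof. by vm_compute. Qed.

Definition psquare (f : nat -> nat -> pol) : pol :=
  psum [seq pmul (f i j) (f i j) | i <- iota 0 3, j <- iota 0 3].
(** For the symmetric matrix S, the sum of the principal 2 x 2 minors. *)
Definition pminors : pol :=
  psum [seq padd (pmul (psym p.1 p.1) (psym p.2 p.2)) (pneg (pmul (psym p.1 p.2) (psym p.1 p.2)))
       | p <- [:: (0, 1); (0, 2); (1, 2)]%N].

Definition plinear (s : seq (int * seq pol)) : pol :=
  psum [seq pscale (Z_of_int t.1) (foldr pmul (pconst 1) t.2) | t <- s].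

Section Symmetric.
Variables (R : realType) (env : nat -> R).

Lemma ev_plinear s : ev env (plinear s) = \sum_(t <- s) t.1%:~R * \prod_(p <- t.2) ev env p.
Proof.
rewrite ev_sum big_map; apply: eq_bigr => -[z ps] _ /=.
rewrite ev_scale /zc Z_of_intK; congr (_ * _).
by elim: ps => [|p ps IH]; rewrite ?big_nil ?ev_const// big_cons ev_mul IH.
Qed.

Lemma ev_psquare f : ev env (psquare f) = \sum_(i < 3) \sum_(j < 3) ev env (f i j) ^+ 2.
Proof.
rewrite ev_sum big_allpairs_dep -[iota 0 3]/(index_iota 0 3) big_mkord.
by apply: eq_bigr => i _; rewrite big_mkord; apply: eq_bigr => j _; rewrite ev_mul.
Qed.

Lemma psquare_ge0 f : 0 <= ev env (psquare f).
Proof. by rewrite ev_psquare !sumr_ge0// => i _; rewrite sumr_ge0// => j _; rewrite sqr_ge0. Qed.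

Lemma psquare_eq0 f i j : ev env (psquare f) = 0 -> (i < 3)%N -> (j < 3)%N -> ev env (f i j) = 0.
Proof.
rewrite ev_psquare => /eqP; rewrite psumr_eq0 => [/allP a0 i3 j3|k _]; last first.
  by rewrite sumr_ge0// => l _; rewrite sqr_ge0.
have := a0 (Ordinal i3) (mem_index_enum _).
rewrite psumr_eq0 => [/allP b0|k _]; last by rewrite sqr_ge0.
by have := b0 (Ordinal j3) (mem_index_enum _); rewrite sqrf_eq0 => /eqP.
Qed.

Lemma psquare_trace :
  ev env (psquare psym) + 2 * ev env pminors = ev env (psum [seq psym i i | i <- iota 0 3]) ^+ 2.
Proof.
rewrite expr2 -ev_mul; set t := pmul _ _.
have -> : t = padd (psquare psym) (pscale 2 pminors) by vm_compute.
by rewrite ev_add ev_scale.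
Qed.

Lemma ev_signed_sum (w : seq nat) (f : nat -> pol) (e : nat -> nat) :
  (forall i, i \in w -> ev env (f i) = 0) ->
  ev env (psum [seq psgn (e i) (f i) | i <- w]) = 0.
Proof.
by move=> f0; rewrite ev_sum big_map big_seq big1// => i iw; rewrite ev_sgn f0// mulr0.
Qed.
End Symmetric.

(** Simultaneous rotations of the z_i and of the w_i preserve the form. Traces over
i of instanton equations are therefore invariants of S: combinations of its
squared norm and of q, since they are quadratic. *)
Section NormalForms.
Let L := pvar 2.
Let x := pmul (pvar 1) (pvar 1).
Let s2 := psquare psym.
Let q := pminors.

Lemma trace_noncal1 :
  pcircle (psum [seq psgn 0 (inst_noncal 6 i (3 + i)%N) | i <- iota 0 3]) =
  plinear [:: (36, [:: s2]); (-36, [:: L; L; s2])].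
Proof. by vm_compute. Qed.

Lemma trace_noncal2 :
  pcircle (psum [seq psgn i.+1 (inst_noncal (3 + i)%N i 6) | i <- iota 0 3]) =
  plinear [:: (144, [:: x; L; q]); (60, [:: L; L; s2]); (120, [:: L; L; q]);
              (-72, [:: L; s2]); (-72, [:: L; q]); (-36, [:: s2])].
Proof. by vm_compute. Qed.

Lemma trace_noncal3 :
  pcircle (psum [seq psgn i (inst_noncal i (3 + i)%N 6) | i <- iota 0 3]) =
  plinear [:: (144, [:: x; L; q]); (-12, [:: L; L; s2]); (-24, [:: L; L; q]);
              (72, [:: L; s2]); (-72, [:: L; q]); (-108, [:: s2])].
Proof. by vm_compute. Qed.
End NormalForms.

Section NonCalibrated.
Variables (R : realType) (V : vectType R) (br : {bilinear V -> V -> V}).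
Variables (phi : cochain R V 3) (g : {dot V for idfun}) (vol : cochain R V 7).
Variables (lambda : R) (nabla : V -> V -> V) (h : nat -> V) (c s : R).
Hypothesis br_alt : forall x, br x x = 0.
Hypotheses (dimV : \dim {: V} = 7%N) (oh : orthonormal_frame g 7 h).
Hypotheses (kvol : kform vol) (vol1 : vol [tuple h i | i < 7] = 1).
Hypotheses (lphi : multilinear phi) (cocl : coclosed br phi g vol).
Hypothesis conn : G2_connection br phi g vol lambda nabla.
Hypothesis inst : G2_instanton br phi g vol nabla.
Hypothesis cs1 : c ^+ 2 + s ^+ 2 = 1.
Hypothesis rP : represents h (nth 0 [:: c; s]) pphi_cs phi.
Hypothesis cen : forall i y, (i < 3)%N -> br (h i) y = 0.
Hypothesis der : forall x y k, (3 <= k < 7)%N -> g (br x y) (h k) = 0.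

Local Notation C3 := (structure_constant br g h).

Lemma represents_cs env : env 0%N = c -> env 1%N = s -> represents h env pphi_cs phi.
Proof.
move=> e0 e1 l sl l7; rewrite -(rP sl l7).
by apply: twisted_ext; rewrite !ev_var.
Qed.

(** Coclosedness leaves the brackets of the w_i with t, given by a symmetric matrix
S; the three traces give S = 0 by [noncalibrated_scalars]. *)
Lemma noncalibrated_no_instanton : s != 0 -> forall i j, (i < 7)%N -> (j < 7)%N -> br (h i) (h j) = 0.
Proof.
move=> s0.
have [[S1 S2 S3] T] := coclosed_dim3 br_alt dimV oh kvol vol1 lphi cocl cs1
  (represents_cs (env := free_env br g h 3 c s) erefl erefl) cen der.
have T0 x i j : (x < 3)%N -> (3 <= i < j)%N -> (j < 6)%N -> C3 i j x = 0.
  move=> x3 ij j6; have /eqP := T x i j x3 ij j6.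
  by rewrite mulf_eq0 (negbTE s0) => /eqP.
rewrite (T0 0%N 3 4)// (T0 2%N 4 5)// mulr0 in S1.
rewrite (T0 0%N 3 5)// (T0 1%N 4 5)// mulr0 in S2.
rewrite (T0 1%N 3 4)// (T0 2%N 3 5)// mulr0 in S3.
pose env := nth 0 [:: c; s; lambda; C3 3 6 0; C3 3 6 1; C3 3 6 2; C3 4 6 1; C3 4 6 2; C3 5 6 2].
have rP' : represents h env pphi_cs phi by exact: represents_cs.
have rB : represents_bracket g br h env (pbracket pbr_noncal).
  apply: represents_pbracket => // [x i j x3 /andP[ij j7]|x i j]; last exact: der.
  have [i3|i3] := ltnP i 3.
    rewrite /structure_constant cen// metric0l.
    by case: i i3 ij => [|[|[|//]]].
  have [j6|j6] := ltnP j 6.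
    rewrite T0// ?i3//; case: i i3 ij => [|[|[|[|[|i]]]]] //= _;
      by case: j j6 {j7} => [|[|[|[|[|[|j]]]]]].
  have j_6 : j = 6%N by lia.
  rewrite {}j_6 in ij *; case: i i3 ij => [|[|[|[|[|[|//]]]]]] // _ _;
    case: x x3 => [|[|[|//]]] _; normalize_lhs; rewrite /env /= ?zc1; lra.
have [e0 e1 e2] : [/\ env 0%N = c, env 1%N = s & env 2%N = lambda] by [].
clearbody env.
have aP := represents_alternating alternating_phi_cs rP'.
have evD i j k : (i < 7)%N -> (j < 7)%N -> (k < 7)%N ->
    ev env (get3 conn_noncal i j k) = 12 * g (nabla (h i) (h j)) (h k).
  move=> i7 j7 k7; rewrite conn_noncalE get3E//.
  apply: (ev_conn dimV oh kvol vol1 lphi rP' alternating_phi_cs rB alternating_dphi_noncal _ conn i7 j7 k7).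
  by rewrite ev_var e2.
have I a u v : (a < 7)%N -> (u < 7)%N -> (v < 7)%N -> ev env (inst_noncal a u v) = 0.
  move=> a7 u7 v7; rewrite /inst_noncal.
  have E := @ev_inst _ _ br phi g vol lambda nabla h env pphi_cs (pbracket pbr_noncal)
    dimV oh kvol vol1 lphi rP' alternating_phi_cs rB alternating_psi_cs conn (get3 conn_noncal) evD br_alt.
  exact: E.
have C1 : env 0%N ^+ 2 + env 1%N ^+ 2 = 1 by rewrite e0 e1.
have iota3 i : i \in iota 0 3 -> (i < 7)%N /\ (3 + i < 7)%N by rewrite mem_iota; lia.
have F1 := @ev_signed_sum _ env (iota 0 3) (fun i => inst_noncal 6 i (3 + i)%N) (fun=> 0%N).
have F2 := @ev_signed_sum _ env (iota 0 3) (fun i => inst_noncal (3 + i)%N i 6) S.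
have F3 := @ev_signed_sum _ env (iota 0 3) (fun i => inst_noncal i (3 + i)%N 6) id.
rewrite -(ev_circle _ C1) trace_noncal1 ev_plinear in F1.
rewrite -(ev_circle _ C1) trace_noncal2 ev_plinear in F2.
rewrite -(ev_circle _ C1) trace_noncal3 ev_plinear in F3.
have {}F1 := F1 (fun i i3 => I 6%N i (3 + i)%N isT (iota3 i i3).1 (iota3 i i3).2).
have {}F2 := F2 (fun i i3 => I (3 + i)%N i 6%N (iota3 i i3).2 (iota3 i i3).1 isT).
have {}F3 := F3 (fun i i3 => I i (3 + i)%N 6%N (iota3 i i3).1 (iota3 i i3).2 isT).
have := @psquare_eq0 _ env psym; have := psquare_trace env; have := psquare_ge0 env psym.
rewrite !(big_cons, big_nil) ev_mul !ev_var ?e1 ?e2 in F1 F2 F3.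
move: (ev env (psum _)) (ev env (psquare psym)) (ev env pminors) F1 F2 F3 => t s2 q /= F1 F2 F3.
move=> s2ge0 tE s2_eq0.
have {s2_eq0} b0 : forall i j, (i < 3)%N -> (j < 3)%N -> ev env (psym i j) = 0.
  move=> i j; apply: s2_eq0.
  apply: (noncalibrated_scalars (L := lambda) (q := q) (x := s ^+ 2)) => //.
  - by rewrite tE sqr_ge0.
  - lra.
  - lra.
  - lra.
suff C0 i j x : (x < 3)%N -> (i < j < 7)%N -> C3 i j x = 0.
  move=> i j i7 j7; apply: (frame_inj dimV oh) => x x7; rewrite metric0l.
  have [x3|x3] := ltnP x 3; last by rewrite der ?x3.
  case: (ltngtP i j) => [ij|ji|->]; last by rewrite br_alt metric0l.
    by apply: C0; rewrite ?ij.
  by rewrite (br_anti br_alt) metricNl; apply/eqP; rewrite oppr_eq0; apply/eqP/C0; rewrite ?ji.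
move=> x3 /andP[ij j7]; rewrite /structure_constant -(rB i j x) ?(ltn_trans ij)// ?(ltn_trans x3)//.
rewrite /pbracket x3 ij; case: i ij => [|[|[|[|[|[|i]]]]]] ij //=;
  case: j ij j7 => [|[|[|[|[|[|[|j]]]]]]] // _ _; exact: b0.
Qed.
End NonCalibrated.

(** * Calibrated derived algebra *)
Definition conn_cal : seq (seq (seq pol)) := Eval vm_compute in
  tab3 (pconn pphi_cal (pbracket (pbr_cal psym)) (pvar 2) (ptau pphi_cal (pbracket (pbr_cal psym)))).
Lemma conn_calE : conn_cal =
  tab3 (pconn pphi_cal (pbracket (pbr_cal psym)) (pvar 2) (ptau pphi_cal (pbracket (pbr_cal psym)))).
Proof. by vm_compute. Qed.
Definition inst_cal := pinst pphi_cal (pbracket (pbr_cal psym)) (get3 conn_cal).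

Definition conn_one : seq (seq (seq pol)) := Eval vm_compute in
  tab3 (pconn pphi_cal (pbracket (pbr_cal psym)) (pconst 1) (ptau pphi_cal (pbracket (pbr_cal psym)))).
Lemma conn_oneE : conn_one =
  tab3 (pconn pphi_cal (pbracket (pbr_cal psym)) (pconst 1) (ptau pphi_cal (pbracket (pbr_cal psym)))).
Proof. by vm_compute. Qed.

Lemma alternating_dphi_cal : alternatingb 4 (pdphi pphi_cal (pbracket (pbr_cal psym))).
Proof. by vm_compute. Qed.

(** At lambda = 1, with S and eta arbitrary. *)
Lemma covd_one : all (fun x => all (fun i => all (fun j => all (fun k =>
  nilp (pcovd pphi_cal (get3 conn_one) x i j k)) (iota 0 7)) (iota 0 7)) (iota 0 7)) (iota 0 7).
Proof. by vm_compute. Qed.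

Lemma phi_dphi_cal : pshuffle 3 4 pphi_cal (pdphi pphi_cal (pbracket (pbr_cal psym))) (iota 0 7) =
  pscale 4 (psum [seq psym i i | i <- iota 0 3]).
Proof. by vm_compute. Qed.

Definition pbr_skew := pbr_cal (fun _ _ => [::]).
Definition conn_skew : seq (seq (seq pol)) := Eval vm_compute in
  tab3 (pconn pphi_cal (pbracket pbr_skew) (pconst 1) (ptau pphi_cal (pbracket pbr_skew))).
Lemma conn_skewE : conn_skew = tab3 (pconn pphi_cal (pbracket pbr_skew) (pconst 1) (ptau pphi_cal (pbracket pbr_skew))).
Proof. by vm_compute. Qed.
Lemma alternating_dphi_skew : alternatingb 4 (pdphi pphi_cal (pbracket pbr_skew)).
Proof. by vm_compute. Qed.

Definition pminor x y i j : pol :=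
  padd (pmul (pgen x i) (pgen y j)) (pneg (pmul (pgen x j) (pgen y i))).

Definition two_of_three := [:: (1, 2); (0, 2); (0, 1)]%N.

(** At lambda = 1 and S = 0 these nine instanton equations are the 2 x 2 minors of
eta. *)
Lemma inst_skew : all (fun a => all (fun k =>
    let: (x, y) := nth (0, 0)%N two_of_three a in
    let: (i, j) := nth (0, 0)%N two_of_three k in
    pinst pphi_cal (pbracket pbr_skew) (get3 conn_skew) a 3 (6 - k) ==
    pscale (if k == 0%N then (-288)%bZ else 288%bZ) (pminor x y i j)) (iota 0 3)) (iota 0 3).
Proof. by vm_compute. Qed.

(** Contraction of phi with the Hodge dual of R /\ psi, restricted to the index
lists ts; the dual is the source of the sign (-1)^a. Splitting the contraction
according to which of the indices a, u, v belong to z1, z2, z3 keeps it invariant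
under the symmetries of phi that preserve their span. *)
Definition ptrace (I : nat -> nat -> nat -> pol) (ts : seq (seq nat)) : pol :=
  psum [seq psgn (nth 0%N t 0) (pmul (pphi_cal t) (I (nth 0%N t 0) (nth 0%N t 1) (nth 0%N t 2))) | t <- ts].

Definition Tzzz := [:: [:: 0; 1; 2]; [:: 1; 2; 0]; [:: 2; 0; 1]]%N.
Definition Tzww := [:: [:: 0; 4; 5]; [:: 0; 3; 6]; [:: 1; 3; 5]; [:: 1; 4; 6];
                       [:: 2; 3; 4]; [:: 2; 5; 6]]%N.
Definition Twzw := [:: [:: 4; 0; 5]; [:: 5; 0; 4]; [:: 3; 0; 6]; [:: 6; 0; 3]; [:: 3; 1; 5];
                       [:: 5; 1; 3]; [:: 4; 1; 6]; [:: 6; 1; 4]; [:: 3; 2; 4]; [:: 4; 2; 3];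
                       [:: 5; 2; 6]; [:: 6; 2; 5]]%N.

Section NormalForms.
Let L := pvar 2.
Let s2 := psquare psym.
Let q := pminors.
Let H := psquare pgen.

Lemma trace_cal1 : ptrace inst_cal Tzzz =
  plinear [:: (192, [:: L; L; s2]); (240, [:: L; L; q]); (-288, [:: L; q]); (-144, [:: q])].
Proof. by vm_compute. Qed.

Lemma trace_cal2 : ptrace inst_cal Tzww =
  plinear [:: (216, [:: s2]); (-336, [:: L; s2]); (-72, [:: L; L; s2]); (480, [:: L; q]);
              (-144, [:: q]); (-144, [:: L; L; q]); (216, [:: L; L; H]); (-432, [:: L; H]);
              (216, [:: H])].
Proof. by vm_compute. Qed.

Lemma trace_cal3 : ptrace inst_cal Twzw =
  plinear [:: (-144, [:: s2]); (-384, [:: L; s2]); (528, [:: L; L; s2]); (288, [:: q]);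
              (-768, [:: L; q]); (480, [:: L; L; q]); (-144, [:: H]); (144, [:: L; L; H])].
Proof. by vm_compute. Qed.
End NormalForms.

Section Symmetric.
Variables (R : realType) (env : nat -> R).

Lemma ev_ptrace (I : nat -> nat -> nat -> pol) ts :
  (forall a u v, (a < 7)%N -> (u < 7)%N -> (v < 7)%N -> ev env (I a u v) = 0) ->
  all (fun t => (size t == 3) && all (gtn 7) t) ts -> ev env (ptrace I ts) = 0.
Proof.
move=> I0 /allP tsP; rewrite ev_sum big_map big_seq big1// => t /tsP.
case: t => [|a [|u [|v [|//]]]] //= /and4P[a7 u7 v7 _].
by rewrite ev_sgn ev_mul I0 ?mulr0.
Qed.

(** 2 (|S|^2 - q) is the sum of the squares of the differences S_ii - S_jj and of
6 S_ij^2, over i < j: if it vanishes, S is a multiple of the identity. *)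
Lemma isotropic_diagonal : ev env (psquare psym) = ev env pminors ->
  ev env (psum [seq psym i i | i <- iota 0 3]) = 3 * ev env (psym 2 2).
Proof.
have -> : psquare psym = plinear [:: (1, [:: psym 0 0; psym 0 0]); (1, [:: psym 1 1; psym 1 1]);
   (1, [:: psym 2 2; psym 2 2]); (2, [:: psym 0 1; psym 0 1]); (2, [:: psym 0 2; psym 0 2]);
   (2, [:: psym 1 2; psym 1 2])] by vm_compute.
have -> : pminors = plinear [:: (1, [:: psym 0 0; psym 1 1]); (1, [:: psym 0 0; psym 2 2]);
   (1, [:: psym 1 1; psym 2 2]); (-1, [:: psym 0 1; psym 0 1]); (-1, [:: psym 0 2; psym 0 2]);
   (-1, [:: psym 1 2; psym 1 2])] by vm_compute.
rewrite ev_sum !ev_plinear !(big_cons, big_nil, big_map).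
move: (ev env (psym 0 0)) (ev env (psym 1 1)) (ev env (psym 2 2)) (ev env (psym 0 1))
  (ev env (psym 0 2)) (ev env (psym 1 2)) => a b c d e f /= E.
have : (a - c) ^+ 2 + (b - c) ^+ 2 = 0.
  apply: le_anti; rewrite addr_ge0 ?sqr_ge0// andbT.
  have := sqr_ge0 (a - b); have := sqr_ge0 d; have := sqr_ge0 e; have := sqr_ge0 f.
  lra.
move=> /eqP; rewrite paddr_eq0 ?sqr_ge0// !sqrf_eq0 => /andP[/eqP ac /eqP bc].
lra.
Qed.
End Symmetric.

Lemma rank_one (F : fieldType) n (eta : nat -> nat -> F) :
  (forall x y i j, (x < n)%N -> (y < n)%N -> (i < n)%N -> (j < n)%N ->
     eta x i * eta y j = eta x j * eta y i) ->
  exists w t : nat -> F, forall x i, (x < n)%N -> (i < n)%N -> eta x i = t i * w x.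
Proof.
move=> minor0.
have [[y [j [yn jn nz]]]|none] := pselect (exists y j, [/\ (y < n)%N, (j < n)%N & eta y j != 0]).
  exists (eta ^~ j), (fun i => eta y i / eta y j) => x i xn i_n.
  apply: (mulIf nz); rewrite minor0// mulrAC divfK// mulrC//.
exists (fun=> 0), (fun=> 0) => x i xn i_n; rewrite mulr0.
by apply: contrapT => /eqP nz; apply: none; exists x, i.
Qed.

Section Calibrated.
Variables (R : realType) (V : vectType R) (br : {bilinear V -> V -> V}).
Variables (phi : cochain R V 3) (g : {dot V for idfun}) (vol : cochain R V 7).
Variables (lambda : R) (nabla : V -> V -> V) (h : nat -> V).
Hypothesis br_alt : forall x, br x x = 0.
Hypotheses (dimV : \dim {: V} = 7%N) (oh : orthonormal_frame g 7 h).
Hypotheses (kvol : kform vol) (vol1 : vol [tuple h i | i < 7] = 1).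
Hypotheses (lphi : multilinear phi) (cocl : coclosed br phi g vol).
Hypothesis conn : G2_connection br phi g vol lambda nabla.
Hypothesis inst : G2_instanton br phi g vol nabla.
Hypothesis rP : forall env, represents h env pphi_cal phi.
Hypothesis cen : forall i y, (i < 3)%N -> br (h i) y = 0.
Hypothesis der : forall x y k, (3 <= k < 7)%N -> g (br x y) (h k) = 0.

Local Notation C3 := (structure_constant br g h).

(** At c = 1 and s = 0 the relations of [coclosed_dim3] are the symmetry of the
half-sum matrix S. *)
Lemma split_bracket : exists env,
  env 2%N = lambda /\ represents_bracket g br h env (pbracket (pbr_cal psym)).
Proof.
have cs1 : (1 : R) ^+ 2 + 0 ^+ 2 = 1 by rewrite expr1n expr0n addr0.
have rcs : represents h (free_env br g h 3 1 0) pphi_cs phi.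
  move=> l sl l7; rewrite -(rP (nth 0 [::]) sl l7).
  by apply: twisted_ext; rewrite ?ev_var ?ev_const.
have [[S1 S2 S3] _] := coclosed_dim3 br_alt dimV oh kvol vol1 lphi cocl cs1 rcs cen der.
rewrite !mul1r in S1 S2 S3.
(* variables 0 and 1 do not occur in the calibrated models *)
pose env := nth 0 [:: 0; 0; lambda;
  (C3 3 6 0 + C3 4 5 0) / 2; (C3 4 6 0 - C3 3 5 0) / 2; (C3 5 6 0 + C3 3 4 0) / 2;
  (C3 4 6 1 - C3 3 5 1) / 2; (C3 5 6 1 + C3 3 4 1) / 2; (C3 5 6 2 + C3 3 4 2) / 2;
  (C3 3 6 0 - C3 4 5 0) / 2; (C3 4 6 0 + C3 3 5 0) / 2; (C3 5 6 0 - C3 3 4 0) / 2;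
  (C3 3 6 1 - C3 4 5 1) / 2; (C3 4 6 1 + C3 3 5 1) / 2; (C3 5 6 1 - C3 3 4 1) / 2;
  (C3 3 6 2 - C3 4 5 2) / 2; (C3 4 6 2 + C3 3 5 2) / 2; (C3 5 6 2 - C3 3 4 2) / 2].
exists env; split=> //.
apply: represents_pbracket => // [x i j x3 /andP[ij j7]|x i j]; last exact: der.
have [i3|i3] := ltnP i 3.
  rewrite /structure_constant cen// metric0l.
  by case: i i3 ij => [|[|[|//]]].
case: i i3 ij => [|[|[|[|[|[|i]]]]]] // _ ij; case: j j7 ij => [|[|[|[|[|[|[|j]]]]]]] // _ _;
  case: x x3 => [|[|[|//]]] _; normalize_lhs; rewrite /env /= ?zc1 ?zcN1; lra.
Qed.

Lemma ev_inst_calibrated env B L T :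
  ev env L = lambda -> represents_bracket g br h env (pbracket B) ->
  T = tab3 (pconn pphi_cal (pbracket B) L (ptau pphi_cal (pbracket B))) ->
  alternatingb 4 (pdphi pphi_cal (pbracket B)) ->
  (forall i j k, (i < 7)%N -> (j < 7)%N -> (k < 7)%N ->
     ev env (get3 T i j k) = 12 * g (nabla (h i) (h j)) (h k)) /\
  (forall a u v, (a < 7)%N -> (u < 7)%N -> (v < 7)%N ->
     ev env (pinst pphi_cal (pbracket B) (get3 T) a u v) = 0).
Proof.
move=> eL rB TE aP.
have evD i j k : (i < 7)%N -> (j < 7)%N -> (k < 7)%N ->
    ev env (get3 T i j k) = 12 * g (nabla (h i) (h j)) (h k).
  move=> i7 j7 k7; rewrite TE get3E//.
  exact: (ev_conn dimV oh kvol vol1 lphi (@rP env) alternating_phi_cal rB aP eL conn i7 j7 k7).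
split=> // a u v a7 u7 v7.
exact: (ev_inst dimV oh kvol vol1 lphi (@rP env) alternating_phi_cal rB alternating_psi_cal
  conn evD br_alt a7 u7 v7 inst).
Qed.

(** All 2 x 2 minors of eta vanish by [inst_skew], so that its columns, which are the
brackets of frame vectors up to sign, are proportional. *)
Lemma skew_line env : lambda = 1 ->
  represents_bracket g br h env (pbracket (pbr_cal psym)) ->
  (forall i j, (i < 3)%N -> (j < 3)%N -> ev env (psym i j) = 0) ->
  exists w, forall x y, br x y \in <[w]>%VS.
Proof.
move=> L1 rB a0.
have rB0 : represents_bracket g br h env (pbracket pbr_skew).
  move=> i j x i7 j7 x7; rewrite -rB// /pbracket; case: ltnP => // x3.
  have E k l : ev env (pbr_skew x k l) = ev env (pbr_cal psym x k l).
    rewrite /pbr_skew /pbr_cal; case: k => [|[|[|[|[|[|k]]]]]] //; case: l => [|[|[|[|[|[|[|l]]]]]]] //;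
      by rewrite !(ev_add, ev_scale) a0 // ?mulr0.
  by case: ifP => _; [|case: ifP => _ //]; rewrite ?ev_scale E.
have e1 : ev env (pconst 1) = lambda by rewrite ev_const L1.
have [_ I] := ev_inst_calibrated e1 rB0 conn_skewE alternating_dphi_skew.
pose eta x i := ev env (pgen x i).
have minor0 a k : (a < 3)%N -> (k < 3)%N ->
    let: (x, y) := nth (0, 0)%N two_of_three a in
    let: (i, j) := nth (0, 0)%N two_of_three k in eta x i * eta y j = eta x j * eta y i.
  move=> a3 k3.
  have := inst_skew => /allP/(_ a); rewrite mem_iota => /(_ a3)/allP/(_ k).
  rewrite mem_iota => /(_ k3).
  case: (nth _ _ a) => x y; case: (nth _ _ k) => i j /eqP/(congr1 (ev env)).
  rewrite I//; [|lia|lia] => /esym/eqP; rewrite ev_scale ev_add ev_scale !ev_mul zcN1 mulN1r.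
  by rewrite mulf_eq0 subr_eq0 => /orP[|/eqP//]; case: (k == 0%N); rewrite /zc intr_eq0.
have [w [t wt]] : exists w t : nat -> R, forall x i, (x < 3)%N -> (i < 3)%N -> eta x i = t i * w x.
  apply: rank_one => x y i j x3 y3 i3 j3.
  have [->|xy] := eqVneq x y; first by rewrite mulrC.
  have [->//|ij] := eqVneq i j.
  have {minor0} M a k := @minor0 a k.
  have := M 0%N 0%N isT isT; have := M 0%N 1%N isT isT; have := M 0%N 2%N isT isT.
  have := M 1%N 0%N isT isT; have := M 1%N 1%N isT isT; have := M 1%N 2%N isT isT.
  have := M 2%N 0%N isT isT; have := M 2%N 1%N isT isT; have := M 2%N 2%N isT isT.
  rewrite /=; clear M I; move: x y i j x3 y3 i3 j3 xy ij.
  case=> [|[|[|//]]] [|[|[|//]]] // [|[|[|//]]] [|[|[|//]]] // _ _ _ _ _ _; lra.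
pose W := \sum_(x < 7) (if (x < 3)%N then w x else 0) *: h x.
have line i j : (i < 7)%N -> (j < 7)%N -> br (h i) (h j) \in <[W]>%VS.
  move=> i7 j7.
  have [k kE] : exists k, forall x, (x < 3)%N -> ev env (pbracket pbr_skew i j x) = k * w x.
    have E x k : (x < 3)%N -> (k < 3)%N -> ev env (pgen x k) = t k * w x by exact: wt.
    have EN x k : (x < 3)%N -> (k < 3)%N -> ev env (pneg (pgen x k)) = - t k * w x.
      by move=> x3 k3; rewrite ev_scale E// mulN1r mulNr.
    have Blt k l : (k < l < 7)%N ->
        exists c, forall x, (x < 3)%N -> ev env (pbr_skew x k l) = c * w x.
      case/andP=> kl l7; rewrite /pbr_skew.
      case: k kl => [|[|[|[|[|[|k]]]]]] //; case: l l7 => [|[|[|[|[|[|[|l]]]]]]] // _ _;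
        try by exists 0 => x _; rewrite mul0r.
      + by exists (- t 2%N) => x x3; rewrite -EN.
      + by exists (t 1%N) => x x3; rewrite -E.
      + by exists (t 0%N) => x x3; rewrite -E.
      + by exists (- t 0%N) => x x3; rewrite -EN.
      + by exists (t 1%N) => x x3; rewrite -E.
      + by exists (t 2%N) => x x3; rewrite -E.
    rewrite /pbracket; case: (ltngtP i j) => [ij|ji|_].
    - by have [|c cE] := Blt i j; [rewrite ij|exists c => x x3; rewrite x3 cE].
    - have [|c cE] := Blt j i; first by rewrite ji.
      by exists (- c) => x x3; rewrite x3 ev_scale cE// mulN1r mulNr.
    - by exists 0 => x x3; rewrite x3 mul0r.
  apply/vlineP; exists k; apply: (frame_inj dimV oh) => x x7.
  rewrite -(rB0 i j x)// metricZl (frame_coord oh _ (Ordinal x7)) /=.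
  by case: ltnP => x3; [exact: kE|rewrite /pbracket ltnNge x3 mulr0].
by exists W; exact: (bracket_subspace dimV oh line).
Qed.

(** By [calibrated_scalars] the bracket is zero, or lambda = 1 and S is a multiple p
of the identity. If p = 0 [skew_line] applies. If p <> 0, then phi /\ d phi is 12 p
times the volume form, and half the sum of the z3-components of the brackets of
w1, w2 and of w3, t is p. *)
Lemma calibrated_instanton :
  (exists w, forall x y, br x y \in <[w]>%VS) \/
  [/\ parallel nabla phi, exists v, wedge phi (ced br phi) v <> 0 &
      exists x y, g (br x y) (h 2) != 0].
Proof.
have [env [e2 rB]] := split_bracket.
have eL : ev env (pvar 2) = lambda by rewrite ev_var e2.
have [_ I] := ev_inst_calibrated eL rB conn_calE alternating_dphi_cal.
have F1 := @ev_ptrace _ env inst_cal Tzzz I isT.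
have F2 := @ev_ptrace _ env inst_cal Tzww I isT.
have F3 := @ev_ptrace _ env inst_cal Twzw I isT.
rewrite trace_cal1 ev_plinear in F1; rewrite trace_cal2 ev_plinear in F2.
rewrite trace_cal3 ev_plinear in F3.
rewrite !(big_cons, big_nil) in F1 F2 F3.
have s2ge0 := psquare_ge0 env psym; have Hge0 := psquare_ge0 env pgen.
have [[L1 sq]|[s0 H0]] : (lambda = 1 /\ ev env (psquare psym) = ev env pminors) \/
    (ev env (psquare psym) = 0 /\ ev env (psquare pgen) = 0).
  move: (ev env (psquare psym)) (ev env pminors) (ev env (psquare pgen)) (ev env (pvar 2)) eL F1 F2 F3 s2ge0 Hge0.
  move=> s2 q H L -> /= F1 F2 F3 s2ge0 Hge0.
  by apply: calibrated_scalars => //; lra.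
- have tE := isotropic_diagonal sq; have stE := psquare_trace env.
  have [s0|s0] := eqVneq (ev env (psquare psym)) 0.
    left; apply: (skew_line L1 rB) => i j; exact: psquare_eq0.
  right.
  have t0 : ev env (psum [seq psym i i | i <- iota 0 3]) != 0.
    apply: contra_neq s0 => t0; move: stE; rewrite t0 -sq.
    by move: (ev env _) => u; rewrite expr0n /=; lra.
  have e1 : ev env (pconst 1) = lambda by rewrite ev_const L1.
  have [evD _] := ev_inst_calibrated e1 rB conn_oneE alternating_dphi_cal.
  split.
  + apply: (parallel_frame dimV oh kvol lphi (@rP env) conn evD) => x i j k x7 i7 j7 k7.
    have := covd_one => /allP/(_ x); rewrite mem_iota => /(_ x7)/allP/(_ i).
    rewrite mem_iota => /(_ i7)/allP/(_ j); rewrite mem_iota => /(_ j7)/allP/(_ k).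
    by rewrite mem_iota => /(_ k7)/nilP->.
  + exists [tuple h i | i < 7].
    rewrite -(ev_phi_dphi dimV oh lphi (@rP env) alternating_phi_cal rB alternating_dphi_cal).
    by rewrite phi_dphi_cal ev_scale => /eqP; rewrite mulf_eq0 (negbTE t0) orbF /zc intr_eq0.
  + apply: contrapT => none.
    have N i j : C3 i j 2 = 0.
      by apply: contrapT => /eqP n0; apply: none; exists (h i), (h j).
    move/eqP: t0; apply; rewrite tE.
    have := rB 5%N 6%N 2%N isT isT isT; have := rB 3%N 4%N 2%N isT isT isT.
    rewrite -!/(C3 _ _ _) !N /= => a b; lra.
- left; exists 0; apply: (bracket_subspace dimV oh) => i j i7 j7.
  suff -> : br (h i) (h j) = 0 by exact: mem0v.
  apply: (frame_inj dimV oh) => x x7; rewrite metric0l -rB// /pbracket.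
  case: ltnP => // x3.
  have E k l : ev env (pbr_cal psym x k l) = 0.
    have A m : (m < 3)%N -> ev env (psym x m) = 0 by move=> m3; exact: psquare_eq0.
    have B m : (m < 3)%N -> ev env (pgen x m) = 0 by move=> m3; exact: psquare_eq0.
    rewrite /pbr_cal; case: k => [|[|[|[|[|[|k]]]]]] //; case: l => [|[|[|[|[|[|[|l]]]]]]] //;
      by rewrite !(ev_add, ev_scale) A // B // ?mulr0 add0r.
  by case: ifP => _; [|case: ifP => _ //]; rewrite ?ev_scale E ?mulr0.
Qed.
End Calibrated.

(** * Frames through the derived algebra *)
Section TwistedFrames.
Variables (R : realType) (V : vectType R).
Variables (phi : cochain R V 3) (g : {dot V for idfun}) (vol : cochain R V 7).
Hypotheses (dimV : \dim {: V} = 7%N) (G2 : G2_structure phi) (metric : G2_metric phi g vol).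

Let lphi : multilinear phi. Proof. exact: G2_multilinear. Qed.
Let aphi h : alternating predT 3 (frame_eval h phi). Proof. exact: G2_alternating. Qed.

Definition twisted c s h := [/\ orthonormal_frame g 7 h, vol [tuple h i | i < 7] = 1 &
  represents h (nth 0 [:: c; s]) pphi_cs phi].

Lemma adapted_frame_exists : exists2 f,
  orthonormal_frame g 7 f & forall env, represents f env pphi_cal phi.
Proof.
have [f rf] := G2_frame g dimV G2 (nth 0 [::]).
have rf' env : represents f env pphi_cal phi.
  by move=> l sl l7; rewrite -rf//; apply: twisted_ext; rewrite ?ev_const.
have rcs : represents f (nth 0 [:: 1; 0]) pphi_cs phi.
  by move=> l sl l7; rewrite -rf//; apply: twisted_ext; rewrite ?ev_var ?ev_const.
have c1 : (1 : R) ^+ 2 + 0 ^+ 2 = 1 by rewrite expr1n expr0n addr0.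
have [onf _] := adapted_orthonormal metric c1 rcs.
by exists f.
Qed.

Lemma twisted_frame_exists f x y m c s :
  orthonormal_frame g 7 f -> (forall env, represents f env pphi_cal phi) ->
  g x x = 1 -> g y y = 1 -> g m m = 1 -> g x y = 0 -> g x m = 0 -> g y m = 0 ->
  phi [tuple x; y; m] = 0 -> c ^+ 2 + s ^+ 2 = 1 ->
  exists2 h, twisted c s h & [/\ h 0%N = x, h 1%N = y & h 2%N = c *: cross phi f x y + s *: m].
Proof.
move=> onf rf xx yy mm xy xm ym Fxym cs1; pose env := nth 0 [:: c; s].
have rh := represents_twisted dimV onf lphi (rf (nth 0 [::])) aphi xx yy mm xy xm ym Fxym
  (env' := env) erefl erefl cs1.
exists (twisted_frame phi f x y m env); last exact: twisted_frameE.
by have [oh vh] := adapted_orthonormal metric cs1 rh.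
Qed.

(** With x, y, w an orthonormal basis of U and p the cross product of x and y, one
has w = c p + r with r orthogonal to x, y and p, of squared norm 1 - c^2. Then m
is r normalised, or any unit vector orthogonal to x, y and p when r = 0. The sign
of w is chosen to make c nonnegative. *)
Lemma twisted_frame_dim3 (U : {vspace V}) : \dim U = 3%N ->
  exists c s h, [/\ 0 <= c, c ^+ 2 + s ^+ 2 = 1, twisted c s h &
    forall i, (i < 3)%N -> h i \in U].
Proof.
move=> dimU; have [f onf rf] := adapted_frame_exists.
have [z oz zU] : exists2 z, orthonormal_frame g 3 z & forall i, (i < 3)%N -> z i \in U.
  by apply: orthonormal_in; rewrite dimU.
pose x := z 0%N; pose y := z 1%N.
have xx : g x x = 1 by exact: oz.
have yy : g y y = 1 by exact: oz.
have xy : g x y = 0 by exact: oz.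
have [w [wU ww xw yw Fw]] : exists w, [/\ w \in U, g w w = 1, g x w = 0, g y w = 0 &
    0 <= phi [tuple x; y; w]].
  have [F0|F0] := leP 0 (phi [tuple x; y; z 2%N]).
    by exists (z 2%N); split=> //; [exact: zU|exact: oz|exact: oz|exact: oz].
  have FN : phi [tuple x; y; - z 2%N] = - phi [tuple x; y; z 2%N].
    by rewrite -!(crossE dimV onf lphi) metricNr.
  exists (- z 2%N); split; rewrite ?memvN ?metricNr ?metricNl ?opprK ?FN ?oppr_ge0 ?(ltW F0)//.
  - exact: zU.
  - exact: oz.
  - by rewrite oz ?oppr0.
  - by rewrite oz ?oppr0.
pose p := cross phi f x y; pose c := phi [tuple x; y; w].
have pE v : g p v = phi [tuple x; y; v] by exact: crossE.
have pp : g p p = 1 by rewrite (cross_isometry dimV onf lphi (rf (nth 0 [::])) aphi).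
have px : g p x = 0 by rewrite pE phi_xyx.
have py : g p y = 0 by rewrite pE phi_yxx.
pose r := w - c *: p.
have wp : g w p = c by rewrite metricC pE.
have rr : g r r = 1 - c ^+ 2.
  by rewrite !(metricBl, metricBr, metricZl, metricZr) ww pp wp metricC wp; ring.
have c1 : c ^+ 2 <= 1 by rewrite -subr_ge0 -rr metric_ge0.
pose s := Num.sqrt (1 - c ^+ 2).
have cs1 : c ^+ 2 + s ^+ 2 = 1 by rewrite sqr_sqrtr ?subr_ge0// addrC subrK.
have [m [mm xm ym pm rm]] : exists m,
    [/\ g m m = 1, g x m = 0, g y m = 0, g p m = 0 & r = s *: m].
  have [s0|s0] := eqVneq s 0.
    have r0 : r = 0.
      apply/eqP; apply: contraT => rn0; have := metric_gt0 g rn0.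
      by rewrite rr -[1 - _]sqr_sqrtr ?subr_ge0// -/s s0 expr0n ltxx.
    have o3 : orthonormal_frame g 3 (nth 0 [:: x; y; p]).
      have yx : g y x = 0 by rewrite metricC.
      have xp : g x p = 0 by rewrite metricC.
      have yp : g y p = 0 by rewrite metricC.
      by move=> [|[|[|//]]] [|[|[|//]]].
    have [u [_ uu uh]] := unit_orthogonal (U := fullv) o3 (fun i _ => memvf _) ltac:(by rewrite dimV).
    have [xu yu pu] : [/\ g x u = 0, g y u = 0 & g p u = 0].
      by split; rewrite metricC; [exact: (uh 0%N)|exact: (uh 1%N)|exact: (uh 2%N)].
    by exists u; split; rewrite // s0 scale0r.
  have rx : g x r = 0 by rewrite metricBr metricZr xw metricC px mulr0 subr0.
  have ry : g y r = 0 by rewrite metricBr metricZr yw metricC py mulr0 subr0.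
  have rp : g p r = 0 by rewrite metricBr metricZr pE pp mulr1 subrr.
  exists (s^-1 *: r); rewrite !(metricZl, metricZr) rx ry rp !mulr0; split=> //.
    by rewrite rr -[1 - _]sqr_sqrtr ?subr_ge0// -/s expr2 mulKf ?mulVf.
  by rewrite scalerA divff// scale1r.
have Fm : phi [tuple x; y; m] = 0 by rewrite -pE.
have [h th [h0 h1 h2]] := twisted_frame_exists onf rf xx yy mm xy xm ym Fm cs1.
exists c, s, h; split=> //; case=> [|[|[|//]]] _; rewrite ?h0 ?h1 ?h2; try exact: zU.
by rewrite -rm addrC subrK.
Qed.

Lemma twisted_frame_dim2 (U : {vspace V}) : \dim U = 2%N ->
  exists2 h, twisted 1 0 h & forall i, (i < 2)%N -> h i \in U.
Proof.
move=> dimU; have [f onf rf] := adapted_frame_exists.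
have [z oz zU] : exists2 z, orthonormal_frame g 2 z & forall i, (i < 2)%N -> z i \in U.
  by apply: orthonormal_in; rewrite dimU.
pose x := z 0%N; pose y := z 1%N.
have xx : g x x = 1 by exact: oz.
have yy : g y y = 1 by exact: oz.
have xy : g x y = 0 by exact: oz.
pose p := cross phi f x y.
have pE v : g p v = phi [tuple x; y; v] by exact: crossE.
have o3 : orthonormal_frame g 3 (nth 0 [:: x; y; p]).
  have pp : g p p = 1 by rewrite (cross_isometry dimV onf lphi (rf (nth 0 [::])) aphi).
  have px : g p x = 0 by rewrite pE phi_xyx.
  have py : g p y = 0 by rewrite pE phi_yxx.
  have yx : g y x = 0 by rewrite metricC.
  have xp : g x p = 0 by rewrite metricC.
  have yp : g y p = 0 by rewrite metricC.
  by move=> [|[|[|//]]] [|[|[|//]]].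
have [m [_ mm mh]] := unit_orthogonal (U := fullv) o3 (fun i _ => memvf _) ltac:(by rewrite dimV).
have xm : g x m = 0 by rewrite metricC; exact: (mh 0%N).
have ym : g y m = 0 by rewrite metricC; exact: (mh 1%N).
have Fm : phi [tuple x; y; m] = 0 by rewrite -pE metricC; exact: (mh 2%N).
have c1 : (1 : R) ^+ 2 + 0 ^+ 2 = 1 by rewrite expr1n expr0n addr0.
have [h th [h0 h1 _]] := twisted_frame_exists onf rf xx yy mm xy xm ym Fm c1.
by exists h => //; case=> [|[|//]] _; rewrite ?h0 ?h1; exact: zU.
Qed.
End TwistedFrames.

(** * The theorem *)
Theorem corollary4p6 (R : realType) (V : vectType R)
    (br : {bilinear V -> V -> V})
    (phi : cochain R V 3) (g : {dot V for idfun}) (vol : cochain R V 7)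
    (lambda : R) (nabla : V -> V -> V) :
  \dim {: V} = 7%N ->
  lie_bracket br ->
  two_step_nilpotent br ->
  \dim (derived br) = 2%N \/ \dim (derived br) = 3%N ->
  G2_structure phi ->
  G2_metric phi g vol ->
  coclosed br phi g vol ->
  G2_connection br phi g vol lambda nabla ->
  G2_instanton br phi g vol nabla ->
  [/\ calibrates phi g (derived br),
      ~ purely_coclosed br phi g vol &
      parallel nabla phi].
Proof.
move=> dimV [br_alt _] [der_n0 der_cen] dim_der G2 metric cocl conn inst.
have lphi := G2_multilinear G2; have kvol := metric.1.1.
have cenU z y : z \in derived br -> br z y = 0.
  move=> zU; rewrite (br_anti br_alt); apply/eqP; rewrite oppr_eq0 -memv0 -der_cen.
  by apply: memv_liev; rewrite ?memvf.
have brU x y : br x y \in derived br by apply: memv_liev; rewrite memvf.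
have dim_gt1 : (1 < \dim (derived br))%N by case: dim_der => ->.
have no_line w : ~ (forall x y, br x y \in <[w]>%VS).
  move=> brw; have /dimvS : (derived br <= <[w]>)%VS by apply/lievP => x y _ _.
  by rewrite dim_vline leqNgt (leq_ltn_trans _ dim_gt1)// leq_b1.
case: dim_der => dimU.
  have [h [oh vol1 rP] hU] := twisted_frame_dim2 dimV G2 metric dimU.
  have rP1 env : represents h env pphi_cal phi.
    by move=> l sl l7; rewrite -rP//; apply: twisted_ext; rewrite ?ev_var ?ev_const.
  have os : orthonormal g [:: h 0%N; h 1%N].
    apply/(@orthonormal_tupleP _ _ _ 2 [tuple h 0%N; h 1%N]).
    by move=> [|[|//]] [|[|//]] _ _; rewrite /= oh.
  have bs : basis_of (derived br) [:: h 0%N; h 1%N].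
    apply: orthonormal_seq os _ _ => // v; rewrite !inE => /orP[]/eqP->; exact: hU.
  have der x y k : (2 <= k < 7)%N -> g (br x y) (h k) = 0.
    case/andP=> k2 k7; apply: (orthogonal_span bs) (brU x y) => v.
    by rewrite !inE => /orP[]/eqP->; rewrite oh//; case: k k2 k7 => [|[|]].
  have cen i y : (i < 2)%N -> br (h i) y = 0 by move=> i2; exact/cenU/hU.
  have cen2 := coclosed_dim2 br_alt dimV oh kvol vol1 lphi cocl (rP1 (nth 0 [::])) cen der.
  have cen3 i y : (i < 3)%N -> br (h i) y = 0.
    by rewrite ltnS leq_eqVlt => /orP[/eqP->|/cen].
  have der3 x y k : (3 <= k < 7)%N -> g (br x y) (h k) = 0.
    by case/andP=> k3 k7; apply: der; rewrite k7 ltnW.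
  have [[w /no_line//]|[_ _ [x [y]]]] :=
    calibrated_instanton br_alt dimV oh kvol vol1 lphi cocl conn inst rP1 cen3 der3.
  by rewrite der ?eqxx.
have [c [s [h [c0 cs1 [oh vol1 rP] hU]]]] := twisted_frame_dim3 dimV G2 metric dimU.
have os : orthonormal g [:: h 0%N; h 1%N; h 2%N].
  apply/(@orthonormal_tupleP _ _ _ 3 [tuple h 0%N; h 1%N; h 2%N]).
  by move=> [|[|[|//]]] [|[|[|//]]] _ _; rewrite /= oh.
have bs : basis_of (derived br) [:: h 0%N; h 1%N; h 2%N].
  by apply: orthonormal_seq os _ _ => // v; rewrite !inE => /or3P[]/eqP->; exact: hU.
have der x y k : (3 <= k < 7)%N -> g (br x y) (h k) = 0.
  case/andP=> k3 k7; apply: (orthogonal_span bs) (brU x y) => v.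
  by rewrite !inE => /or3P[]/eqP->; rewrite oh//; case: k k3 k7 => [|[|[|]]].
have cen i y : (i < 3)%N -> br (h i) y = 0 by move=> i3; exact/cenU/hU.
have [s0|s0] := eqVneq s 0; last first.
  (* the algebra would be abelian *)
  case: (no_line 0); apply: (bracket_subspace dimV oh) => i j i7 j7.
  by rewrite (noncalibrated_no_instanton br_alt dimV oh kvol vol1 lphi cocl conn inst cs1 rP cen der s0) ?mem0v.
have c1 : c = 1.
  by apply/eqP; rewrite -(@pexpr_eq1 _ c 2)//; move/eqP: cs1; rewrite s0 expr0n addr0.
have rP1 env : represents h env pphi_cal phi.
  by move=> l sl l7; rewrite -rP//; apply: twisted_ext; rewrite ?ev_var ?ev_const /= ?c1 ?s0.
have [[w /no_line//]|[par [v vn0] _]] :=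
  calibrated_instanton br_alt dimV oh kvol vol1 lphi cocl conn inst rP1 cen der.
split=> //; last by case=> _ /(_ v).
split=> //; exists (h 0%N), (h 1%N), (h 2%N); split=> //; left.
have := rP [:: 0; 1; 2]%N erefl isT; rewrite /frame_eval.
have -> : [tuple h (nth 0%N [:: 0; 1; 2]%N i) | i < 3] = [tuple h 0%N; h 1%N; h 2%N].
  by apply: eq_from_tnth => -[[|[|[|//]]]] ?; rewrite tnth_mktuple.
by move=> <-; rewrite -c1; normalize_lhs; rewrite /= zc1 mul1r mulr1 addr0.
Qed.
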